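(* Let $k$ be a perfect field of characteristic $p>0$, let $R$ be an equidimensional standard graded ring over $k$ of dimension $d\ge2$, and let $I\subseteq J$ be two graded ideals of $R$ with $\ell(R/I)<\infty$. Then $HKd(R,I)=HKd(R,J)$ if and only if $J\subseteq I^{*}$, where $I^{*}$ denotes the tight closure of $I$ in $R$.
   Context: A standard graded ring over $k$ is a Noetherian graded ring $R=\bigoplus_{m\ge0}R_m$ with $R_0=k$, generated over $k$ by $R_1$. For a homogeneous ideal $I$ with $\ell(R/I)<\infty$, the Hilbert-Kunz density function $HKd(R,I):\mathbb{R}\to\mathbb{R}$ is $$HKd(R,I)(x)=\lim_{n\to\infty}\frac{1}{q^{d-1}}\ell(R/I^{[q]})_{\lfloor xq\rfloor},\qquad q=p^n,$$ where $I^{[q]}$ is the ideal generated by $q$-th powers of elements of $I$ and the subscript denotes the graded component (the limit exists for every $x$). *)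

(* Defs.v *)
From mathcomp Require Import all_boot all_order all_algebra.
From mathcomp Require Import ring_quotient.
From mathcomp Require Import all_classical all_reals all_analysis.

Set Implicit Arguments.
Unset Strict Implicit.
Unset Printing Implicit Defensive.
Import Order.TTheory GRing.Theory Num.Theory.
Import numFieldNormedType.Exports.

Local Open Scope classical_set_scope.
Local Open Scope ring_scope.

Definition perfect_char (p : nat) (k : fieldType) : Prop :=
  p \in [pchar k] /\ forall a : k, exists b : k, b ^+ p = a.

Definition submodule (A : nzRingType) (M : lmodType A) (N : set M) : Prop :=
  submod_closed (mem N).

(* Unlike the library's [idealr_closed], this allows the unit ideal. *)
Definition ideal (R : comNzRingType) (I : set R) : Prop :=
  @submodule R R^o I.

Definition prime_ideal (R : comNzRingType) (P : set R) : Prop :=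
  idealr_closed (mem P) /\ prime_idealr_closed (mem P).

Definition ideal_gen (R : comNzRingType) (X : set R) : set R :=
  smallest (@ideal R) X.

(* c 0 `<` c 1 `<` ... `<` c n; the values of c beyond n are irrelevant. *)
Definition strict_chain (T : Type) (S : set (set T)) (n : nat)
    (c : nat -> set T) : Prop :=
  (forall i : nat, (i <= n)%N -> S (c i)) /\
  (forall i : nat, (i < n)%N -> c i `<` c i.+1).

(* The length of the subquotient P / N, for submodules N `<=` P of M: the
   supremum, possibly +oo, of the lengths of the chains of submodules from N
   to P. *)
Definition qlength (K : realType) (A : nzRingType) (M : lmodType A)
    (N P : set M) : \bar K :=
  ereal_sup [set n%:R%:E | n in [set n : nat |
    exists c : nat -> set M,
      [/\ strict_chain (@submodule A M) n c, c 0%N = N & c n = P]]].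

(* The Krull dimension of R / I, in terms of the primes of R containing I. *)
Definition krull_dim (K : realType) (R : comNzRingType) (I : set R) : \bar K :=
  ereal_sup [set n%:R%:E | n in [set n : nat |
    exists c : nat -> set R,
      strict_chain [set P | prime_ideal P /\ I `<=` P] n c]].

Definition minimal_prime (R : comNzRingType) (P : set R) : Prop :=
  prime_ideal P /\ forall Q : set R, prime_ideal Q -> Q `<=` P -> Q = P.

Definition equidimensional (K : realType) (R : comNzRingType) : Prop :=
  forall P : set R, minimal_prime P -> krull_dim K P = krull_dim K [set (0 : R)].

Definition noetherian (R : comNzRingType) : Prop :=
  forall I : set R, ideal I -> exists s : seq R, I = ideal_gen [set` s].

Definition is_grading (k : fieldType) (R : comAlgType k)
    (Rg : nat -> set R) : Prop :=
  [/\ forall m : nat, submodule (Rg m),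
      forall (m n : nat) (x y : R), Rg m x -> Rg n y -> Rg (m + n)%N (x * y),
      forall x : R, exists (n : nat) (f : nat -> R),
        (forall m : nat, Rg m (f m)) /\ x = \sum_(m < n) f m
    & forall (n : nat) (f : nat -> R), (forall m : nat, Rg m (f m)) ->
        \sum_(m < n) f m = 0 -> forall m : nat, (m < n)%N -> f m = 0].

Definition standard_graded (k : fieldType) (R : comAlgType k)
    (Rg : nat -> set R) : Prop :=
  [/\ noetherian R,
      is_grading Rg,
      Rg 0%N = range (fun a : k => a%:A : R)
    & smallest (fun A : set R => subalg_closed (mem A)) (Rg 1%N) = setT].

Definition graded_ideal (R : comNzRingType) (Rg : nat -> set R)
    (I : set R) : Prop :=
  ideal I /\
  forall x : R, I x -> exists (n : nat) (f : nat -> R),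
    (forall m : nat, (Rg m `&` I) (f m)) /\ x = \sum_(m < n) f m.

Definition frobenius_power (R : comNzRingType) (q : nat) (I : set R) : set R :=
  ideal_gen [set x ^+ q | x in I].

(* The component of degree m : int; it is zero in negative degrees. *)
Definition zcomp (R : comNzRingType) (Rg : nat -> set R) (m : int) : set R :=
  if m is Posz n then Rg n else [set 0].

(* The length over R_0 = k of (R / I)_m = R_m / (R_m `&` I). *)
Definition graded_length (K : realType) (k : fieldType) (R : comAlgType k)
    (Rg : nat -> set R) (I : set R) (m : int) : \bar K :=
  qlength K (zcomp Rg m `&` I : set R) (zcomp Rg m).

Definition colength (K : realType) (R : comNzRingType) (I : set R) : \bar K :=
  @qlength K R R^o I setT.

Definition HKd (K : realType) (p d : nat) (k : fieldType) (R : comAlgType k)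
    (Rg : nat -> set R) (I : set R) (x : K) : K :=
  lim ((fun n : nat =>
    fine (graded_length K Rg (frobenius_power (p ^ n) I)
            (Num.floor (x * (p ^ n)%:R)))
      / (p ^ n)%:R ^+ d.-1) @ \oo).

(* c ranges over the complement of the union of the minimal primes. *)
Definition tight_closure (p : nat) (R : comNzRingType) (I : set R) : set R :=
  [set x | exists c : R,
    (forall P : set R, minimal_prime P -> ~ P c) /\
    \forall n \near \oo, frobenius_power (p ^ n) I (c * x ^+ (p ^ n))].

(* Main.v *)
Require Import Defs.
From mathcomp Require Import all_boot all_order all_algebra.
From mathcomp Require Import all_classical all_reals all_analysis.
From mathcomp Require Import ring lra zify.

(* Write q = p ^ n and let m range over the degrees.  All lengths are dimensions
   of subquotients of graded pieces of R.

   If c * J^[q] is contained in I^[q] for all large q, the ideal of all such c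
   is homogeneous and avoids the minimal primes, so that its Hilbert function is
   O(m ^ (d - 2)); this bounds the difference of the two sequences by O(1 / q),
   whether or not they converge.

   Conversely, tight closure is tested modulo a minimal prime P.  Fix p ^ (d - 1)
   elements of R of one degree, independent over R ^ p modulo P, in a maximal
   independent family, and c with c ^ p * R inside the R ^ p-span of the family.
   Iterating this inclusion n times only costs c ^ 2, because
   1 + 1 / p + 1 / p ^ 2 + ... <= 2.  Hence c ^ 2 * y ^ D * z ^ q' not in
   I^[q'] + P forces q ^ (d - 1) independent multiples of z ^ (q' * q) modulo
   I^[q' * q] + P, all of the same degree x * q' * q for a fixed x in Z[1/p].
   At such an x the densities exist: modulo P the sequence
   dim ((I^[q] + P) / P)_(x * q) / q ^ (d - 1) is increasing up to O(1 / q), and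
   R, as a module over its q0-th powers with q0 large, agrees in dimension d
   with a direct sum of copies of the domains R / P. *)

Set Implicit Arguments.
Unset Strict Implicit.
Unset Printing Implicit Defensive.
Import Order.TTheory GRing.Theory Num.Theory.
Import numFieldNormedType.Exports.

Local Open Scope classical_set_scope.
Local Open Scope ring_scope.

(** No quotient is formed: dimensions are relative to a submodule of R, so that one free family can
    be read modulo I^[q], I^[q] + P or P. Working modulo a minimal prime P makes multiplication by
    an element outside P injective, which is what keeps families free there. Degrees shape the
    converse. The independent family has degree p * (p - 1) * kappa, so that products of p ^ i-th
    powers of its members, one for each i < n, have degree (p ^ n - 1) * D with D = p * kappa. The
    factor y ^ D, with y a linear form outside P, completes this to p ^ n * D. Together with the
    power of z, all degrees become X * p ^ n, and no rounding occurs at x = X / p ^ n1, where q' = p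
    ^ n1 is a power at which membership fails. As [lim] has a default value on divergent sequences,
    unequal limits can only be deduced after convergence has been proved; at such x the floors are
    exact, which makes the comparison of successive terms possible. R may have nilpotents, hence the
    passage to q0-th powers, which kill them. *)

(** * Linear algebra relative to a submodule *)

Section RelativeDimension.
Variables (k : fieldType) (E : lmodType k).
Implicit Types (U V W : set E) (s t : seq E).

Lemma submoduleP U : @submodule k E U <->
  U 0 /\ forall a x y, U x -> U y -> U (a *: x + y).
Proof.
split=> [[U0 UD]|[U0 UD]]; split.
- by move: U0; rewrite inE.
- by move=> a x y Ux Uy; have := UD a x y; rewrite !inE; apply.
- by rewrite inE.
- by move=> a x y; rewrite !inE; apply: UD.
Qed.

Lemma submodule0 U : @submodule k E U -> U 0.
Proof. by move=> /submoduleP[]. Qed.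

Lemma submoduleD U x y : @submodule k E U -> U x -> U y -> U (x + y).
Proof. by move=> /submoduleP[_ h] Ux Uy; rewrite -[x]scale1r; apply: h. Qed.

Lemma submoduleZ U a x : @submodule k E U -> U x -> U (a *: x).
Proof. by move=> /submoduleP[U0 h] Ux; rewrite -[_ *: _]addr0; apply: h. Qed.

Lemma submoduleN U x : @submodule k E U -> U x -> U (- x).
Proof. by move=> hU Ux; rewrite -scaleN1r; apply: submoduleZ. Qed.

Lemma submoduleB U x y : @submodule k E U -> U x -> U y -> U (x - y).
Proof. by move=> hU Ux Uy; apply: submoduleD => //; apply: submoduleN. Qed.

Lemma submodule_sum U (I : Type) (r : seq I) (Q : pred I) (F : I -> E) :
  @submodule k E U -> (forall i, Q i -> U (F i)) -> U (\sum_(i <- r | Q i) F i).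
Proof.
move=> hU h; elim/big_ind: _ => //; first exact: submodule0.
by move=> x y; apply: submoduleD.
Qed.

Lemma submoduleI U V : @submodule k E U -> @submodule k E V ->
  @submodule k E (U `&` V).
Proof.
move=> /submoduleP[U0 hU] /submoduleP[V0 hV]; apply/submoduleP; split=> //.
by move=> a x y [Ux Vx] [Uy Vy]; split; [apply: hU|apply: hV].
Qed.

(* [sp U s] is U + span s, [qfree U s] says that s is free modulo U, and [qd U V]
   is the dimension of (U + V) / U, where U need not be contained in V; its value
   is 0 when this dimension is infinite. *)
Fixpoint sp U s : set E :=
  if s is v :: s' then [set x | exists a : k, sp U s' (x - a *: v)] else U.

Fixpoint qfree U s : Prop :=
  if s is v :: s' then ~ sp U s' v /\ qfree U s' else True.

Definition qbasis U V s : Prop :=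
  [/\ forall v, v \in s -> V v, qfree U s & V `<=` sp U s].

Definition qfin U V : Prop := exists s, V `<=` sp U s.

Definition qd U V : nat :=
  xget 0%N [set n | exists s, qbasis U V s /\ size s = n].

Lemma sp_submodule U s : @submodule k E U -> @submodule k E (sp U s).
Proof.
move=> hU; elim: s => [//|v s /submoduleP[s0 hs]] /=.
apply/submoduleP; split=> [|a x y [b hb] [c hc]].
  by exists 0; rewrite scale0r subr0.
exists (a * b + c); have := hs a _ _ hb hc.
by rewrite scalerBr scalerA scalerDl opprD addrACA.
Qed.

Lemma sub_sp U s : U `<=` sp U s.
Proof.
elim: s => [//|v s IH] x Ux; exists 0.
by rewrite scale0r subr0; apply: IH.
Qed.

Lemma mem_sp U s v : @submodule k E U -> v \in s -> sp U s v.
Proof.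
move=> hU; elim: s => [//|w s IH]; rewrite inE => /orP[/eqP ->|vs].
  by exists 1; rewrite scale1r subrr; apply: submodule0; apply: sp_submodule.
by exists 0; rewrite scale0r subr0; apply: IH.
Qed.

Lemma sp_min U s W : @submodule k E W -> U `<=` W ->
  (forall v, v \in s -> W v) -> sp U s `<=` W.
Proof.
move=> hW UW; elim: s => [|v s IH] sW; first exact: UW.
move=> x /= [a xa]; rewrite -(subrK (a *: v) x); apply: submoduleD => //.
  by apply: IH => // w ws; apply: sW; rewrite inE ws orbT.
by apply: submoduleZ => //; apply: sW; rewrite inE eqxx.
Qed.

Lemma sp_cat U s t : sp U (s ++ t) = sp (sp U t) s.
Proof. by elim: s => [//|v s IH] /=; rewrite IH. Qed.

Lemma sp_subl U W s : U `<=` W -> sp U s `<=` sp W s.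
Proof.
move=> UW; elim: s => [//|v s IH] x /= [a xa]; exists a; exact: IH.
Qed.

Lemma sp_catl U s t : @submodule k E U -> sp U s `<=` sp U (s ++ t).
Proof. by move=> hU; rewrite sp_cat; apply: sp_subl; apply: sub_sp. Qed.

Lemma qfree_cat U s t : qfree U (s ++ t) <-> qfree (sp U t) s /\ qfree U t.
Proof.
elim: s => [|v s IH] /=; first tauto.
by rewrite sp_cat IH; tauto.
Qed.

Lemma qfree_subl U W s : U `<=` W -> qfree W s -> qfree U s.
Proof.
move=> UW; elim: s => [//|v s IH] /= [Wv fs]; split; last exact: IH.
by move=> Uv; apply: Wv; apply: sp_subl Uv.
Qed.

(** Steinitz exchange, one vector at a time: absorbing [v] into the base costs at most one vector of
    a free family. In the relation that expresses the lost vector, the coefficient of [v] is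
    nonzero, so that it can be solved for [v]. *)
Lemma qfree_exchange U v s : @submodule k E U -> qfree U s ->
  qfree (sp U [:: v]) s \/
  exists s', [/\ size s = (size s').+1, {subset s' <= s},
                 qfree (sp U [:: v]) s' & sp U s v].
Proof.
move=> hU; elim: s => [|w s IH] /=; first by left.
move=> [nw fs]; have hs := sp_submodule s hU.
case: (IH fs) => [fvs|[s' [ss s's fs' sv]]]; last first.
  right; exists (w :: s'); split.
  - by rewrite /= ss.
  - move=> x; rewrite !inE => /orP[->//|/s's ->]; exact: orbT.
  - split=> // w1; apply: nw; move: w1.
    rewrite -[X in X -> _]/(sp (sp U [:: v]) s' w) -sp_cat; apply: sp_min => //.
      exact: sub_sp.
    move=> x; rewrite mem_cat inE => /orP[/s's xs|/eqP ->//].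
    exact: mem_sp.
  - by exists 0; rewrite scale0r subr0.
have [wv|wv] := pselect (sp (sp U [:: v]) s w); last by left.
right; exists s; split=> //.
  by move=> x xs; rewrite inE xs orbT.
have {}wv : exists a, sp U s (w - a *: v).
  have key : forall x, sp (sp U [:: v]) s x -> exists a, sp U s (x - a *: v).
    elim: (s) => [x /= [a xa]|y r IHr x [a] /IHr[b xb]]; first by exists a.
    by exists b, a; rewrite addrAC.
  exact: key.
have [a ha] := wv; exists a^-1.
have [a0|a0] := eqVneq a 0.
  by case: nw; move: ha; rewrite a0 scale0r subr0.
have := submoduleZ (- a^-1) hs ha.
by rewrite scalerBr scalerA mulNr mulVf // !scaleNr scale1r opprK addrC.
Qed.

Lemma qfree_size_le U s t : @submodule k E U -> qfree U s ->
  (forall v, v \in s -> sp U t v) -> (size s <= size t)%N.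
Proof.
move=> + + +; elim/last_ind: t U s => [|t v IH] U s hU fs st.
  case: s fs st => [//|w s] /= [nw _] /(_ w); rewrite inE eqxx => /(_ isT) Uw.
  by case: nw; apply: sub_sp.
have hU' : @submodule k E (sp U [:: v]) by exact: sp_submodule.
rewrite -cats1 in st; rewrite size_rcons.
have st' w : w \in s -> sp (sp U [:: v]) t w by move=> /st; rewrite sp_cat.
have [fs'|[s' [-> ss fs' _]]] := qfree_exchange v hU fs.
  by apply: leqW; apply: IH fs' st'.
by apply: IH fs' _ => // w /ss; apply: st'.
Qed.

Lemma qbasis_size U V s t : @submodule k E U ->
  qbasis U V s -> qbasis U V t -> size s = size t.
Proof.
move=> hU [sV fs Vs] [tV ft Vt]; apply/eqP; rewrite eqn_leq.
by rewrite (qfree_size_le hU fs) ?(qfree_size_le hU ft) // => v; [move/tV/Vs|move/sV/Vt].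
Qed.

Lemma qd_basis U V s : @submodule k E U -> qbasis U V s -> qd U V = size s.
Proof.
move=> hU bs; rewrite /qd; case: xgetP => [n -> [t [bt <-]]|/(_ (size s))].
  exact: qbasis_size bt bs.
by case; exists s.
Qed.

Lemma qbasis_exists U V : @submodule k E U -> qfin U V -> exists s, qbasis U V s.
Proof.
move=> hU [t Vt].
pose Q n := `[< exists s, [/\ size s = n, forall v, v \in s -> V v & qfree U s] >].
have Q0 : exists n, Q n by exists 0%N; apply/asboolP; exists [::].
have Qle n : Q n -> (n <= size t)%N.
  move=> /asboolP[s [<- sV fs]]; apply: (qfree_size_le hU fs) => v /sV; exact: Vt.
have [n Qn nmax] := ex_maxnP Q0 Qle.
move: Qn => /asboolP[s [sn sV fs]]; exists s; split=> // v Vv.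
apply: contrapT => nv; suff : (n.+1 <= n)%N by rewrite ltnn.
apply: nmax; apply/asboolP; exists (v :: s); split=> //=; first by rewrite sn.
by move=> w; rewrite inE => /orP[/eqP ->//|]; apply: sV.
Qed.

Lemma qd_le U V t : @submodule k E U -> V `<=` sp U t -> (qd U V <= size t)%N.
Proof.
move=> hU Vt; have [|s bs] := @qbasis_exists U V hU; first by exists t.
rewrite (qd_basis hU bs); have [sV fs _] := bs.
by apply: (qfree_size_le hU fs) => v /sV; apply: Vt.
Qed.

Lemma qd_ge U V s : @submodule k E U -> qfin U V ->
  (forall v, v \in s -> V v) -> qfree U s -> (size s <= qd U V)%N.
Proof.
move=> hU fV sV fs; have [t bt] := qbasis_exists hU fV.
rewrite (qd_basis hU bt); have [_ _ Vt] := bt.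
by apply: (qfree_size_le hU fs) => v /sV; apply: Vt.
Qed.

Lemma qfin_sub U V U' V' : U `<=` U' -> V' `<=` V -> qfin U V -> qfin U' V'.
Proof.
by move=> UU VV [s Vs]; exists s => x /VV /Vs; apply: sp_subl.
Qed.

Lemma qd_mono U V U' V' : @submodule k E U -> @submodule k E U' ->
  U `<=` U' -> V' `<=` V -> qfin U V -> (qd U' V' <= qd U V)%N.
Proof.
move=> hU hU' UU VV fV; have [s bs] := qbasis_exists hU fV.
rewrite (qd_basis hU bs); apply: qd_le => // x /VV.
by case: bs => _ _ Vs /Vs; apply: sp_subl.
Qed.

(** A basis of [V] modulo [W], followed by a basis modulo [U] of the intersection of [V] and [W], is
    a basis of [V] modulo [U]. *)
Lemma qd_split U W V : @submodule k E U -> @submodule k E W ->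
  @submodule k E V -> U `<=` W -> qfin U V ->
  qd U V = (qd U (V `&` W) + qd W V)%N.
Proof.
move=> hU hW hV UW fV.
have [|s bs] := @qbasis_exists U (V `&` W) hU.
  by apply: qfin_sub fV => // x [].
have [|t bt] := @qbasis_exists W V hW; first by apply: qfin_sub fV.
rewrite (qd_basis hU bs) (qd_basis hW bt) addnC -size_cat.
apply: qd_basis => //; have [sV fs Vs] := bs; have [tV ft Vt] := bt; split.
- by move=> v; rewrite mem_cat => /orP[/tV//|/sV[]].
- rewrite qfree_cat; split=> //; apply: qfree_subl ft.
  by apply: sp_min => // v /sV[].
- move=> v Vv; rewrite sp_cat; have : sp W t v by apply: Vt.
  have : forall x, V x -> sp W t x -> sp (sp U s) t x; last by apply.
  elim: (t) tV => [|w r IH] tV x Vx /=; first by move=> Wx; apply: Vs.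
  move=> [a xa]; exists a; apply: IH => //.
    by move=> y yr; apply: tV; rewrite inE yr orbT.
  apply: submoduleB => //; apply: submoduleZ => //.
  by apply: tV; rewrite inE eqxx.
Qed.

Lemma qd0 U V : @submodule k E U -> V `<=` U -> qd U V = 0%N.
Proof. by move=> hU VU; apply/eqP; rewrite -leqn0; apply: (@qd_le _ _ [::]). Qed.

Lemma qd_gt0 U V v : @submodule k E U -> qfin U V -> V v -> ~ U v ->
  (0 < qd U V)%N.
Proof.
move=> hU fV Vv Uv; apply: (@qd_ge _ _ [:: v]) => //= w; rewrite inE.
by move/eqP ->.
Qed.

End RelativeDimension.

(** * Spans and free families under semilinear maps *)

Section Semilinear.
Variables (k : fieldType) (E F : lmodType k) (sigma : k -> k) (f : E -> F).
Hypothesis sigma_surj : forall b, exists a, sigma a = b.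
Hypothesis fB : {morph f : x y / x - y}.
Hypothesis fZ : forall a x, f (a *: x) = sigma a *: f x.

Lemma sp_image (U : set E) (U' : set F) s x : (forall y, U y -> U' (f y)) ->
  sp U s x -> sp U' (map f s) (f x).
Proof.
move=> UU; elim: s x => [|v s IH] x /=; first exact: UU.
by move=> [a /IH xa]; exists (sigma a); rewrite -fZ -fB.
Qed.

(** The coefficients of a relation in the target are pulled back along [sigma]. For the maps r -> r
    ^ q * w this is where perfectness of [k] enters; for multiplications [sigma] is the identity. *)
Lemma sp_preimage (U W : set E) (U' : set F) s x : @submodule k E W ->
  (forall y, W y -> U' (f y) -> U y) -> (forall v, v \in s -> W v) -> W x ->
  sp U' (map f s) (f x) -> sp U s x.
Proof.
move=> hW UU; elim: s x => [|v s IH] x sW Wx /=; first exact: UU.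
move=> [b xb]; have [a ab] := sigma_surj b; exists a; apply: IH.
- by move=> w ws; apply: sW; rewrite inE ws orbT.
- apply: submoduleB => //; apply: submoduleZ => //; apply: sW.
  by rewrite inE eqxx.
- by rewrite fB fZ ab.
Qed.

Lemma qfree_image (U W : set E) (U' : set F) s : @submodule k E W ->
  (forall y, W y -> U' (f y) -> U y) -> (forall v, v \in s -> W v) ->
  qfree U s -> qfree U' (map f s).
Proof.
move=> hW UU; elim: s => [//|v s IH] sW /= [nv fs]; split.
  move=> h; apply: nv; apply: (sp_preimage hW UU) h.
    by move=> w ws; apply: sW; rewrite inE ws orbT.
  by apply: sW; rewrite inE eqxx.
by apply: IH fs => w ws; apply: sW; rewrite inE ws orbT.
Qed.

Lemma qfree_preimage (U : set E) (U' : set F) s : (forall y, U y -> U' (f y)) ->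
  qfree U' (map f s) -> qfree U s.
Proof.
move=> UU; elim: s => [//|v s IH] /= [nv fs]; split; last exact: IH.
by move=> h; apply: nv; apply: sp_image h.
Qed.

End Semilinear.

(** * Length as a dimension *)

Section Length.
Variables (k : fieldType) (E : lmodType k).

(** A chain yields a free family by picking a vector in each gap; conversely, the spans of the tails
    of a basis form a chain of the right length. *)
Lemma qlength_qd (K : realType) (U V : set E) : @submodule k E U ->
  @submodule k E V -> U `<=` V -> qfin U V ->
  qlength K U V = (qd U V)%:R%:E.
Proof.
move=> hU hV UV fV; apply/eqP; rewrite eq_le; apply/andP; split.
  apply: ge_ereal_sup => _ [n [c [[cS cs] c0 cn]] <-].
  rewrite lee_fin ler_nat.
  suff h i : (i <= n)%N -> exists s, [/\ size s = i, forall v, v \in s -> c i v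
                                      & qfree U s].
    have [s [ss sc fs]] := h n (leqnn n).
    by rewrite -ss; apply: qd_ge => // v /sc; rewrite cn.
  elim: i => [_|i IH ilt]; first by exists [::].
  have [s [ss sc fs]] := IH (ltnW ilt).
  have [ci nci] := cs i ilt.
  have [v [civ nv]] : exists v, c i.+1 v /\ ~ c i v.
    apply: contrapT => h; apply: nci => v civ; apply: contrapT => nv.
    by apply: h; exists v.
  exists (v :: s); split=> [|w|]; first by rewrite /= ss.
    by rewrite inE => /orP[/eqP ->//|/sc]; apply: ci.
  split=> // sv; apply: nv; apply: (@sp_min _ _ U s (c i)) sv => //.
    exact: cS (ltnW ilt).
  have : forall j, (j <= i)%N -> c 0%N `<=` c j.
    elim=> [_ x //|j IHj ji]; apply: subset_trans (IHj (ltnW ji)) _.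
    by case: (cs j (leq_trans ji (ltnW ilt))).
  by rewrite -c0; apply.
apply: ereal_sup_ubound; exists (qd U V) => //.
have [s bs] := qbasis_exists hU fV; have [sV fs Vs] := bs.
rewrite (qd_basis hU bs).
exists (fun i => sp U (drop (size s - i) s)); split.
- split=> [i _|i ilt]; first exact: sp_submodule.
  have e : ((size s - i.+1).+1 = size s - i)%N by lia.
  have -> : drop (size s - i.+1) s = nth 0 s (size s - i.+1) :: drop (size s - i) s.
    by rewrite (drop_nth 0) ?e // leq_subr.
  split; first by move=> x xd /=; exists 0; rewrite scale0r subr0.
  set v := nth _ _ _ => h.
  have : qfree U (drop (size s - i.+1) s).
    by move: fs; rewrite -{1}(cat_take_drop (size s - i.+1) s) qfree_cat => -[].
  rewrite (drop_nth 0); last by rewrite ltn_subrL (leq_ltn_trans (leq0n i) ilt).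
  move=> [nv _]; apply: nv; rewrite e; apply: h.
  by apply: mem_sp => //; rewrite inE eqxx.
- by rewrite subn0 drop_size.
- rewrite subnn drop0; apply/seteqP; split=> // x.
  by apply: sp_min => // v /sV.
Qed.

End Length.

(** * Ideals and primes *)

Section Ideals.
Variable R : comNzRingType.
Implicit Types (I P : set R).

Lemma idealP I : ideal I <-> I 0 /\ forall a x y, I x -> I y -> I (a * x + y).
Proof.
split=> [[U0 UD]|[U0 UD]]; split.
- by move: U0; rewrite inE.
- by move=> a x y Ux Uy; have := UD a x y; rewrite !inE; apply.
- by rewrite inE.
- by move=> a x y; rewrite !inE; apply: UD.
Qed.

Lemma ideal0 I : ideal I -> I 0. Proof. by move=> /idealP[]. Qed.

Lemma idealD I x y : ideal I -> I x -> I y -> I (x + y).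
Proof. by move=> /idealP[_ h] Ux Uy; rewrite -[x]mul1r; apply: h. Qed.

Lemma ideal_mull I a x : ideal I -> I x -> I (a * x).
Proof. by move=> /idealP[U0 h] Ux; rewrite -[_ * _]addr0; apply: h. Qed.

Lemma ideal_mulr I a x : ideal I -> I x -> I (x * a).
Proof. by rewrite mulrC; apply: ideal_mull. Qed.

Lemma idealN I x : ideal I -> I x -> I (- x).
Proof. by move=> hU Ux; rewrite -mulN1r; apply: ideal_mull. Qed.

Lemma idealB I x y : ideal I -> I x -> I y -> I (x - y).
Proof. by move=> hU Ux Uy; apply: idealD => //; apply: idealN. Qed.

Lemma idealX I x n : ideal I -> I x -> (0 < n)%N -> I (x ^+ n).
Proof. by case: n => // n hI Ix _; rewrite exprSr; apply: ideal_mull. Qed.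

Lemma ideal_sum I (T : Type) (r : seq T) (Q : pred T) (F : T -> R) :
  ideal I -> (forall i, Q i -> I (F i)) -> I (\sum_(i <- r | Q i) F i).
Proof.
move=> hU h; elim/big_ind: _ => //; first exact: ideal0.
by move=> x y; apply: idealD.
Qed.

Lemma ideal_setT : ideal [set: R]. Proof. by apply/idealP. Qed.

Lemma ideal_set0 : ideal [set 0 : R].
Proof.
by apply/idealP; split=> // a x y -> ->; rewrite mulr0 addr0.
Qed.

Definition addi (I J : set R) : set R :=
  [set x | exists y z, [/\ I y, J z & x = y + z]].

Lemma addi_ideal I J : ideal I -> ideal J -> ideal (addi I J).
Proof.
move=> hI hJ; apply/idealP; split.
  by exists 0, 0; split; rewrite ?addr0 //; apply: ideal0.
move=> a x y [x1 [x2 [Ix Jx ->]]] [y1 [y2 [Iy Jy ->]]].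
exists (a * x1 + y1), (a * x2 + y2); split; last by rewrite mulrDr addrACA.
- by apply: idealD => //; apply: ideal_mull.
- by apply: idealD => //; apply: ideal_mull.
Qed.

Lemma addil I J : ideal J -> I `<=` addi I J.
Proof. by move=> /ideal0 J0 x Ix; exists x, 0; rewrite addr0. Qed.

Lemma addir I J : ideal I -> J `<=` addi I J.
Proof. by move=> /ideal0 J0 x Ix; exists 0, x; rewrite add0r. Qed.

Definition prin (x : R) : set R := [set y | exists a, y = a * x].

Lemma prin_ideal x : ideal (prin x).
Proof.
apply/idealP; split; first by exists 0; rewrite mul0r.
by move=> a _ _ [b ->] [c ->]; exists (a * b + c); rewrite mulrDl mulrA.
Qed.

Lemma prin_mem x : prin x x. Proof. by exists 1; rewrite mul1r. Qed.

Definition colon (I : set R) (x : R) : set R := [set y | I (y * x)].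

Lemma colon_ideal I x : ideal I -> ideal (colon I x).
Proof.
move=> hI; apply/idealP; split; first by rewrite /colon /= mul0r; apply: ideal0.
move=> a y z; rewrite /colon /= => Iy Iz; rewrite mulrDl -mulrA.
by apply: idealD => //; apply: ideal_mull.
Qed.

Lemma ideal_gen_ideal (X : set R) : ideal (ideal_gen X).
Proof.
apply/idealP; split.
  by move=> I [hI _]; apply: ideal0.
move=> a x y Xx Xy I [hI XI]; apply: idealD => //.
  by apply: ideal_mull => //; apply: Xx.
exact: Xy.
Qed.

Lemma ideal_gen_sub (X : set R) : X `<=` ideal_gen X.
Proof. by move=> x Xx I [_]; apply. Qed.

Lemma ideal_gen_min (X I : set R) : ideal I -> X `<=` I -> ideal_gen X `<=` I.
Proof. by move=> hI XI x; apply. Qed.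

Lemma prime_idealP P : prime_ideal P <->
  [/\ ideal P, ~ P 1 & forall x y, P (x * y) -> P x \/ P y].
Proof.
split=> [[[P0 P1 PD] PM]|[hP P1 PM]]; split.
- apply/idealP; split; first by move: P0; rewrite inE.
  by move=> a x y Px Py; have := PD a x y; rewrite !inE; apply.
- by move=> h; move: P1; rewrite notin_setE.
- by move=> x y Pxy; have := PM x y; rewrite inE => /(_ Pxy) /orP[]; rewrite inE; tauto.
- split.
  + by rewrite inE; apply: ideal0.
  + by rewrite notin_setE.
  + move=> a x y; rewrite !inE => Px Py; apply: idealD => //; exact: ideal_mull.
- by move=> x y; rewrite inE => /PM[h|h]; apply/orP; [left|right]; rewrite inE.
Qed.

Lemma prime_ideal_ideal P : prime_ideal P -> ideal P.
Proof. by move=> /prime_idealP[]. Qed.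

Lemma prime_n1 P : prime_ideal P -> ~ P 1.
Proof. by move=> /prime_idealP[]. Qed.

Lemma primeM P x y : prime_ideal P -> ~ P x -> ~ P y -> ~ P (x * y).
Proof. by move=> /prime_idealP[_ _ h] nx ny /h[]. Qed.

Lemma primeX P x n : prime_ideal P -> ~ P x -> ~ P (x ^+ n).
Proof.
move=> hP nx; elim: n => [|n IH]; first by rewrite expr0; apply: prime_n1.
by rewrite exprS; apply: primeM.
Qed.

Lemma primeX_inv P x n : prime_ideal P -> P (x ^+ n) -> P x.
Proof. by move=> hP h; apply: contrapT => nx; exact: primeX hP nx h. Qed.

Lemma prime_prod P (T : eqType) (r : seq T) (F : T -> R) :
  prime_ideal P -> (forall i, i \in r -> ~ P (F i)) -> ~ P (\prod_(i <- r) F i).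
Proof.
move=> hP; elim: r => [|i r IH] h; first by rewrite big_nil; apply: prime_n1.
rewrite big_cons; apply: primeM => //; first by apply: h; rewrite inE eqxx.
by apply: IH => j jr; apply: h; rewrite inE jr orbT.
Qed.

Lemma ideal_prod_mem I (T : eqType) (r : seq T) (F : T -> R) i :
  ideal I -> i \in r -> I (F i) -> I (\prod_(j <- r) F j).
Proof.
move=> hI; elim: r => [//|j r IH]; rewrite inE big_cons => /orP[/eqP <-|ir] h.
  exact: ideal_mulr.
by apply: ideal_mull => //; apply: IH.
Qed.

(* Noetherian induction: a counterexample would start a strictly increasing
   sequence, whose union would not be finitely generated. *)
Lemma noeth_ind (Th : set R -> Prop) : noetherian R ->
  (forall I, ideal I -> (forall J, ideal J -> I `<=` J -> I <> J -> Th J) -> Th I) ->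
  forall I, ideal I -> Th I.
Proof.
move=> hR step I0 hI0; apply: contrapT => nT0.
pose T := {I : set R | ideal I /\ ~ Th I}.
have next (I : T) : {J : T | sval I `<=` sval J /\ sval I <> sval J}.
  apply: cid; case: I => I [hI nI] /=; apply: contrapT => h; apply: nI.
  apply: step => // J hJ IJ nIJ; apply: contrapT => nJ; apply: h.
  by exists (exist _ J (conj hJ nJ)).
pose c n : T := iter n (fun I : T => sval (next I)) (exist _ I0 (conj hI0 nT0)).
have cS n : sval (c n) `<=` sval (c n.+1) /\ sval (c n) <> sval (c n.+1).
  exact: (svalP (next (c n))).
have cle m n : (m <= n)%N -> sval (c m) `<=` sval (c n).
  move=> /subnK <-; elim: (n - m)%N => [//|i IH].
  by rewrite addSn; apply: subset_trans IH _; case: (cS (i + m)%N).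
pose U : set R := [set x | exists n, sval (c n) x].
have hU : ideal U.
  apply/idealP; split; first by exists 0%N; apply: ideal0.
  move=> a x y [m mx] [n ny]; exists (maxn m n).
  have hc := (svalP (c (maxn m n))).1.
  apply: idealD => //; last exact: cle (leq_maxr m n) _ ny.
  by apply: ideal_mull => //; exact: cle (leq_maxl m n) _ mx.
have [s Us] := hR U hU.
have [n hn] : exists n, forall x, x \in s -> sval (c n) x.
  have sU x : x \in s -> U x by move=> xs; rewrite Us; apply: ideal_gen_sub.
  elim: (s) sU => [|x r IH] sU; first by exists 0%N.
  have [n hn] : exists n, forall x, x \in r -> sval (c n) x.
    by apply: IH => y yr; apply: sU; rewrite inE yr orbT.
  have [m hm] : U x by apply: sU; rewrite inE eqxx.
  exists (maxn m n) => y; rewrite inE => /orP[/eqP ->|/hn].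
    exact: cle (leq_maxl m n) _ hm.
  exact: cle (leq_maxr m n) _.
have [h1 h2] := cS n; apply: h2; apply/seteqP; split=> // x hx.
have : U x by exists n.+1.
rewrite Us; apply: ideal_gen_min; first exact: (svalP (c n)).1.
by move=> y /= /hn.
Qed.

End Ideals.

(** * Combinations with q-th powers as coefficients *)

Section QSpan.
Variables (k : fieldType) (R : comAlgType k) (q : nat).
Hypothesis expB : forall x y : R, (x - y) ^+ q = x ^+ q - y ^+ q.
Hypothesis q_gt0 : (0 < q)%N.
Hypothesis k_perf : forall a : k, exists b : k, b ^+ q = a.
Implicit Types (B V : set R) (L : seq (R * set R)).

Lemma expN_q (x : R) : (- x) ^+ q = - x ^+ q.
Proof. by rewrite -sub0r expB expr0n gtn_eqF // sub0r. Qed.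

Lemma expD_q (x y : R) : (x + y) ^+ q = x ^+ q + y ^+ q.
Proof. by rewrite -{1}[y]opprK expB expN_q opprK. Qed.

Lemma expZ_q (a : k) (x : R) : (a *: x) ^+ q = a ^+ q *: x ^+ q.
Proof. exact: exprZn. Qed.

Lemma ideal_submodule (I : set R) : ideal I -> @submodule k R I.
Proof.
move=> hI; apply/submoduleP; split; first exact: ideal0.
move=> a x y Ix Iy; rewrite -[x]mul1r scalerAl; apply: idealD => //.
exact: ideal_mull.
Qed.

(* The elements [b + \sum_j r_j ^+ q * w_j] with [b] in [B] and [r_j] in [V],
   for [(w_j, P_j)] in [L]; the [P_j], which should contain the coefficients of
   every relation, only matter in [indep]. *)
Fixpoint TT V B L : set R :=
  if L is e :: L' then [set x | exists2 r, V r & TT V B L' (x - r ^+ q * e.1)]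
  else B.

(** Independence in triangular form: only the leading coefficient of each relation is constrained,
    by its own [e.2]. Vectors attached to different primes can thus be mixed, and a family can be
    extended greedily. *)
Fixpoint indep B L : Prop :=
  if L is e :: L' then
    (forall r, TT setT B L' (r ^+ q * e.1) -> e.2 r) /\ indep B L'
  else True.

Lemma TT_submodule V B L : @submodule k R V -> @submodule k R B ->
  @submodule k R (TT V B L).
Proof.
move=> hV hB; elim: L => [//|e L IH].
apply/submoduleP; split=> [|a x y [r Vr xr] [s Vs ys]] /=.
  exists 0; first exact: submodule0.
  rewrite expr0n gtn_eqF // mul0r subr0; exact: submodule0.
(* A scalar is absorbed into the coefficient [r] through a q-th root. *)
have [b <-] := k_perf a.
exists (b *: r + s); first by apply: submoduleD => //; apply: submoduleZ.
have := submoduleD IH (submoduleZ (b ^+ q) IH xr) ys.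
rewrite expD_q expZ_q mulrDl -scalerAl; congr (TT V B L _).
by rewrite scalerBr opprD addrACA.
Qed.

Lemma TT_base V B L : V 0 -> B `<=` TT V B L.
Proof.
move=> V0; elim: L => [//|e L IH] x Bx; exists 0 => //.
by rewrite expr0n gtn_eqF // mul0r subr0; apply: IH.
Qed.

Lemma TT_cat V B L1 L2 : TT V B (L1 ++ L2) = TT V (TT V B L2) L1.
Proof. by elim: L1 => [//|e L1 /= ->]. Qed.

Lemma TT_catr V B L1 L2 : V 0 -> TT V B L2 `<=` TT V B (L1 ++ L2).
Proof. by move=> V0; rewrite TT_cat; apply: TT_base. Qed.

Lemma TT_mul V V' B L y x : ideal B -> (forall r, V r -> V' (y * r)) ->
  TT V B L x -> TT V' B L (y ^+ q * x).
Proof.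
move=> hB hV; elim: L x => [x|e L IH x] /=; first exact: ideal_mull.
move=> [r Vr /IH xr]; exists (y * r); first exact: hV.
by move: xr; rewrite mulrBr exprMn mulrA.
Qed.

Lemma indep_catr B L1 L2 : indep B (L1 ++ L2) -> indep B L2.
Proof. by elim: L1 => [//|e L IH] /= [_ /IH]. Qed.

(** Candidates are tried one by one, and one is rejected only when its multiple by some r ^ q, with
    [r] outside its prime, already lies in the span; an accepted one satisfies the last clause with
    r = 1. *)
Lemma indep_extend B L0 (C : seq (R * set R)) :
  (forall e, e \in C -> prime_ideal e.2) -> ideal B -> indep B L0 ->
  exists L1, [/\ {subset L1 <= C}, indep B (L1 ++ L0) &
    forall e, e \in C -> exists2 r, ~ e.2 r &
      TT setT B (L1 ++ L0) (r ^+ q * e.1)].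
Proof.
move=> hC hB i0; elim: C hC => [|e C IH] hC; first by exists [::].
have [|L1 [LC iL hL]] := IH; first by move=> f fC; apply: hC; rewrite inE fC orbT.
have [[r nr hr]|nex] := pselect (exists2 r, ~ e.2 r &
    TT setT B (L1 ++ L0) (r ^+ q * e.1)).
  exists L1; split=> //; first by move=> f /LC; rewrite inE orbC => ->.
  by move=> f; rewrite inE => /orP[/eqP ->|/hL //]; exists r.
exists (e :: L1); split.
- by move=> f; rewrite !inE => /orP[->//|/LC ->]; rewrite orbT.
- by split=> //= r hr; apply: contrapT => nr; apply: nex; exists r.
- move=> f; rewrite inE => /orP[/eqP ->|/hL [r nr hr]].
    exists 1; first by apply: prime_n1; apply: hC; rewrite inE eqxx.
    exists 1 => //; rewrite subrr; apply: TT_base => //; exact: ideal0.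
  by exists r => //; exact: (@TT_catr setT B [:: e]).
Qed.

Lemma TT_sp V B L (S : set R -> seq R) : @submodule k R B ->
  (forall e, e \in L -> V `<=` sp e.2 (S e.2)) ->
  (forall e, e \in L -> forall r, e.2 r -> B (r ^+ q * e.1)) ->
  TT V B L `<=` sp B (flatten [seq [seq r ^+ q * e.1 | r <- S e.2] | e <- L]).
Proof.
move=> hB; elim: L => [_ _ x //|e L IH] hS hP x [r Vr xr] /=.
rewrite sp_cat -(subrK (r ^+ q * e.1) x).
have hF := sp_submodule (flatten [seq [seq r ^+ q * e.1 | r <- S e.2] | e <- L]) hB.
apply: submoduleD; first exact: sp_submodule.
  apply: sub_sp; apply: IH xr => f fL; [apply: hS|apply: hP]; rewrite inE fL orbT //.
have eL : e \in e :: L by rewrite inE eqxx.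
apply: (@sp_image _ _ _ (fun a => a ^+ q) (fun r => r ^+ q * e.1) _ _ e.2).
- by move=> a b; rewrite expB mulrBl.
- by move=> a y; rewrite expZ_q scalerAl.
- by move=> y ey; apply: sub_sp; apply: hP ey.
- exact: hS eL _ Vr.
Qed.

(** Together with [TT_sp], this turns independence over q-th powers into dimensions over [k]: each
    vector contributes a copy of a basis modulo its [e.2], carried over by the semilinear map r -> r
    ^ q * e.1. *)
Lemma indep_qfree B L (S : set R -> seq R) : @submodule k R B ->
  (forall e, e \in L -> qfree e.2 (S e.2)) -> indep B L ->
  qfree B (flatten [seq [seq r ^+ q * e.1 | r <- S e.2] | e <- L]).
Proof.
move=> hB; elim: L => [//|e L IH] hS /= [he hL]; rewrite qfree_cat; split; last first.
  by apply: IH => // f fL; apply: hS; rewrite inE fL orbT.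
have eL : e \in e :: L by rewrite inE eqxx.
apply: (@qfree_image _ _ _ (fun a => a ^+ q) (fun r => r ^+ q * e.1) k_perf _ _ e.2 setT).
- by move=> a b; rewrite expB mulrBl.
- by move=> a y; rewrite expZ_q scalerAl.
- by apply/submoduleP.
- move=> y _ hy; apply: he; apply: sp_min hy.
  + by apply: TT_submodule => //; apply/submoduleP.
  + exact: TT_base.
  + move=> v /flattenP[_ /mapP[f fL ->] /mapP[r rS ->]].
    elim: (L) fL => [//|g L' IHL]; rewrite inE => /orP[/eqP <-|/IHL h].
      by exists r => //; rewrite subrr; apply: TT_base => //; apply: submodule0.
    exists 0 => //; by rewrite expr0n gtn_eqF // mul0r subr0.
- by [].
- exact: hS.
Qed.

Lemma size_flatten_qspan L (S : set R -> seq R) :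
  size (flatten [seq [seq r ^+ q * e.1 | r <- S e.2] | e <- L]) =
  \sum_(e <- L) size (S e.2).
Proof.
by elim: L => [|e L IH]; rewrite ?big_nil //= big_cons size_cat size_map IH.
Qed.

End QSpan.

(** * Homogeneous components and homogeneous ideals *)

Section Grading.
Variables (k : fieldType) (R : comAlgType k) (Rg : nat -> set R).
Hypothesis hG : is_grading Rg.
Hypothesis Rg1 : Rg 0%N 1.

Lemma Rg_submodule m : @submodule k R (Rg m). Proof. by case: hG. Qed.
Hint Resolve Rg_submodule : core.

Lemma RgM m n x y : Rg m x -> Rg n y -> Rg (m + n)%N (x * y).
Proof. by case: hG => _ h _ _; apply: h. Qed.

Lemma RgX n x m : Rg m x -> Rg (n * m)%N (x ^+ n).
Proof.
move=> mx; elim: n => [|n IH]; first by rewrite mul0n expr0.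
by rewrite exprS mulSn; apply: RgM.
Qed.

Lemma Rg0 m : Rg m 0. Proof. exact: submodule0. Qed.
Hint Resolve Rg0 : core.

Lemma sum_trunc n N (f : nat -> R) : (n <= N)%N ->
  \sum_(m < N) (if (m < n)%N then f m else 0) = \sum_(m < n) f m.
Proof. by move=> nN; rewrite (big_ord_widen _ _ nN) [RHS]big_mkcond. Qed.

Lemma hcomp_ex x : exists g : nat -> R, (forall m, Rg m (g m)) /\
  exists n, (forall m, (n <= m)%N -> g m = 0) /\ x = \sum_(m < n) g m.
Proof.
case: hG => _ _ /(_ x) [n [f [fR ->]]] _.
exists (fun m => if (m < n)%N then f m else 0); split=> [m|]; first by case: ifP.
exists n; split=> [m|]; first by rewrite ltnNge => ->.
by rewrite sum_trunc.
Qed.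

Definition hcomp x : nat -> R := sval (cid (hcomp_ex x)).

Lemma hcompP x m : Rg m (hcomp x m).
Proof. by rewrite /hcomp; case: cid => g [] /=. Qed.
Hint Resolve hcompP : core.

Lemma hcomp_fin x : exists n, (forall m, (n <= m)%N -> hcomp x m = 0) /\
  x = \sum_(m < n) hcomp x m.
Proof. by rewrite /hcomp; case: cid => g []. Qed.

Lemma hcomp_uniq x n (f : nat -> R) : (forall m, Rg m (f m)) ->
  x = \sum_(m < n) f m -> forall m, hcomp x m = if (m < n)%N then f m else 0.
Proof.
move=> fR xf m; have [N [gN xg]] := hcomp_fin x.
have [mM|mM] := ltnP m (maxn n N); last first.
  rewrite gN; last by apply: leq_trans mM; rewrite leq_maxr.
  by rewrite ltnNge (leq_trans _ mM) // leq_maxl.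
case: hG => _ _ _ hI.
pose F i := hcomp x i - (if (i < n)%N then f i else 0).
have /(_ m mM) : forall i, (i < maxn n N)%N -> F i = 0.
  apply: hI => [i|].
    by apply: submoduleB => //; case: ifP.
  rewrite sumrB sum_trunc ?leq_maxl // -xf.
  suff -> : \sum_(i < maxn n N) hcomp x i = x by rewrite subrr.
  rewrite [RHS]xg -(@sum_trunc N (maxn n N) (hcomp x)) ?leq_maxr //.
  by apply: eq_bigr => i _; case: ltnP => [|/gN ->].
by move/eqP; rewrite subr_eq0 => /eqP.
Qed.

Lemma hcomp_homog m x j : Rg m x -> hcomp x j = if j == m then x else 0.
Proof.
move=> mx; rewrite (@hcomp_uniq x m.+1 (fun i => if i == m then x else 0)).
- by case: ltnP => // mj; case: eqP => // jm; move: mj; rewrite jm ltnn.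
- by move=> i; case: eqP => [->|].
- rewrite (bigD1 ord_max) //= eqxx big1 ?addr0 // => i im.
  by rewrite ifN //; apply: contra im => /eqP im; apply/eqP/val_inj.
Qed.

Lemma hcomp_id m x : Rg m x -> hcomp x m = x.
Proof. by move/(@hcomp_homog _ _ m) ->; rewrite eqxx. Qed.

Lemma hcomp_lin a x y m : hcomp (a *: x + y) m = a *: hcomp x m + hcomp y m.
Proof.
have [n [nx xE]] := hcomp_fin x; have [n' [ny yE]] := hcomp_fin y.
rewrite (@hcomp_uniq _ (maxn n n') (fun m => a *: hcomp x m + hcomp y m)).
- case: ltnP => // h; rewrite nx ?ny ?scaler0 ?addr0 //.
    by apply: leq_trans h; rewrite leq_maxr.
  by apply: leq_trans h; rewrite leq_maxl.
- by move=> i; apply: submoduleD => //; apply: submoduleZ.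
- rewrite big_split /= -scaler_sumr {1}xE {1}yE.
  rewrite -(@sum_trunc n (maxn n n') (hcomp x)) ?leq_maxl //.
  rewrite -(@sum_trunc n' (maxn n n') (hcomp y)) ?leq_maxr //.
  congr (a *: _ + _); apply: eq_bigr => i _.
    by case: ltnP => [//|/nx ->].
  by case: ltnP => [//|/ny ->].
Qed.

Lemma hcomp0 m : hcomp 0 m = 0.
Proof. by rewrite (@hcomp_homog 0) //; case: eqP. Qed.

Lemma hcompD x y m : hcomp (x + y) m = hcomp x m + hcomp y m.
Proof. by rewrite -[x]scale1r hcomp_lin !scale1r. Qed.

Lemma hcompB x y m : hcomp (x - y) m = hcomp x m - hcomp y m.
Proof. by rewrite -scaleN1r addrC hcomp_lin scaleN1r addrC. Qed.

Lemma hcomp_sum (T : Type) (r : seq T) (Q : pred T) (F : T -> R) m :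
  hcomp (\sum_(i <- r | Q i) F i) m = \sum_(i <- r | Q i) hcomp (F i) m.
Proof.
apply: (big_morph (fun x => hcomp x m)) => [x y|]; first exact: hcompD.
exact: hcomp0.
Qed.

Lemma hcomp_ind (Th : R -> Prop) : (forall m x, Rg m x -> Th x) ->
  (forall x y, Th x -> Th y -> Th (x + y)) -> forall x, Th x.
Proof.
move=> h hD x; have [n [_ ->]] := hcomp_fin x.
elim/big_ind: _ => //; first exact: (h 0%N).
by move=> i _; apply: (h i).
Qed.

Lemma hcompM a x y m : Rg a y ->
  hcomp (x * y) m = if (a <= m)%N then hcomp x (m - a) * y else 0.
Proof.
move=> ay; elim/hcomp_ind: x => [j x jx|x x' hx hx'].
  rewrite (@hcomp_homog (j + a)); last exact: RgM.
  rewrite (@hcomp_homog j _ (m - a)%N) //.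
  case: leqP => am; first by rewrite -[(m - a == j)%N](eqn_add2r a) subnK //; case: eqP => //; rewrite mul0r.
  by case: eqP => // mja; move: am; rewrite mja ltnNge leq_addl.
by rewrite mulrDl !hcompD hx hx'; case: ifP; rewrite ?mulrDl ?addr0.
Qed.

Lemma hcompM_r a x y m : Rg a y -> hcomp (x * y) (m + a) = hcomp x m * y.
Proof. by move/hcompM ->; rewrite leq_addl addnK. Qed.

Definition hideal (I : set R) : Prop :=
  ideal I /\ forall x m, I x -> I (hcomp x m).

Lemma hideal_ideal I : hideal I -> ideal I. Proof. by case. Qed.

Lemma hideal_submodule I : hideal I -> @submodule k R I.
Proof. by case=> /ideal_submodule. Qed.

Lemma hcomp_mem (I : set R) : ideal I -> forall x, (forall m, I (hcomp x m)) -> I x.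
Proof.
by move=> hI x h; have [n [_ ->]] := hcomp_fin x; apply: ideal_sum.
Qed.

Lemma graded_hideal I : graded_ideal Rg I -> hideal I.
Proof.
move=> [hI hh]; split=> // x m /hh [n [f [fR xf]]].
rewrite (hcomp_uniq _ xf); last by move=> i; case: (fR i).
by case: ifP => _; [case: (fR m)|apply: ideal0].
Qed.

Lemma hideal_setT : hideal setT.
Proof. by split=> //; apply: ideal_setT. Qed.

Lemma hideal_set0 : hideal [set 0].
Proof. by split=> [|x m ->]; [apply: ideal_set0|rewrite /= hcomp0]. Qed.

Lemma hideal_addi I J : hideal I -> hideal J -> hideal (addi I J).
Proof.
move=> [hI hhI] [hJ hhJ]; split; first exact: addi_ideal.
move=> _ m [x [y [Ix Jy ->]]]; exists (hcomp x m), (hcomp y m).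
by split; [apply: hhI|apply: hhJ|rewrite hcompD].
Qed.

Lemma hideal_prin a x : Rg a x -> hideal (prin x).
Proof.
move=> ax; split; first exact: prin_ideal.
move=> _ m [y ->]; rewrite (hcompM _ _ ax); case: ifP => _.
  by exists (hcomp y (m - a)).
by exact: (ideal0 (prin_ideal x)).
Qed.

Lemma hideal_colon a I x : hideal I -> Rg a x -> hideal (colon I x).
Proof.
move=> [hI hhI] ax; split; first exact: colon_ideal.
by move=> y m h; rewrite /colon /= -(hcompM_r y m ax); apply: hhI.
Qed.

Lemma hideal_gen (X : set R) : (forall x m, X x -> ideal_gen X (hcomp x m)) ->
  hideal (ideal_gen X).
Proof.
move=> hX; split; first exact: ideal_gen_ideal.
suff h x : ideal_gen X x -> forall m, ideal_gen X (hcomp x m) by move=> x m /h; apply.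
have hg := ideal_gen_ideal X.
pose C : set R := [set x | forall a m, ideal_gen X (hcomp (a * x) m)].
suff : ideal_gen X `<=` C.
  by move=> h /h hx m; have := hx 1 m; rewrite mul1r.
apply: ideal_gen_min.
  apply/idealP; split; first by move=> a m; rewrite mulr0 hcomp0; exact: (ideal0 hg).
  move=> a y z Cy Cz b m; rewrite mulrDr mulrA hcompD; apply: (idealD hg).
    exact: Cy.
  exact: Cz.
move=> y Xy a m; have [n [_ yE]] := hcomp_fin y.
rewrite yE mulr_sumr hcomp_sum; apply: (ideal_sum _ hg) => i _.
rewrite (hcompM _ _ (hcompP y i)); case: ifP => _; last exact: (ideal0 hg).
by apply: (ideal_mull _ hg); apply: hX.
Qed.

(* The component of degree M - delta, with the convention that it is zero when
   this difference is negative. *)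
Definition Rs M delta : set R :=
  [set r | if (delta <= M)%N then Rg (M - delta) r else r = 0].

Lemma Rs0 M delta : Rs M delta 0. Proof. by rewrite /Rs /=; case: ifP. Qed.

Section Power.
Variable q : nat.
Hypothesis expB : forall x y : R, (x - y) ^+ q = x ^+ q - y ^+ q.
Hypothesis q_gt0 : (0 < q)%N.

(** As the q-th power is additive, x ^ q is the sum of the q-th powers of the components of [x] and
    lives in degrees divisible by q; [hcompX_zero] treats the remaining degrees. *)
Lemma hcompX x m j (w : R) a : Rg a w -> j = (q * m + a)%N ->
  hcomp (x ^+ q * w) j = hcomp x m ^+ q * w.
Proof.
move=> aw ->.
rewrite hcompM_r //; congr (_ * _).
elim/hcomp_ind: x => [i x ix|x y hx hy].
  rewrite (@hcomp_homog (q * i)); last exact: RgX.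
  rewrite (@hcomp_homog i) // eqn_pmul2l //; case: eqP => // _.
  by rewrite expr0n gtn_eqF.
by rewrite expD_q // !hcompD hx hy expD_q.
Qed.

Lemma hcompX_zero x j (w : R) a : Rg a w -> (forall m, j <> (q * m + a)%N) ->
  hcomp (x ^+ q * w) j = 0.
Proof.
move=> aw nj.
elim/hcomp_ind: x => [i x ix|x y hx hy].
  rewrite (@hcomp_homog (q * i + a)); last by apply: RgM => //; apply: RgX.
  by case: eqP => // /nj.
by rewrite expD_q // mulrDl hcompD hx hy addr0.
Qed.

End Power.
End Grading.

(** * Two counting arguments *)

(** A word longer than q - 1 times the size of its alphabet repeats some letter q times. *)
Lemma pigeonhole_pow (R : comNzRingType) (ys w : seq R) q : {subset w <= ys} ->
  (size ys * q.-1 < size w)%N -> (0 < q)%N ->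
  exists2 y, y \in ys & exists w',
    [/\ {subset w' <= w}, (size w' + q)%N = size w
      & \prod_(x <- w) x = y ^+ q * \prod_(x <- w') x].
Proof.
move=> wy sw q0.
have [y yys yq] : exists2 y, y \in ys & (q <= count_mem y w)%N.
  apply: contrapT => h.
  have : (size w <= \sum_(y <- ys) count_mem y w)%N.
    have -> : size w = count (mem ys) w by apply/esym/eqP; rewrite -all_count; apply/allP.
    elim: (ys) => [|y r IH]; first by rewrite big_nil; elim: (w).
    rewrite big_cons; apply: leq_trans (leq_add (leqnn _) IH).
    by rewrite -count_predUI; apply: leq_trans (leq_addr _ _); apply: sub_count => x; rewrite !inE.
  apply/negP; rewrite -ltnNge; apply: leq_ltn_trans sw.
  have : forall y, y \in ys -> (count_mem y w <= q.-1)%N.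
    move=> y yys; rewrite leqNgt; apply/negP => hq; apply: h; exists y => //.
    by rewrite -(prednK q0).
  elim: (ys) => [|y r IH] hr; first by rewrite big_nil.
  rewrite big_cons mulSn leq_add ?hr ?inE ?eqxx // IH // => z zr.
  by apply: hr; rewrite inE zr orbT.
exists y => //.
exists (nseq (count_mem y w - q) y ++ [seq x <- w | predC (pred1 y) x]).
have e1 : [seq x <- w | pred1 y x] = nseq (count_mem y w) y.
  by rewrite -size_filter; apply/all_pred1P/filter_all.
split.
- move=> z; rewrite mem_cat mem_nseq mem_filter => /orP[/andP[_ /eqP ->]|/andP[]//].
  by rewrite -has_pred1 has_count (leq_trans q0).
- by rewrite size_cat size_nseq addnAC subnK // size_filter count_predC.
- rewrite -(perm_big _ (permEl (perm_filterC (pred1 y) w))) /= !big_cat /= mulrA.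
  by congr (_ * _); rewrite e1 !big_nseq !iter_mulr_1 -exprD subnKC.
Qed.

Lemma leq_expl (m n e : nat) : (m <= n)%N -> (m ^ e <= n ^ e)%N.
Proof. by case: e => // e mn; rewrite leq_exp2r. Qed.

(** If 0 < s < N, Bernoulli's inequality (s + 1) ^ n >= s ^ n + n * s ^ (n - 1) contradicts the
    bound at n = C * s + 1. *)
Lemma exp_growth (N s C : nat) : (forall n, N ^ n <= C * s ^ n)%N -> (N <= s)%N.
Proof.
move=> h; rewrite leqNgt; apply/negP => sN.
have {}h n : (s.+1 ^ n <= C * s ^ n)%N.
  by apply: leq_trans (h n); apply: leq_expl.
have [s0|s0] := posnP s; first by have := h 1%N; rewrite s0 !expn1 muln0.
have bern n : (s ^ n + n * s ^ n.-1 <= s.+1 ^ n)%N.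
  elim: n => [|n IH]; first by rewrite !expn0 mul0n addn0.
  rewrite expnS [leqRHS]expnS /=; apply: leq_trans (leq_mul (leqnn s.+1) IH).
  case: n {IH} => [|n]; first by rewrite !expn0; lia.
  by rewrite /= !expnS; nia.
have := leq_trans (bern (C * s).+1) (h _).
rewrite /= !expnS; have : (0 < s ^ (C * s))%N by rewrite expn_gt0 s0.
by move: (s ^ (C * s))%N => w; nia.
Qed.

(** * Explicit coefficients of combinations *)

Section Coefficients.
Variables (k : fieldType) (R : comAlgType k) (q : nat).
Hypothesis expB : forall x y : R, (x - y) ^+ q = x ^+ q - y ^+ q.
Hypothesis q_gt0 : (0 < q)%N.
Implicit Types (B V : set R) (L : seq (R * set R)).

Definition qcomb L (r : nat -> R) : R :=
  \sum_(j < size L) r j ^+ q * (nth (0, set0) L j).1.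

Lemma qcomb_cons e L r : qcomb (e :: L) r = r 0%N ^+ q * e.1 + qcomb L (r \o S).
Proof. by rewrite /qcomb big_ord_recl. Qed.

Lemma qcombB L r s : qcomb L (fun j => r j - s j) = qcomb L r - qcomb L s.
Proof. by rewrite -sumrB; apply: eq_bigr => j _; rewrite expB mulrBl. Qed.

Lemma qcombM L r c : qcomb L (fun j => c * r j) = c ^+ q * qcomb L r.
Proof. by rewrite mulr_sumr; apply: eq_bigr => j _; rewrite exprMn mulrA. Qed.

Lemma TT_coef V B L x : V 0 -> TT q V B L x ->
  exists2 r, forall j, V (r j) & B (x - qcomb L r).
Proof.
move=> V0; elim: L x => [x Bx|e L IH x [r0 Vr0 /IH[r Vr Br]]].
  by exists (fun=> 0); rewrite // /qcomb big_ord0 subr0.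
exists (fun j => if j is j'.+1 then r j' else r0); first by case.
by rewrite qcomb_cons opprD addrA.
Qed.

(** With a common ideal [P], the triangular condition constrains every coefficient: once the leading
    one is in [P], its whole term is in [P] and can be removed. *)
Lemma indep_coef P L r : ideal P -> (forall e, e \in L -> e.2 = P) ->
  indep q P L -> P (qcomb L r) -> forall j, (j < size L)%N -> P (r j).
Proof.
move=> hP; elim: L r => [//|e L IH] r hL /= [he hi]; rewrite qcomb_cons => hc.
have Pr0 : P (r 0%N).
  rewrite -(hL e) ?inE ?eqxx //; apply: he.
  have : P (r 0%N ^+ q * e.1 - qcomb L (fun j => - r j.+1)).
    have -> : qcomb L (fun j => - r j.+1) = - qcomb L (r \o S).
      rewrite -[RHS]sub0r -[X in _ = X - _](_ : qcomb L (fun=> 0) = 0).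
        by rewrite -qcombB; apply: eq_bigr => j _; rewrite sub0r.
      by rewrite /qcomb big1 // => j _; rewrite expr0n gtn_eqF // mul0r.
    by rewrite opprK.
  move: (r 0%N ^+ q * e.1) (fun j => - r j.+1); elim: (L) => [|f L' IHL] x s.
    by rewrite /qcomb big_ord0 subr0.
  rewrite qcomb_cons opprD addrA => /IHL h; exists (s 0%N) => //.
case=> [_|j jL]; first exact: Pr0.
apply: (IH (r \o S)) => //.
- by move=> f fL; apply: hL; rewrite inE fL orbT.
- rewrite -(addrK (r 0%N ^+ q * e.1) (qcomb _ _)) [qcomb _ _ + _]addrC.
  by apply: idealB => //; apply: ideal_mulr => //; apply: idealX.
Qed.

(** The base [U'] and the set [U] of coefficients differ because [indep_descent] relates two
    consecutive Frobenius powers. *)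
Lemma indep_of_coef U U' (ws : seq R) :
  (forall r, U' (qcomb [seq (w, U) | w <- ws] r) ->
     forall j, (j < size ws)%N -> U (r j)) ->
  indep q U' [seq (w, U) | w <- ws].
Proof.
elim: ws => [//|w ws IH] h /=; split.
  move=> r /(TT_coef (I : setT 0))[s _ hs].
  have := h (fun j => if j is j'.+1 then - s j' else r).
  rewrite /= qcomb_cons /=; set a := qcomb _ _ in hs *; set b := qcomb _ _.
  have -> : b = - a.
    rewrite /a /b /qcomb -sumrN; apply: eq_bigr => j _ /=.
    by rewrite expN_q // mulNr.
  by move=> /(_ hs 0%N); apply.
apply: IH => r hr j js.
have := h (fun j => if j is j'.+1 then r j' else 0).
rewrite /= qcomb_cons /= expr0n gtn_eqF // mul0r add0r => /(_ hr j.+1).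
by apply.
Qed.

End Coefficients.

(** * Limits up to geometric errors *)

Section GeometricErrors.
Variables (K : realType) (p : nat).
Hypothesis p_gt1 : (1 < p)%N.

Let pn_gt0 n : 0 < (p ^ n)%:R :> K.
Proof. by rewrite ltr0n expn_gt0 (ltnW p_gt1). Qed.

Lemma cvg_invpow (c : K) : (fun n => c / (p ^ n)%:R) @ \oo --> (0 : K).
Proof.
have : `|(p%:R : K)^-1| < 1.
  by rewrite ger0_norm ?invr_ge0 // invf_lt1 ?ltr1n // ltr0n ltnW.
move=> /(cvg_geometric c); apply: cvg_trans; apply: near_eq_cvg.
by apply: nearW => n; rewrite /= natrX exprVn.
Qed.

Lemma cvg_pow_close (u v : nat -> K) n0 (c l : K) :
  (forall n, (n0 <= n)%N -> `|u n - v n| <= c / (p ^ n)%:R) ->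
  u @ \oo --> l -> v @ \oo --> l.
Proof.
move=> huv ul.
have h0 : (u - v) @ \oo --> (0 : K).
  apply: (@squeeze_cvgr _ _ _ _ (fun n => - (c / (p ^ n)%:R)) (fun n => c / (p ^ n)%:R)).
  - exists n0 => // n /= n0n; rewrite -ler_norml; exact: huv.
  - by rewrite -oppr0; apply: cvgN; apply: cvg_invpow.
  - exact: cvg_invpow.
have -> : v = u - (u - v).
  by apply/funext => n; rewrite /= !fctE opprB addrC subrK.
by rewrite -[l]subr0; apply: cvgB.
Qed.

(** If one sequence diverges, so does the other, and [lim] then takes the same default value on
    both. *)
Lemma lim_pow_close (u v : nat -> K) n0 (c : K) :
  (forall n, (n0 <= n)%N -> `|u n - v n| <= c / (p ^ n)%:R) ->
  lim (u @ \oo) = lim (v @ \oo).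
Proof.
move=> huv; have hvu n : (n0 <= n)%N -> `|v n - u n| <= c / (p ^ n)%:R.
  by rewrite distrC; apply: huv.
have [ul|nu] := pselect (cvg (u @ \oo)).
  apply/esym; apply: cvg_lim; first exact: Rhausdorff.
  exact: cvg_pow_close huv ul.
rewrite (dvgP nu) dvgP // => vl; apply: nu.
by apply: cvgP; apply: cvg_pow_close hvu vl.
Qed.

Lemma natr_pow_split e n : ((p ^ n) ^ e)%:R / (p ^ n)%:R ^+ e.+1 = ((p ^ n)%:R : K)^-1.
Proof.
have h : ((p ^ n)%:R : K) != 0 by rewrite gt_eqF.
by rewrite natrX exprS invfM mulrCA mulfV ?expf_neq0 // mulr1.
Qed.

Lemma cvg_superadditive e (a : nat -> nat) C C' :
  (forall n, p ^ e.+1 * a n <= a n.+1 + C * (p ^ n) ^ e)%N ->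
  (forall n, a n <= C' * (p ^ n) ^ e.+1)%N ->
  cvg ((fun n => (a n)%:R / (p ^ n)%:R ^+ e.+1 : K) @ \oo).
Proof.
move=> h1 h2; pose u n : K := (a n)%:R / (p ^ n)%:R ^+ e.+1.
have pe n : 0 < ((p ^ n)%:R : K) ^+ e.+1 by rewrite exprn_gt0.
have uS n : u n <= u n.+1 + C%:R / (p ^ n)%:R.
  have : (p ^ e.+1 * a n)%:R <= (a n.+1 + C * (p ^ n) ^ e)%:R :> K by rewrite ler_nat.
  rewrite -(ler_pM2r (x := ((p ^ n.+1)%:R ^+ e.+1)^-1)) ?invr_gt0 // natrD mulrDl.
  have -> : (p ^ e.+1 * a n)%:R / (p ^ n.+1)%:R ^+ e.+1 = u n.
    rewrite /u [(p ^ n.+1)%N]expnS [(p * p ^ n)%:R]natrM [(p ^ e.+1 * _)%:R]natrM exprMn natrX.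
    have h : (p%:R : K) ^+ e.+1 != 0 by rewrite expf_neq0 // pnatr_eq0 -lt0n ltnW.
    rewrite invfM mulrACA [X in X * _]mulfV // mul1r; congr (_ / _).
  move=> /le_trans; apply; rewrite lerD2l natrM -mulrA ler_wpM2l // -(natr_pow_split e n).
  rewrite ler_wpM2l // lef_pV2 ?posrE // lerXn2r ?nnegrE ?ler_nat //.
  by rewrite leq_pexp2l // ltnW.
(* The errors C / p ^ j for j >= n add up to at most 2 * C / p ^ n, since p >= 2; subtracting this
   bound makes the sequence nondecreasing. *)
pose v n : K := u n - (2 * C%:R) / (p ^ n)%:R.
have vS n : v n <= v n.+1.
  have hp : (2 * C%:R) / (p ^ n.+1)%:R <= C%:R / (p ^ n)%:R :> K.
    have hs : 2 * (p%:R)^-1 <= 1 :> K.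
      have p0 : 0 < (p%:R : K) by rewrite ltr0n; apply: ltnW.
      by rewrite (ler_pdivrMr _ _ p0) mul1r (ler_nat K 2 p).
    have ht : 0 <= C%:R / (p ^ n)%:R :> K by rewrite divr_ge0.
    by rewrite expnS natrM invfM mulrACA ler_piMl.
  have e2 : (2 * C%:R) / (p ^ n)%:R = C%:R / (p ^ n)%:R + C%:R / (p ^ n)%:R :> K.
    by rewrite -mulrDl (mulr_natl C%:R 2) mulr2n.
  move: hp (uS n); rewrite /v e2.
  move=> hp hu; apply: (@le_trans _ _ (u n.+1 - C%:R / (p ^ n)%:R)).
    by rewrite opprD addrA lerD2r lerBlDr.
  by rewrite lerD2l lerN2.
have vcvg : cvg (v @ \oo).
  apply: nondecreasing_is_cvgn.
    by apply: homo_leq => // x y z; apply: le_trans.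
  exists C'%:R => _ [n _ <-]; rewrite /v /u.
  apply: (@le_trans _ _ ((a n)%:R / (p ^ n)%:R ^+ e.+1)).
    by rewrite gerBl divr_ge0 // ?mulr_ge0 // ltW.
  by rewrite ler_pdivrMr // -natrX -natrM ler_nat.
apply: cvgP; apply: (@cvg_pow_close v _ 0%N (2 * C%:R) _ _ vcvg) => n _.
rewrite /v /u addrC addKr normrN ger0_norm //.
Qed.

End GeometricErrors.

Lemma leq_sum_seq_mem (T : eqType) (r : seq T) (F G : T -> nat) :
  (forall i, i \in r -> (F i <= G i)%N) ->
  (\sum_(i <- r) F i <= \sum_(i <- r) G i)%N.
Proof.
by move=> h; rewrite big_seq [leqRHS]big_seq; apply: leq_sum => i; apply: h.
Qed.

(** * Standard graded rings over a perfect field *)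

Section Standard.
Variables (p : nat) (k : fieldType) (R : comAlgType k) (Rg : nat -> set R).
Hypothesis hk : perfect_char p k.
Hypothesis hN : noetherian R.
Hypothesis hG : is_grading Rg.
Hypothesis Rg1 : Rg 0%N 1.
Hypothesis hR0 : Rg 0%N = range (fun a : k => a%:A : R).
Hypothesis hgen : smallest (fun A : set R => subalg_closed (mem A)) (Rg 1%N) = setT.
Implicit Types (I P B : set R) (L : seq (R * set R)).
Local Notation hc := (hcomp hG).
Local Notation hideal := (hideal hG).

Let RgS m : @submodule k R (Rg m). Proof. exact: Rg_submodule. Qed.
Hint Resolve RgS : core.

Let RgS0 m : Rg m 0. Proof. exact: Rg0. Qed.
Hint Resolve RgS0 : core.

Let S0 : @submodule k R [set 0]. Proof. exact/ideal_submodule/ideal_set0. Qed.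
Hint Resolve S0 : core.

Lemma p_prime : prime p.
Proof. by case: hk => /andP[]. Qed.

Lemma pX_gt0 n : (0 < p ^ n)%N.
Proof. by rewrite expn_gt0 prime_gt0 // p_prime. Qed.

Lemma pcharR : p \in [pchar R].
Proof.
case: hk => /andP[pp /eqP p0] _; rewrite inE; apply/andP; split=> //.
by rewrite -scaler_nat p0 scale0r.
Qed.

Lemma expBp n (x y : R) : (x - y) ^+ (p ^ n) = x ^+ (p ^ n) - y ^+ (p ^ n).
Proof.
have pn : [pchar R].-nat (p ^ n)%N.
  by rewrite pnatX (eq_pnat _ (pcharf_eq pcharR)) pnat_id ?p_prime.
have /eqP := exprDn_pchar (x - y) y pn.
by rewrite subrK -subr_eq eq_sym => /eqP.
Qed.

Lemma k_perfX n (a : k) : exists b : k, b ^+ (p ^ n) = a.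
Proof.
case: hk => _ hp; elim: n a => [a|n IH a]; first by exists a; rewrite expn0 expr1.
have [b <-] := IH a; have [c <-] := hp b.
by exists c; rewrite expnS exprM.
Qed.

Definition expDp n := expD_q (@expBp n) (pX_gt0 n).

Section Components.
Variable n : nat.
Local Notation q := (p ^ n)%N.

Lemma TT_comp B L x j : hideal B -> (forall e, e \in L -> exists a, Rg a e.1) ->
  TT q setT B L x -> TT q setT B L (hc x j).
Proof.
move=> hB; elim: L x => [|e L IH] x hL /=; first exact: (hB.2).
move=> [r _ xr]; have [|a ea] := hL e; first by rewrite inE eqxx.
have {}IH := IH _ (fun f fL => hL f (mem_behead (s := e :: L) fL)) xr.
rewrite hcompB in IH.
have [[m jm]|nm] := pselect (exists m, j = (q * m + a)%N).
  by exists (hc r m) => //; rewrite -(hcompX hG Rg1 (@expBp n) (pX_gt0 n) r ea jm).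
exists 0 => //; rewrite expr0n gtn_eqF ?pX_gt0 // mul0r subr0.
move: IH; rewrite (hcompX_zero hG Rg1 (@expBp n) (pX_gt0 n) _ ea) ?subr0 //.
by move=> m jm; apply: nm; exists m.
Qed.

(** Since all vectors have the one degree [q * delta], the coefficients can be cut down to their
    components of degree [M - delta]; this is how the coefficients come to be counted by Hilbert
    functions. *)
Lemma TT_homog delta M B L x : hideal B ->
  (forall e, e \in L -> Rg (q * delta)%N e.1) ->
  TT q setT B L x -> Rg (q * M)%N x -> TT q (Rs Rg M delta) B L x.
Proof.
move=> hB hL + Mx; rewrite -{2}(hcomp_id hG Mx) => {Mx}.
elim: L x hL => [|e L IH] x hL /=; first exact: (hB.2).
move=> [r _ xr].
have eL : Rg (q * delta)%N e.1 by apply: hL; rewrite inE eqxx.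
have {}IH := IH _ (fun f fL => hL f (mem_behead (s := e :: L) fL)) xr.
rewrite hcompB in IH.
have [dM|dM] := leqP delta M.
  exists (hc r (M - delta)); first by rewrite /Rs /= dM; apply: hcompP.
  rewrite -(hcompX hG Rg1 (@expBp n) (pX_gt0 n) r eL (j := (q * M)%N)) //.
  by rewrite -mulnDr subnK.
exists 0; first exact: Rs0.
rewrite expr0n gtn_eqF ?pX_gt0 // mul0r subr0.
move: IH; rewrite (hcompX_zero hG Rg1 (@expBp n) (pX_gt0 n) _ eL) ?subr0 //.
move=> m; rewrite -mulnDr => /eqP; rewrite eqn_pmul2l ?pX_gt0 // => /eqP h.
by move: dM; rewrite h ltnNge leq_addl.
Qed.

End Components.

(** [TT 1] encodes the sums of r_j * y_j. Finite generation of the irrelevant ideal makes R_1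
    finite-dimensional; generation of the algebra in degree 1 gives the higher degrees. *)
Lemma exists_gens : exists ys : seq R, (forall y, y \in ys -> Rg 1%N y) /\
  forall m, Rg m.+1 `<=` TT 1 (Rg m) [set 0] [seq (y, [set 0]) | y <- ys].
Proof.
have exp1B (x y : R) : (x - y) ^+ 1 = x ^+ 1 - y ^+ 1 by [].
have k1_perf (a : k) : exists b : k, b ^+ 1 = a by exists a.
pose Rp : set R := [set x | hc x 0%N = 0].
have hRp : ideal Rp.
  apply/idealP; split; first exact: hcomp0.
  move=> a x y; rewrite /Rp /= => x0 y0; rewrite hcompD y0 addr0.
  have [n [_ ->]] := hcomp_fin hG x.
  rewrite mulr_sumr hcomp_sum big1 // => i _.
  rewrite (hcompM hG _ _ (hcompP hG x i)); case: ifP => //.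
  by rewrite leqn0 => /eqP ->; rewrite x0 mulr0.
have [s Rps] := hN hRp.
pose ys := [seq hc z 1%N | z <- s].
have ys1 y : y \in ys -> Rg 1%N y by move=> /mapP[z _ ->]; apply: hcompP.
have R1 : Rg 1%N `<=` sp [set 0] ys.
  (* This is an ideal because R_0 = k: the degree 1 part of a multiple of an element of [Rp] only
     involves the constant term of the multiplier. *)
  pose J : set R := [set x | Rp x /\ sp [set 0] ys (hc x 1%N)].
  have hJ : ideal J.
    apply/idealP; split; first by split; [exact: ideal0|rewrite hcomp0; exact: (submodule0 (sp_submodule ys S0))].
    move=> a x y [Rx sx] [Ry sy]; split; first by apply: idealD => //; apply: ideal_mull.
    rewrite hcompD; apply: submoduleD => //; first exact: sp_submodule.
    have [[|n] [_ ->]] := hcomp_fin hG x.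
      rewrite big_ord0 mulr0 hcomp0; exact: (submodule0 (sp_submodule ys S0)).
    rewrite big_ord_recl /= [hc x 0%N]Rx add0r.
    case: n => [|n]; first by rewrite big_ord0 mulr0 hcomp0; exact: (submodule0 (sp_submodule ys S0)).
    rewrite big_ord_recl /= mulrDr hcompD mulr_sumr hcomp_sum big1 ?addr0.
      rewrite (hcompM hG _ _ (hcompP hG x _)) /= subnn.
      have := hcompP hG a 0%N; rewrite hR0 => -[c _ <-].
      by rewrite -scalerAl mul1r; apply: submoduleZ => //; apply: sp_submodule.
    by move=> i _; rewrite (hcompM hG _ _ (hcompP hG x _)).
  move=> x x1; have : Rp x by rewrite /Rp /= (hcomp_homog hG _ x1).
  rewrite Rps => /(ideal_gen_min hJ) h.
  have [|_] := h; last by rewrite (hcomp_id hG x1).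
  move=> z zs; split; first by rewrite Rps; apply: ideal_gen_sub.
  by apply: mem_sp => //; apply: map_f.
exists ys; split=> // m.
pose L := [seq (y, [set 0 : R]) | y <- ys].
pose GG m := TT 1 (Rg m) [set 0] L.
have GGS j : @submodule k R (GG j) by apply: TT_submodule.
(* The elements whose components of positive degree decompose as wanted form a subalgebra containing
   R_1. *)
pose A : set R := [set x | forall m, GG m (hc x m.+1)].
have hA : subalg_closed (mem A).
  split.
  - by rewrite inE => j; rewrite (hcomp_homog hG _ Rg1) /=; apply: submodule0.
  - move=> a x y; rewrite !inE => Ax Ay j; rewrite hcomp_lin.
    by apply: submoduleD => //; apply: submoduleZ.
  - move=> x y; rewrite !inE => Ax Ay j.
    have [n [_ ->]] := hcomp_fin hG y.
    rewrite mulr_sumr hcomp_sum; apply: submodule_sum => // i _.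
    rewrite (hcompM hG _ _ (hcompP hG y i)); case: ifP => ij; last exact: submodule0.
    case: (nat_of_ord i) ij => [_|i' ij].
      have := hcompP hG y 0%N; rewrite hR0 => -[c _ <-].
      by rewrite subn0 -scalerAr mulr1; apply: submoduleZ.
    rewrite subSS -[hc x _]expr1; apply: TT_mul (Ay i'); first exact: ideal_set0.
    by move=> r ri; have := RgM hG (hcompP hG x (j - i')) ri; rewrite subnK.
have RA : Rg 1%N `<=` A.
  move=> x x1 [|j]; last by rewrite (hcomp_homog hG _ x1); apply: submodule0.
  rewrite (hcomp_id hG x1); apply: sp_min (R1 x x1) => //.
    by move=> _ ->; apply: submodule0.
  rewrite /GG /L; elim: (ys) => [//|y r IH] z; rewrite inE => /orP[/eqP ->|/IH h].
    exists 1; rewrite // expr1 mul1r subrr; apply: TT_base => //.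
  by exists 0; rewrite // expr1 mul0r subr0.
move=> x xm; have : A x.
  suff : setT x by rewrite -hgen; apply.
  by [].
by move=> /(_ m); rewrite (hcomp_id hG xm).
Qed.

(** * Generators and Noetherian induction *)

Lemma exists_basis : exists (ys : seq R) (bas : nat -> seq R),
  [/\ forall y, y \in ys -> Rg 1%N y,
      forall m, Rg m `<=` sp [set 0] (bas m)
    & forall m u, u \in bas m -> exists w,
        [/\ {subset w <= ys}, size w = m & u = \prod_(x <- w) x]].
Proof.
have [ys [y1 hys]] := exists_gens.
pose L := [seq (y, [set 0 : R]) | y <- ys].
pose bas := fix bas m := if m is m'.+1 then
  flatten [seq [seq r ^+ 1 * e.1 | r <- bas m'] | e <- L] else [:: 1].
exists ys, bas; split=> //.
  elim=> [|m IH] x xm.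
    move: xm; rewrite hR0 => -[a _ <-]; exists a; by rewrite /= subrr.
  suff h : TT 1 (Rg m) [set 0] L `<=` sp [set 0] (bas m.+1) by exact: h (hys m x xm).
  apply: (@TT_sp k R 1 (fun x y => erefl) (Rg m) [set 0] L (fun=> bas m)) => //.
  - by move=> _ /mapP[y _ ->].
  - by move=> _ /mapP[y _ ->] r -> /=; rewrite expr1 mul0r.
elim=> [|m IH] u /=.
  by rewrite inE => /eqP ->; exists [::]; rewrite big_nil.
move=> /flattenP[_ /mapP[_ /mapP[y yys ->] ->] /mapP[r /IH[w [wy sw ->]] ->]].
exists (y :: w); split.
- by move=> z; rewrite inE => /orP[/eqP ->|/wy].
- by rewrite /= sw.
- by rewrite big_cons mulrC.
Qed.

Lemma word_homog (ys w : seq R) : (forall y, y \in ys -> Rg 1%N y) ->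
  {subset w <= ys} -> Rg (size w) (\prod_(x <- w) x).
Proof.
move=> y1; elim: w => [|z w IH] wy; first by rewrite big_nil.
rewrite big_cons /= -add1n; apply: RgM => //; first by apply/y1/wy; rewrite inE eqxx.
by apply: IH => x xw; apply: wy; rewrite inE xw orbT.
Qed.

Lemma Rfin m U : @submodule k R U -> qfin U (Rg m).
Proof.
move=> hU; have [ys [bas [_ hb _]]] := exists_basis.
exists (bas m) => x /hb; apply: sp_subl => _ ->; exact: submodule0.
Qed.
Hint Resolve Rfin : core.

Lemma Rfin_sub m U V : @submodule k R U -> V `<=` Rg m -> qfin U V.
Proof. by move=> hU VR; apply: qfin_sub (Rfin m hU). Qed.

(* The pigeonhole principle makes every monomial of large degree divisible by
   the q-th power of a generator, so that R is finite over its q-th powers. *)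
Lemma exists_pow_basis q : (0 < q)%N -> exists (N : nat) (bas : nat -> seq R),
  [/\ forall m u, u \in bas m -> Rg m u, forall m, Rg m `<=` sp [set 0] (bas m)
    & forall m W, (N < m)%N -> @submodule k R W ->
      (forall y r, Rg 1%N y -> Rg (m - q)%N r -> (q <= m)%N -> W (y ^+ q * r)) ->
      Rg m `<=` W].
Proof.
move=> q0; have [ys [bas [y1 hb hw]]] := exists_basis.
exists (size ys * q.-1)%N, bas; split=> //.
  by move=> m u /hw[w [wy <- ->]]; apply: word_homog wy.
move=> m W Nm hW h x /hb; apply: sp_min => //; first by move=> _ ->; apply: submodule0.
move=> u /hw[w [wy sw ->]].
have sz : (size ys * q.-1 < size w)%N by rewrite sw.
have [y yys [w' [ww sw' ->]]] := pigeonhole_pow wy sz q0.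
rewrite sw in sw'; apply: h; first exact: y1.
  by rewrite -sw' addnK; apply: word_homog (fun z zw => wy z (ww z zw)).
by rewrite -sw' leq_addl.
Qed.

(** Stripping off the q-th power of a linear form lowers the degree by exactly q, so that degrees
    stay divisible by q. This is the form needed for families homogeneous of one degree. *)
Lemma Rgq_gen q : (0 < q)%N -> exists (N : nat) (bas : nat -> seq R),
  (forall m u, u \in bas m -> Rg m u) /\
  forall M W, @submodule k R W ->
    (forall m s u, (m <= N)%N -> (m <= M)%N -> Rg (M - m)%N s ->
      u \in bas (q * m)%N -> W (s ^+ q * u)) -> Rg (q * M)%N `<=` W.
Proof.
move=> q0; have [N [bas [bR hb hN1]]] := exists_pow_basis q0.
exists N, bas; split=> // M; have [n] := ubnP M; elim: n M => // n IH M Mn W hW h.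
have [MN|NM] := leqP M N.
  move=> x /hb; apply: sp_min => //; first by move=> _ ->; apply: submodule0.
  by move=> u ub; rewrite -[u]mul1r -(expr1n _ q); apply: h ub; rewrite ?subnn.
apply: hN1 => //; first by apply: leq_trans NM _; rewrite leq_pmull.
move=> y r y1.
have M0 : (0 < M)%N by apply: leq_ltn_trans NM.
have -> : (q * M - q = q * M.-1)%N by rewrite -[in RHS]subn1 mulnBr muln1.
move=> rM _; apply: (IH M.-1 _ [set r | W (y ^+ q * r)]) rM.
- by rewrite -ltnS prednK.
- apply/submoduleP; split; first by rewrite /= mulr0; apply: submodule0.
  move=> a x z /= Wx Wz; rewrite mulrDr -scalerAr; apply: submoduleD => //.
  exact: submoduleZ.
- move=> m s u mN mM sR ub /=; rewrite mulrA -exprMn; apply: h ub => //.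
    by apply: leq_trans mM _; rewrite leq_pred.
  have -> : (M - m = 1 + (M.-1 - m))%N by lia.
  exact: RgM.
Qed.

Lemma Rq_gen q : (0 < q)%N -> exists us : seq R,
  (forall u, u \in us -> exists a, Rg a u) /\
  forall W, @submodule k R W -> (forall s u, u \in us -> W (s ^+ q * u)) ->
    forall x, W x.
Proof.
move=> q0; have [N [bas [bR hb hN1]]] := exists_pow_basis q0.
exists (flatten [seq bas m | m <- iota 0 N.+1]); split.
  by move=> u /flattenP[_ /mapP[m _ ->] /bR]; exists m.
suff h m W : @submodule k R W -> (forall s u,
    u \in flatten [seq bas m | m <- iota 0 N.+1] -> W (s ^+ q * u)) -> Rg m `<=` W.
  move=> W hW hs; apply: (hcomp_ind hG) => [m x|x y]; first exact: h.
  exact: submoduleD.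
have [n] := ubnP m; elim: n m W => // n IH m W mn hW h.
have [mN|Nm] := leqP m N.
  move=> x /hb; apply: sp_min => //; first by move=> _ ->; apply: submodule0.
  move=> u ub; rewrite -[u]mul1r -(expr1n _ q); apply: h.
  by apply/flattenP; exists (bas m) => //; apply: map_f; rewrite mem_iota ltnS mN.
apply: hN1 => // y r y1 rm qm; apply: (IH (m - q)%N [set r | W (y ^+ q * r)]) rm.
- by lia.
- apply/submoduleP; split; first by rewrite /= mulr0; apply: submodule0.
  move=> a x z /= Wx Wz; rewrite mulrDr -scalerAr; apply: submoduleD => //.
  exact: submoduleZ.
- by move=> s u ub /=; rewrite mulrA -exprMn; apply: h.
Qed.

(** Consider the components of lowest degree of [x] and [y] outside [I]: in x * y, every other term
    of their total degree lies in [I]. *)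
Lemma hprimeP I : hideal I -> ~ I 1 ->
  (forall a b x y, Rg a x -> Rg b y -> I (x * y) -> I x \/ I y) -> prime_ideal I.
Proof.
move=> [hI hhI] n1 h; apply/prime_idealP; split=> // x y Ixy.
have low z : ~ I z -> exists i, ~ I (hc z i) /\ forall j, (j < i)%N -> I (hc z j).
  move=> nz; have ex : exists i, `[< ~ I (hc z i) >].
    apply: contrapT => ne; apply: nz; apply: (hcomp_mem (hG := hG) hI) => i.
    by apply: contrapT => ni; apply: ne; exists i; apply/asboolP.
  have [i /asboolP ni imin] := ex_minnP ex; exists i; split=> // j ji.
  apply: contrapT => nj; have : (i <= j)%N by apply: imin; apply/asboolP.
  by rewrite leqNgt ji.
apply: contrapT => /not_orP[/low[i [nxi xi]] /low[j [nyj yj]]].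
suff Iij : I (hc x i * hc y j).
  by have [] := h _ _ _ _ (hcompP hG x i) (hcompP hG y j) Iij.
have [n [ny yE]] := hcomp_fin hG y.
have jn : (j < n)%N.
  by rewrite ltnNge; apply/negP => /ny y0; apply: nyj; rewrite y0; apply: ideal0.
have := hhI _ (i + j)%N Ixy; rewrite {1}yE mulr_sumr hcomp_sum.
rewrite (bigD1 (Ordinal jn)) //= (hcompM_r hG _ _ (hcompP hG y j)) => hs.
rewrite -(addrK (\sum_(l < n | l != Ordinal jn) hc (x * hc y l) (i + j)) (hc x i * _)).
apply: idealB => //; apply: ideal_sum => // l lj.
rewrite (hcompM hG _ _ (hcompP hG y l)); case: ifP => lij; last exact: ideal0.
have [llt|] := ltnP l j; first by apply: ideal_mull => //; apply: yj.
rewrite leq_eqVlt => /orP[/eqP jl|jl].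
  by move: lj; rewrite -val_eqE /= jl eqxx.
by apply: ideal_mulr => //; apply: xi; lia.
Qed.

(** A homogeneous ideal that is neither prime nor the unit ideal has homogeneous x, y outside it
    with x * y in it, so that both I + (x) and I : x are strictly larger. This replaces a filtration
    of R / I by shifted copies of domains R / P. *)
Lemma hnoeth_ind (Th : set R -> Prop) : Th setT ->
  (forall P, hideal P -> prime_ideal P -> Th P) ->
  (forall I a x, hideal I -> Rg a x -> ~ I x ->
     Th (addi I (prin x)) -> Th (colon I x) -> Th I) ->
  forall I, hideal I -> Th I.
Proof.
move=> hT hP hS; suff h I : ideal I -> hideal I -> Th I.
  by move=> I hI; apply: h => //; apply: hideal_ideal hI.
move: I; apply: (noeth_ind hN) => I hI IH hhI.
have [I1|n1] := pselect (I 1).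
  suff -> : I = setT by [].
  by apply/seteqP; split=> // x _; rewrite -[x]mulr1; apply: ideal_mull.
have [[a [b [x [y [xa yb Ixy [nx ny]]]]]]|nex] := pselect (exists a b x y,
    [/\ Rg a x, Rg b y, I (x * y) & ~ I x /\ ~ I y]); last first.
  apply: hP => //; apply: hprimeP => // a b x y xa yb Ixy.
  apply: contrapT => /not_orP[nx ny]; apply: nex.
  by exists a, b, x, y.
apply: (hS I a x) => //; apply: IH.
- exact: addi_ideal hI (prin_ideal x).
- exact: addil (prin_ideal x).
- move=> e; apply: nx; rewrite e; apply: addir => //; exact: prin_mem.
- by apply: hideal_addi => //; apply: hideal_prin xa.
- exact: colon_ideal.
- by move=> z Iz; rewrite /colon /=; apply: ideal_mulr.
- by move=> e; apply: ny; rewrite e /colon /= mulrC.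
- exact: hideal_colon xa.
Qed.

(** * Hilbert functions *)

Definition hilb I m : nat := qd I (Rg m).

(** The bound dim R / I <= e within the natural numbers; it holds vacuously for the unit ideal. *)
Definition coht_le I e : Prop := forall n c,
  strict_chain [set P | prime_ideal P /\ I `<=` P] n c -> (n <= e)%N.

Lemma coht_le_sub I J e : I `<=` J -> coht_le I e -> coht_le J e.
Proof.
move=> IJ h n c [hc1 hc2]; apply: (h n c); split=> // i ilt.
by have [h1 h2] := hc1 i ilt; split=> //; apply: subset_trans IJ h2.
Qed.

Lemma coht_le_step P J x e : prime_ideal P -> P `<=` J -> J x -> ~ P x ->
  coht_le P e.+1 -> coht_le J e.
Proof.
move=> hP PJ Jx nPx h n c [hc1 hc2].
suff : (n.+1 <= e.+1)%N by [].
apply: (h n.+1 (fun i => if i is i'.+1 then c i' else P)); split.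
  case=> [_|i ilt]; first by split.
  by have [h1 h2] := hc1 i ilt; split=> //; apply: subset_trans PJ h2.
case=> [_|i ilt]; last exact: hc2.
have [_ Jc] := hc1 0%N (leq0n n).
split; first by apply: subset_trans PJ Jc.
by move=> h'; apply: nPx; apply: h'; apply: Jc.
Qed.

Lemma coht_le_krull (K : realType) P d : krull_dim K P = d%:R%:E -> coht_le P d.
Proof.
move=> hP n c hc'; have : ((n%:R : K)%:E <= krull_dim K P)%E.
  by apply: ereal_sup_ubound; exists n => //; exists c.
by rewrite hP lee_fin ler_nat.
Qed.

(** Multiplication by [x] maps R / (I : x), shifted by [a], onto (I + (x)) / I. For m < a the source
    is zero in degree m, hence the test that guards the truncated subtraction. *)
Lemma hilb_cut I a x m : hideal I -> Rg a x ->
  (hilb I m <= hilb (addi I (prin x)) m +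
     (if (a <= m)%N then hilb (colon I x) (m - a) else 0))%N.
Proof.
move=> hI xa; have hx := hideal_prin hG xa; have hIx := hideal_addi hI hx.
rewrite /hilb (@qd_split _ _ I (addi I (prin x)) (Rg m)) //; first last.
- exact/Rfin/(hideal_submodule hI).
- exact/addil/prin_ideal.
- exact: hideal_submodule hIx.
- exact: hideal_submodule hI.
rewrite addnC leq_add2l.
have [t bt] := qbasis_exists (hideal_submodule (hideal_colon hI xa))
  (Rfin (m - a) (hideal_submodule (hideal_colon hI xa))).
rewrite (qd_basis (hideal_submodule (hideal_colon hI xa)) bt).
have key y : Rg m y -> addi I (prin x) y ->
    I y \/ (a <= m)%N /\ exists2 r, Rg (m - a)%N r & I (y - r * x).
  move=> ym [u [_ [Iu [r ->] yE]]].
  have := hcomp_id hG ym; rewrite yE hcompD (hcompM hG _ _ xa).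
  case: ifP => am; last by rewrite addr0 => <-; left; apply: hI.2.
  move=> h; right; split=> //; exists (hc r (m - a)); first exact: hcompP.
  by rewrite -h addrK; apply: hI.2.
case: ifP => am.
  rewrite -(size_map (fun r => r * x)); apply: qd_le; first exact: hideal_submodule hI.
  move=> y [ym hy]; have [Iy|[_ [r rm Iyr]]] := key y ym hy; first exact: sub_sp.
  rewrite -(subrK (r * x) y); apply: submoduleD.
  - exact/sp_submodule/(hideal_submodule hI).
  - exact: sub_sp.
  have [_ _ ht] := bt.
  apply: (@sp_image _ _ _ id (fun r => r * x) _ _ (colon I x)) => //.
  - by move=> y1 y2; rewrite mulrBl.
  - by move=> a' y'; rewrite scalerAl.
  - exact: ht.
rewrite leqn0; apply/eqP; apply: qd0; first exact: hideal_submodule hI.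
by move=> y [ym /key[//|//|]]; rewrite am => -[].
Qed.

Lemma hilb_setT m : hilb setT m = 0%N.
Proof. by apply: qd0 => //; apply/submoduleP. Qed.


Lemma Rg_sub_ideal I m : ideal I -> Rg 1%N `<=` I -> Rg m.+1 `<=` I.
Proof.
move=> hI R1I x; have [ys [y1 hys]] := exists_gens => /hys.
have : forall y, y \in ys -> I y by move=> y /y1/R1I.
elim: (ys) x => [_ x ->|y r IH x yI /= [z _ h]]; first exact: ideal0.
rewrite -(subrK (z ^+ 1 * y) x); apply: idealD => //.
  by apply: IH h => w wr; apply: yI; rewrite inE wr orbT.
by apply: ideal_mull => //; apply: yI; rewrite inE eqxx.
Qed.

Lemma hilb0_le1 I : ideal I -> (hilb I 0 <= 1)%N.
Proof.
move=> hI; apply: (@qd_le _ _ _ _ [:: 1]); first exact: ideal_submodule.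
by move=> x; rewrite hR0 => -[a _ <-]; exists a; rewrite /= subrr; apply: ideal0.
Qed.

Lemma hilb_top P m : ideal P -> Rg 1%N `<=` P -> hilb P m.+1 = 0%N.
Proof.
by move=> hP h; apply: qd0; [apply: ideal_submodule|apply: Rg_sub_ideal].
Qed.

Lemma colon_prime P x : prime_ideal P -> ~ P x -> colon P x = P.
Proof.
move=> hP nPx; apply/seteqP; split=> y; rewrite /colon /=.
  by move=> h; apply: contrapT => ny; exact: (primeM hP ny nPx) h.
exact: (ideal_mulr _ (prime_ideal_ideal hP)).
Qed.

(** For a prime, P : y = P, so that [hilb_cut] telescopes. *)
Lemma hilb_prime_sum P y m : hideal P -> prime_ideal P -> Rg 1%N y -> ~ P y ->
  (hilb P m <= \sum_(i < m.+1) hilb (addi P (prin y)) i)%N.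
Proof.
move=> hP pP y1 nPy; elim: m => [|m IH].
  rewrite big_ord_recl big_ord0 addn0.
  by apply: leq_trans (hilb_cut 0 hP y1) _; rewrite addn0.
apply: leq_trans (hilb_cut m.+1 hP y1) _.
by rewrite big_ord_recr addnC /= subSS subn0 colon_prime // leq_add2r.
Qed.

Lemma irrelevant_prime : prime_ideal [set x | hc x 0%N = 0].
Proof.
have hM x y : hc (x * y) 0%N = hc x 0%N * hc y 0%N.
  have [[|n] [hn yE]] := hcomp_fin hG y.
    by rewrite yE big_ord0 hcomp0 !mulr0 hcomp0.
  rewrite {1}yE big_ord_recl /= mulrDr hcompD mulr_sumr hcomp_sum big1 ?addr0.
    by rewrite (hcompM hG _ _ (hcompP hG y 0%N)) /= subnn.
  by move=> i _; rewrite (hcompM hG _ _ (hcompP hG y _)).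
apply/prime_idealP; split.
- apply/idealP; split; first exact: hcomp0.
  by move=> a x y /= x0 y0; rewrite hcompD hM x0 y0 mulr0 addr0.
- by rewrite /= (hcomp_id hG Rg1) => /eqP; rewrite oner_eq0.
- move=> x y /=; rewrite hM.
  have := hcompP hG x 0%N; have := hcompP hG y 0%N.
  rewrite hR0 => -[b _ <-] [a _ <-] /eqP.
  rewrite -scalerAl mul1r scalerA.
  have [->|a0] := eqVneq a 0; first by left; rewrite scale0r.
  have [->|b0] := eqVneq b 0; first by right; rewrite scale0r.
  have ab : a * b != 0 by rewrite mulf_neq0.
  move=> /eqP h; have : (a * b)^-1 *: ((a * b) *: (1 : R)) = 0 by rewrite h scaler0.
  by rewrite scalerA mulVf // scale1r => /eqP; rewrite oner_eq0.
Qed.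

Lemma hprime_irrelevant P x : hideal P -> prime_ideal P -> P x -> hc x 0%N = 0.
Proof.
move=> hP pP /(hP.2 _ 0%N); have := hcompP hG x 0%N; rewrite hR0 => -[a _ <-].
have [->|a0] := eqVneq a 0; first by rewrite scale0r.
move=> h; case: (prime_n1 pP).
have := submoduleZ a^-1 (hideal_submodule hP) h.
by rewrite scalerA mulVf // scale1r.
Qed.

(** A homogeneous prime lies in the irrelevant ideal, strictly so unless it contains R_1; strictness
    would give a chain of length 1. *)
Lemma hilb_coht0 I : hideal I -> coht_le I 0 ->
  exists N, forall m, (N <= m)%N -> hilb I m = 0%N.
Proof.
move: I; apply: hnoeth_ind => [_|P hP pP h|I a x hI xa nIx IH1 IH2 h].
- by exists 0%N => m _; apply: hilb_setT.
- exists 1%N => -[//|m] _; apply: hilb_top; first exact: prime_ideal_ideal.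
  move=> y y1; apply: contrapT => nPy.
  have : (1 <= 0)%N; last by [].
  apply: (h 1%N (fun i => if i is 0%N then P else [set x | hc x 0%N = 0])).
  have Pm : P `<=` [set x | hc x 0%N = 0] by move=> x /(hprime_irrelevant hP pP).
  split; first by case=> [|i] _; split=> //; apply: irrelevant_prime.
  case=> // _; split=> // h'; apply: nPy; apply: h'.
  by rewrite /= (hcomp_homog hG _ y1).
- have [|N1 h1] := IH1; first by apply: coht_le_sub h; apply/addil/prin_ideal.
  have [|N2 h2] := IH2.
    by apply: coht_le_sub h => y Iy; apply: (ideal_mulr _ (hideal_ideal hI)).
  exists (N1 + N2 + a)%N => m hm; apply/eqP; rewrite -leqn0.
  apply: leq_trans (hilb_cut m hI xa) _.
  rewrite h1 ?add0n; last by lia.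
  by case: ifP => // am; rewrite h2 //; lia.
Qed.

Lemma hilb_sum_of_bound e I C : (forall m, hilb I m <= C * m.+1 ^ e)%N ->
  forall m, (\sum_(i < m.+1) hilb I i <= C * m.+1 ^ e.+1)%N.
Proof.
move=> h m; apply: (@leq_trans (\sum_(i < m.+1) C * m.+1 ^ e)).
  apply: leq_sum => i _; apply: leq_trans (h i) _.
  by rewrite leq_mul2l leq_expl ?orbT // ltn_ord.
by rewrite sum_nat_const card_ord expnS mulnCA.
Qed.

(** One half of an induction on the dimension. Cutting a prime by a linear form lowers the dimension
    by one, and [hilb_prime_sum] turns a cumulative bound there into a pointwise bound with the same
    exponent; [hilb_sum_bound] restores the cumulative form by summation. *)
Lemma hilb_bound_of_sum e :
  (forall I, hideal I -> coht_le I e ->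
     exists C, forall m, (\sum_(i < m.+1) hilb I i <= C * m.+1 ^ e)%N) ->
  forall I, hideal I -> coht_le I e.+1 ->
    exists C, forall m, (hilb I m <= C * m.+1 ^ e)%N.
Proof.
move=> hB; apply: hnoeth_ind => [_|P hP pP h|I a x hI xa nIx IH1 IH2 h].
- by exists 0%N => m; rewrite hilb_setT.
- have [R1P|] := pselect (Rg 1%N `<=` P).
    exists 1%N => m; rewrite mul1n; apply: (@leq_trans 1); last by rewrite expn_gt0.
    case: m => [|m]; first exact/hilb0_le1/prime_ideal_ideal.
    by rewrite hilb_top //; apply: prime_ideal_ideal.
  move=> nR1; have [y [y1 nPy]] : exists y, Rg 1%N y /\ ~ P y.
    apply: contrapT => ne; apply: nR1 => y y1; apply: contrapT => nPy.
    by apply: ne; exists y.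
  have hPy := hideal_addi hP (hideal_prin hG y1).
  have [|C hC] := hB _ hPy.
    apply: (coht_le_step pP _ _ nPy h); first exact/addil/prin_ideal.
    by apply: addir; [apply: prime_ideal_ideal|apply: prin_mem].
  by exists C => m; apply: leq_trans (hilb_prime_sum m hP pP y1 nPy) (hC m).
- have [|C1 h1] := IH1; first by apply: coht_le_sub h; apply/addil/prin_ideal.
  have [|C2 h2] := IH2.
    by apply: coht_le_sub h => y Iy; apply: (ideal_mulr _ (hideal_ideal hI)).
  exists (C1 + C2)%N => m; apply: leq_trans (hilb_cut m hI xa) _.
  rewrite mulnDl leq_add //; case: ifP => // am; apply: leq_trans (h2 _) _.
  rewrite leq_mul2l; apply/orP; right.
  by rewrite leq_expl // ltnS leq_subr.
Qed.

Lemma hilb_sum_bound e I : hideal I -> coht_le I e ->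
  exists C, forall m, (\sum_(i < m.+1) hilb I i <= C * m.+1 ^ e)%N.
Proof.
elim: e I => [|e IH] I hI h.
  have [N hN0] := hilb_coht0 hI h.
  exists (\sum_(i < N) hilb I i) => m; rewrite expn0 muln1.
  have -> : \sum_(i < m.+1) hilb I i = \sum_(i < m.+1 | (i < N)%N) hilb I i.
    rewrite [RHS]big_mkcond; apply: eq_bigr => i _; case: ltnP => // /hN0 //.
  rewrite -!(big_mkord (fun i => (i < N)%N)) -(big_mkord xpredT).
  have [mN|Nm] := leqP m.+1 N.
    rewrite (big_cat_nat (leq0n m.+1) mN) /=; apply: leq_trans (leq_addr _ _).
    by rewrite big_mkcond leq_sum // => i _; case: ifP.
  by rewrite (big_nat_widen _ _ _ _ _ (ltnW Nm)).
have [C hC] := hilb_bound_of_sum IH hI h.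
by exists C; apply: hilb_sum_of_bound.
Qed.

Lemma hilb_bound e I : hideal I -> coht_le I e.+1 ->
  exists C, forall m, (hilb I m <= C * m.+1 ^ e)%N.
Proof. by apply: hilb_bound_of_sum => J; apply: hilb_sum_bound. Qed.

(** * Minimal primes *)

(** The primes for I + (x0) and for I : x0 are put together: x ^ N1 = u + r * x0 with u in I, and
    multiplication by x ^ N2 sends both terms into I. *)
Lemma prime_cover_nilp I : hideal I -> exists t (Pm : 'I_t -> set R) N,
  (forall i, hideal (Pm i) /\ prime_ideal (Pm i)) /\
  forall x, (forall i, Pm i x) -> I (x ^+ N).
Proof.
move: I; apply: hnoeth_ind => [|P hP pP|I a x0 hI xa nIx].
- by exists 0%N, (fun=> setT), 0%N; split=> // -[].
- exists 1%N, (fun=> P), 1%N; split=> // x h; rewrite expr1; exact: (h ord0).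
move=> [t1 [P1 [N1 [h1 hx1]]]] [t2 [P2 [N2 [h2 hx2]]]].
exists (t1 + t2)%N, (fun i => match fintype.split i with inl j => P1 j | inr j => P2 j end).
exists (N1 + N2)%N; split=> [i|x hx]; first by case: fintype.split.
have [|u [_ [Iu [r ->] xE]]] := hx1 x.
  by move=> i; have := hx (unsplit (inl i)); rewrite unsplitK.
have h2x : I (x ^+ N2 * x0).
  by apply: hx2 => i; have := hx (unsplit (inr i)); rewrite unsplitK.
rewrite exprD xE mulrDl; apply: (idealD (hideal_ideal hI)).
  exact: (ideal_mulr _ (hideal_ideal hI)).
by rewrite -mulrA [x0 * _]mulrC; apply: (ideal_mull _ (hideal_ideal hI)).
Qed.

(** In a family of homogeneous primes with nil intersection and of least cardinality, no two members
    are comparable, as the larger could be dropped. A prime containing no member would contain a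
    nilpotent product of elements outside it. *)
Lemma exists_minimal_primes : exists t (Pm : 'I_t -> set R) N,
  [/\ forall i, hideal (Pm i) /\ minimal_prime (Pm i),
      forall P, prime_ideal P -> exists i, Pm i `<=` P,
      forall i j, Pm i `<=` Pm j -> i = j
    & forall x, (forall i, Pm i x) -> x ^+ N = 0].
Proof.
pose Q t := `[< exists (Pm : 'I_t -> set R) N,
  (forall i, hideal (Pm i) /\ prime_ideal (Pm i)) /\
  forall x, (forall i, Pm i x) -> x ^+ N = 0 >].
have exQ : exists t, Q t.
  have [t [Pm [N [h1 h2]]]] := prime_cover_nilp (hideal_set0 hG).
  by exists t; apply/asboolP; exists Pm, N.
have [t /asboolP[Pm [N [h1 h2]]] tmin] := ex_minnP exQ.
have incl i j : Pm i `<=` Pm j -> i = j.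
  move=> ij; apply: contrapT => /eqP nij.
  case: t Pm h1 h2 tmin i j ij nij => [Pm _ _ _ []//|t] Pm h1 h2 tmin i j ij nij.
  suff /tmin : Q t by rewrite ltnn.
  apply/asboolP; exists (fun l => Pm (lift j l)), N; split=> [l|x hx].
    exact: h1.
  apply: h2 => l; have [j' ->|->] := unliftP j l; first exact: hx.
  apply: ij; have [i' ->|e] := unliftP j i; first exact: hx.
  by move: nij; rewrite e eqxx.
have above P : prime_ideal P -> exists i, Pm i `<=` P.
  move=> pP; apply: contrapT => ne.
  have /choice[f hf] : forall i, exists x, Pm i x /\ ~ P x.
    move=> i; apply: contrapT => nx; apply: ne; exists i => x Px.
    by apply: contrapT => nPx; apply: nx; exists x.
  have : P ((\prod_(i <- enum 'I_t) f i) ^+ N).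
    rewrite h2; first exact: (ideal0 (prime_ideal_ideal pP)).
    move=> i; apply: (@ideal_prod_mem _ _ _ _ _ i).
    - by apply: hideal_ideal (h1 i).1.
    - by rewrite mem_enum.
    - by case: (hf i).
  by move=> /(primeX_inv pP); apply: prime_prod => // i _; case: (hf i).
exists t, Pm, N; split=> // i; split; first exact: (h1 i).1.
split=> [|P pP Pi]; first exact: (h1 i).2.
have [j jP] := above P pP; apply/seteqP; split=> //.
by rewrite -(incl j i) //; apply: subset_trans jP Pi.
Qed.

Lemma hideal_nsub I P : hideal I -> hideal P -> ~ (I `<=` P) ->
  exists a x, [/\ Rg a x, I x & ~ P x].
Proof.
move=> hI hP nIP; apply: contrapT => ne; apply: nIP => x Ix.
apply: (hcomp_mem (hG := hG) (hideal_ideal hP)) => m.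
apply: contrapT => nP; apply: ne; exists m, (hc x m); split=> //.
  exact: hcompP.
exact: hI.2.
Qed.

Lemma exists_separator t (Pm : 'I_t -> set R) i :
  (forall i, hideal (Pm i) /\ prime_ideal (Pm i)) ->
  (forall i j, Pm i `<=` Pm j -> i = j) ->
  exists a x, [/\ Rg a x, ~ Pm i x & forall j, j != i -> Pm j x].
Proof.
move=> h1 hinc.
suff [a [x [xa nx hx]]] : exists a x,
    [/\ Rg a x, ~ Pm i x & forall j, j \in enum 'I_t -> j != i -> Pm j x].
  by exists a, x; split=> // j; apply: hx; rewrite mem_enum.
elim: (enum 'I_t) => [|j r [a [x [xa nx hx]]]].
  by exists 0%N, 1; split=> //; apply: prime_n1; exact: (h1 i).2.
have [ji|nji] := eqVneq j i.
  exists a, x; split=> // l; rewrite inE => /orP[/eqP -> /eqP //|]; exact: hx.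
have [|b [y [yb yj ny]]] := hideal_nsub (h1 j).1 (h1 i).1.
  by move=> /hinc/eqP; apply/negP.
exists (a + b)%N, (x * y); split; first exact: RgM.
  by apply: primeM => //; exact: (h1 i).2.
move=> l; rewrite inE => /orP[/eqP -> _|lr li].
  by apply: ideal_mull => //; apply: hideal_ideal (h1 j).1.
by apply: ideal_mulr; [apply: hideal_ideal (h1 l).1|apply: hx].
Qed.

(** A filtration is used beside the grading because the primes of a chain realizing the Krull
    dimension need not be homogeneous. *)
Definition Rle M : set R := [set x | forall i, (M < i)%N -> hc x i = 0].

Lemma Rle_sum M x : Rle M x -> x = \sum_(i < M.+1) hc x i.
Proof.
move=> hx; have [n [hn xE]] := hcomp_fin hG x; rewrite {1}xE.
have [nM|Mn] := leqP n M.+1.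
  rewrite -(sum_trunc (hc x) nM); apply: eq_bigr => i _.
  by case: ltnP => // /hn ->.
rewrite -(sum_trunc (hc x) (ltnW Mn)); apply: eq_bigr => i _.
by case: ltnP => // /hx ->.
Qed.

Lemma RleM M b x y : Rle M x -> Rle b y -> Rle (M + b) (x * y).
Proof.
move=> hx hy i Mbi; rewrite (Rle_sum hy) mulr_sumr hcomp_sum big1 // => j _.
rewrite (hcompM hG _ _ (hcompP hG y j)); case: ifP => // ji.
rewrite hx ?mul0r //; have := ltn_ord j; lia.
Qed.

Lemma Rle_span M U : @submodule k R U ->
  exists s, Rle M `<=` sp U s /\ size s = \sum_(i < M.+1) hilb U i.
Proof.
move=> hU; have /choice[S hS] : forall i, exists s, qbasis U (Rg i) s.
  by move=> i; apply: qbasis_exists => //; apply: Rfin.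
exists (flatten [seq S i | i <- iota 0 M.+1]); split.
  move=> x /Rle_sum ->; apply: submodule_sum; first exact: sp_submodule.
  move=> i _; have [_ _ h] := hS i; have : sp U (S i) (hc x i) by apply: h; apply: hcompP.
  apply: sp_min => //; first exact: sp_submodule.
    exact: sub_sp.
  move=> v vS; apply: mem_sp => //; apply/flattenP; exists (S i) => //.
  by apply: map_f; rewrite mem_iota ltn_ord.
rewrite size_flatten /shape -map_comp sumnE big_map -[iota 0 _]/(index_iota 0 M.+1).
by rewrite big_mkord; apply: eq_bigr => i _; rewrite /= -(qd_basis hU (hS i)).
Qed.

Lemma Rle_fin M U : @submodule k R U -> qfin U (Rle M).
Proof. by move=> /(Rle_span M)[s [hs _]]; exists s. Qed.

Lemma qd_Rle_le M U : @submodule k R U ->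
  (qd U (Rle M) <= \sum_(i < M.+1) hilb U i)%N.
Proof. by move=> hU; have [s [hs <-]] := Rle_span M hU; apply: qd_le. Qed.

(** A basis modulo [Q'] and the multiples by [x] of a basis modulo [Q] are jointly free modulo [Q]:
    the multiples lie in [Q'], and multiplication by [x] is injective modulo [Q]. *)
Lemma qd_Rle_step Q Q' x b M : prime_ideal Q -> ideal Q' -> Q `<=` Q' ->
  Rle b x -> Q' x -> ~ Q x ->
  (qd Q (Rle M) + qd Q' (Rle (M + b)) <= qd Q (Rle (M + b)))%N.
Proof.
move=> pQ hQ' QQ' xb Q'x nQx; have hQ : @submodule k R Q := ideal_submodule (prime_ideal_ideal pQ).
have hQ'' : @submodule k R Q' := ideal_submodule hQ'.
have [s bs] := qbasis_exists hQ (Rle_fin M hQ).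
have [t bt] := qbasis_exists hQ'' (Rle_fin (M + b) hQ'').
rewrite (qd_basis hQ bs) (qd_basis hQ'' bt) addnC -(size_map (fun r => r * x) s) -size_cat.
have [sM fs _] := bs; have [tM ft _] := bt.
apply: qd_ge => //; first exact: Rle_fin.
  move=> v; rewrite mem_cat => /orP[/tM //|/mapP[r /sM rM ->]]; exact: RleM.
apply/qfree_cat; split.
  apply: qfree_subl ft; apply: sp_min => // v /mapP[r _ ->].
  exact: ideal_mull.
apply: (@qfree_image _ _ _ id (fun r => r * x) _ _ _ Q setT) => //.
- by move=> a; exists a.
- by move=> y1 y2; rewrite mulrBl.
- by move=> a y; rewrite scalerAl.
- by apply/submoduleP.
- by move=> y _ Qyx; apply: contrapT => nQy; exact: (primeM pQ nQy nQx).
Qed.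

Lemma qd_Rle_mono M N U : @submodule k R U -> (M <= N)%N ->
  (qd U (Rle M) <= qd U (Rle N))%N.
Proof.
move=> hU MN; apply: qd_mono => //; last exact: Rle_fin.
by move=> x hx i Ni; apply: hx; apply: leq_ltn_trans MN Ni.
Qed.

(** Each step down the chain raises the exponent by one: [t] applications of [qd_Rle_step] stack [t]
    copies of the growth modulo the next larger prime. *)
Lemma chain_growth d (c : nat -> set R) (P : set R) :
  strict_chain [set Q | prime_ideal Q /\ P `<=` Q] d c ->
  exists2 a, (0 < a)%N & forall t, (t ^ d <= qd (c 0%N) (Rle (a * t)))%N.
Proof.
move=> [c1 c2].
have pc i : (i <= d)%N -> prime_ideal (c i) by case/c1.
have hc' i : (i <= d)%N -> @submodule k R (c i).
  by move=> /pc/prime_ideal_ideal/ideal_submodule.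
suff h i : (i <= d)%N -> exists2 a, (0 < a)%N &
    forall t, (t ^ i <= qd (c (d - i)%N) (Rle (a * t)))%N.
  by have := h d (leqnn d); rewrite subnn.
elim: i => [_|i IH id].
  exists 1%N => // t; rewrite expn0 subn0.
  apply: (@qd_gt0 _ _ _ _ 1); [exact: hc'|by apply: Rle_fin; apply: hc'| |].
    by move=> i ti; rewrite (hcomp_homog hG _ Rg1) gtn_eqF //; lia.
  exact: prime_n1 (pc d _).
have [a a0 ha] := IH (ltnW id).
have e : (d - i = (d - i.+1).+1)%N by lia.
have lt : (d - i.+1 < d)%N by lia.
rewrite e in ha.
have [cc ncc] := c2 _ lt.
have [x [Q'x nQx]] : exists x, c (d - i.+1).+1 x /\ ~ c (d - i.+1)%N x.
  apply: contrapT => ne; apply: ncc => x hx; apply: contrapT => nx.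
  by apply: ne; exists x.
have [b [hb _]] := hcomp_fin hG x.
have xb : Rle b x by move=> j /ltnW; apply: hb.
have key s M : (s * qd (c (d - i.+1).+1) (Rle M) <=
    qd (c (d - i.+1)%N) (Rle (M + s * b)))%N.
  elim: s => [//|s IHs].
  rewrite mulSn addnC [(s.+1 * b)%N]mulSn [(b + _)%N]addnC addnA.
  apply: leq_trans (qd_Rle_step _ (pc _ (ltnW lt)) (prime_ideal_ideal (pc _ lt)) cc xb Q'x nQx).
  by apply: leq_add => //; apply: qd_Rle_mono; [apply: hc'|rewrite -addnA leq_addr].
exists (a + b)%N; first by rewrite addn_gt0 a0.
move=> t; rewrite expnS mulnDl [(b * t)%N]mulnC.
by apply: leq_trans (key t (a * t)%N); rewrite leq_mul2l ha orbT.
Qed.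

Lemma krull_chain (K : realType) P d : krull_dim K P = d%:R%:E ->
  exists c, strict_chain [set Q | prime_ideal Q /\ P `<=` Q] d c.
Proof.
move=> hP; have [//|nc] := pselect (exists c,
  strict_chain [set Q | prime_ideal Q /\ P `<=` Q] d c).
have hle n c : strict_chain [set Q | prime_ideal Q /\ P `<=` Q] n c -> (n < d)%N.
  move=> hcn; rewrite ltn_neqAle (coht_le_krull hP hcn) andbT.
  by apply/eqP => nd; apply: nc; exists c; rewrite -nd.
have : (krull_dim K P <= (d%:R - 1)%:E)%E.
  apply: ge_ereal_sup => _ [n [c /hle nd] <-].
  by rewrite lee_fin lerBrDr natr1 ler_nat.
by rewrite hP lee_fin => h; exfalso; move: h; rewrite lerBrDr; lra.
Qed.

Lemma hilb_mono P m n : hideal P -> prime_ideal P -> ~ (Rg 1%N `<=` P) ->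
  (m <= n)%N -> (hilb P m <= hilb P n)%N.
Proof.
move=> hP pP nR1 /subnK <-.
have [y [y1 nPy]] : exists y, Rg 1%N y /\ ~ P y.
  apply: contrapT => ne; apply: nR1 => y y1; apply: contrapT => nPy.
  by apply: ne; exists y.
elim: (n - m)%N => [//|l IH]; apply: leq_trans IH _; rewrite addSn.
have hPS := hideal_submodule hP.
have [s bs] := qbasis_exists hPS (Rfin (l + m)%N hPS).
rewrite {1}/hilb (qd_basis hPS bs) -(size_map (fun r => r * y)).
have [sM fs _] := bs.
apply: qd_ge => //; first exact: Rfin.
  by move=> v /mapP[r /sM rM ->]; rewrite -addn1; apply: RgM.
apply: (@qfree_image _ _ _ id (fun r => r * y) _ _ _ P setT) => //.
- by move=> a; exists a.
- by move=> y1' y2; rewrite mulrBl.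
- by move=> a z; rewrite scalerAl.
- by apply/submoduleP.
- by move=> z _ Pzy; apply: contrapT => nPz; exact: (primeM pP nPz nPy).
Qed.

(** The cumulative growth along a chain becomes pointwise because the Hilbert function of R / P is
    nondecreasing. If [P] contained R_1, the sums would stay at most 1, against the growth at t =
    2. *)
Lemma hilb_lower (K : realType) P d : hideal P -> prime_ideal P ->
  krull_dim K P = d.+1%:R%:E ->
  ~ (Rg 1%N `<=` P) /\ exists2 a, (0 < a)%N &
    forall t, (0 < t)%N -> (t ^ d <= a.+1 * hilb P (a * t))%N.
Proof.
move=> hP pP hd; have [c hcc] := krull_chain hd.
have [a a0 ha] := chain_growth hcc.
have hPS := hideal_submodule hP.
have [_ Pc0] := hcc.1 0%N (leq0n _).
have c0S : @submodule k R (c 0%N).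
  by have [/prime_ideal_ideal/ideal_submodule] := hcc.1 0%N (leq0n _).
have hsum t : (t ^ d.+1 <= \sum_(i < (a * t).+1) hilb P i)%N.
  apply: leq_trans (ha t) _; apply: leq_trans (qd_Rle_le _ hPS).
  by apply: qd_mono => //; apply: Rle_fin.
have nR1 : ~ (Rg 1%N `<=` P).
  move=> R1P; have := hsum 2; rewrite big_ord_recl big1 ?addn0; last first.
    by move=> i _; rewrite hilb_top //; apply: prime_ideal_ideal.
  rewrite leqNgt => /negP; apply; apply: (@leq_ltn_trans 1).
    exact: (hilb0_le1 (prime_ideal_ideal pP)).
  by have : (0 < 2 ^ d)%N; rewrite ?expn_gt0 // expnS; lia.
split=> //; exists a => // t t0.
have : (t ^ d.+1 <= (a * t).+1 * hilb P (a * t))%N.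
  apply: leq_trans (hsum t) _; rewrite -[X in (_ <= X * _)%N]card_ord -sum_nat_const.
  by apply: leq_sum => i _; apply: hilb_mono => //; rewrite -ltnS.
rewrite expnS => h; rewrite -(leq_pmul2l t0); apply: leq_trans h _.
by rewrite mulnA leq_mul2r; apply/orP; right; rewrite mulnS addnC mulnC; lia.
Qed.

(** * Families independent over Frobenius powers *)

(** Homogeneity serves twice: a conductor outside a homogeneous prime can be chosen of one degree,
    and the Hilbert function of the quotient by all conductors can be bounded. *)
Lemma conductor_hideal n B L (us : seq R) : hideal B ->
  (forall e, e \in L -> exists a, Rg a e.1) ->
  (forall u, u \in us -> exists a, Rg a u) ->
  hideal [set c | forall u, u \in us -> TT (p ^ n) setT B L (c ^+ (p ^ n) * u)].
Proof.
move=> hB hL hus; have BS := hideal_submodule hB.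
have TS : @submodule k R (TT (p ^ n) setT B L).
  apply: (TT_submodule (@expBp n) (pX_gt0 n) (k_perfX n)) => //.
  by apply/submoduleP.
split.
  apply/idealP; split=> [u _|a x y hx hy u us_u].
    rewrite expr0n gtn_eqF ?pX_gt0 // mul0r; exact: submodule0.
  rewrite expDp mulrDl exprMn -mulrA; apply: submoduleD => //; last exact: hy.
  exact: (TT_mul (V := setT) (hideal_ideal hB) _ (hx u us_u)).
move=> x m hx u us_u; have [a ua] := hus u us_u.
rewrite -(hcompX hG Rg1 (@expBp n) (pX_gt0 n) x ua erefl).
by apply: TT_comp => //; apply: hx.
Qed.

(* The growth of the Hilbert function of R / P forces the size of a maximal
   independent family. *)
Lemma frob_family (K : realType) P e : hideal P -> prime_ideal P ->
  krull_dim K P = e.+1%:R%:E ->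
  exists kappa (ws : seq R),
    [/\ (0 < kappa)%N, forall w, w \in ws -> Rg (p ^ 1 * (p.-1 * kappa))%N w,
        indep (p ^ 1) P [seq (w, P) | w <- ws]
      & ((p ^ 1) ^ e <= size ws)%N].
Proof.
move=> hP pP hd; set q := (p ^ 1)%N; have q0 : (0 < q)%N := pX_gt0 1.
have p2 : (1 < p)%N by apply: prime_gt1; apply: p_prime.
have [nR1 [a a0 ha]] := hilb_lower hP pP hd.
have iP := prime_ideal_ideal pP; have PS := hideal_submodule hP.
have [y [y1 nPy]] : exists y, Rg 1%N y /\ ~ P y.
  apply: contrapT => ne; apply: nR1 => y y1; apply: contrapT => nPy.
  by apply: ne; exists y.
have [N [bas [bR hbas]]] := Rgq_gen q0.
(* At least [N], so that powers of [y] bring all candidates to one degree, and a multiple of [p.-1],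
   so that the degrees of iterated products telescope. *)
pose delta := (p.-1 * N.+1)%N.
have Nd : (N <= delta)%N.
  by apply: ltnW; rewrite /delta leq_pmull // -subn1 subn_gt0.
pose C := flatten [seq [seq (y ^+ (q * (delta - m)) * u, P) | u <- bas (q * m)%N]
                  | m <- iota 0 N.+1].
have CP f : f \in C -> f.2 = P /\ Rg (q * delta)%N f.1.
  move=> /flattenP[_ /mapP[m mN ->] /mapP[u ub ->]] /=; split=> //.
  rewrite mem_iota ltnS in mN.
  have -> : (q * delta = q * (delta - m) * 1 + q * m)%N.
    by rewrite muln1 -mulnDr subnK // (leq_trans _ Nd).
  by apply: RgM => //; [apply: RgX|apply: bR].
have [|L [LC iL hL]] := @indep_extend k R q q0 P [::] C _ iP I.
  by move=> f /CP[->].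
rewrite cats0 in iL hL.
have LP f : f \in L -> f.2 = P /\ Rg (q * delta)%N f.1 by move=> /LC/CP.
exists N.+1, [seq f.1 | f <- L].
have -> : [seq (w, P) | w <- [seq f.1 | f <- L]] = L.
  rewrite -map_comp -[RHS]map_id; apply/eq_in_map => -[w Q] /LP[/= -> _] //.
split=> //; first by move=> _ /mapP[f /LP[_ ?] ->].
rewrite size_map.
pose us := flatten [seq bas (q * m)%N | m <- iota 0 N.+1].
have hcond : hideal [set c | forall u, u \in us -> TT q setT P L (c ^+ q * u)].
  apply: conductor_hideal => //; first by move=> f /LP[_ fd]; exists (q * delta)%N.
  by move=> u /flattenP[_ /mapP[m _ ->] /bR]; exists (q * m)%N.
have [|gam [c [cg hc0 nPc]]] := hideal_nsub hcond hP.
  have /choice[r hr] : forall f, exists r, f \in C ->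
      ~ P r /\ TT q setT P L (r ^+ q * f.1).
    move=> f; have [/[dup]/CP[fP _] /hL[r]|] := boolP (f \in C); last by exists 0.
    by rewrite fP => nr hr; exists r.
  (* The power of [y] covers the y ^ (delta - m) built into every candidate, and the product covers
     every [r f]. *)
  pose cc := y ^+ delta * \prod_(f <- C) r f.
  move=> /(_ cc) h; have : P cc; last first.
    apply: primeM => //; first exact: primeX.
    by apply: prime_prod => // f /hr[].
  apply: h => u /flattenP[_ /mapP[m mN ->] ub].
  pose f := (y ^+ (q * (delta - m)) * u, P).
  have fC : f \in C.
    by apply/flattenP; eexists; [apply: map_f mN|apply: map_f ub].
  have [_ hf] := hr f fC.
  have mN' : (m <= delta)%N by apply: leq_trans Nd; rewrite -ltnS; move: mN; rewrite mem_iota.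
  have -> : cc ^+ q * u = (y ^+ m * \prod_(g <- rem f C) r g) ^+ q * (r f ^+ q * f.1).
    rewrite /cc (perm_big _ (perm_to_rem fC)) big_cons /= !exprMn -!exprM.
    rewrite -{1}(subnK mN') mulnDl exprD [(q * _)%N]mulnC.
    by rewrite -!mulrA; ring.
  exact: (TT_mul (V := setT) iP _ hf).
have cR M x : Rg (q * M)%N x -> TT q setT P L (c ^+ q * x).
  apply: (hbas M [set x | TT q setT P L (c ^+ q * x)]).
    have TS : @submodule k R (TT q setT P L).
      apply: (TT_submodule (@expBp 1) q0 (k_perfX 1)) => //.
      by apply/submoduleP.
    apply/submoduleP; split; first by rewrite /= mulr0; apply: submodule0.
    move=> a' x1 x2 h1 h2 /=; rewrite mulrDr -scalerAr; apply: submoduleD => //.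
    exact: submoduleZ.
  move=> m s u mN _ _ ub /=; rewrite mulrCA.
  apply: (TT_mul (V := setT)) => //; apply: hc0.
  by apply/flattenP; exists (bas (q * m)%N) => //; apply: map_f; rewrite mem_iota ltnS mN.
(* Multiplication by c ^ q is injective modulo [P] and lands in combinations whose [size L]
   coefficients have degree [M + gam - delta]. *)
have hstep M : (hilb P (q * M) <= size L * hilb P (M + gam))%N.
  have [s bs] := qbasis_exists PS (Rfin (q * M)%N PS).
  have [t bt] := qbasis_exists PS (Rfin (M + gam - delta)%N PS).
  rewrite {1}/hilb (qd_basis PS bs) -(size_map (fun r => c ^+ q * r)).
  have [sM fs _] := bs; have [tM _ ht] := bt.
  apply: (@leq_trans (size (flatten [seq [seq r ^+ q * f.1 | r <- t] | f <- L]))).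
    apply: (@qfree_size_le _ _ P) => //.
      apply: (@qfree_image _ _ _ id (fun r => c ^+ q * r) _ _ _ P setT) => //.
      - by move=> b; exists b.
      - by move=> z1 z2; rewrite mulrBr.
      - by move=> b z; rewrite scalerAr.
      - by apply/submoduleP.
      - move=> z _ Pcz; apply: contrapT => nPz.
        by apply: (primeM pP _ nPz) Pcz; apply: primeX.
    move=> _ /mapP[x /sM xM ->].
    have : TT q (Rs Rg (M + gam) delta) P L (c ^+ q * x).
      apply: TT_homog => //; first by move=> f /LP[].
        exact: cR xM.
      by rewrite mulnDr addnC; apply: RgM => //; apply: RgX.
    apply: (@TT_sp k R q (@expBp 1) _ P L (fun=> t)) => //.
    - move=> f /LP[-> _] z; rewrite /Rs /=; case: ifP => _; first exact: ht.
      by move=> ->; apply: submodule0; apply: sp_submodule.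
    - by move=> f /LP[-> _] z Pz; apply: ideal_mulr => //; apply: idealX.
  rewrite (size_flatten_qspan q L (fun=> t)) big_const_seq count_predT iter_addn_0 mulnC -(qd_basis PS bt).
  by rewrite leq_mul2l; apply/orP; right; apply: hilb_mono => //; apply: leq_subr.
(* The shift [q * gam] is stable: one step turns it into 2 * gam, which is at most [q * gam]. *)
have hiter n t : (hilb P (q ^ n * t + q * gam) <= size L ^ n * hilb P (t + q * gam))%N.
  elim: n => [|n IH]; first by rewrite !expn0 !mul1n.
  rewrite expnS -mulnA -mulnDr; apply: leq_trans (hstep _) _.
  rewrite expnS -mulnA leq_mul2l; apply/orP; right; apply: leq_trans IH.
  apply: hilb_mono => //; rewrite -addnA leq_add2l.
  by rewrite /q expn1 addnn -mul2n leq_mul2r p2 orbT.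
apply: (@exp_growth _ _ (a.+1 * hilb P (a + q * gam))) => n.
rewrite -expnM mulnC expnM; apply: leq_trans (ha _ _) _; first by rewrite expn_gt0 q0.
rewrite -!mulnA leq_mul2l; apply/orP; right; rewrite [leqRHS]mulnC.
apply: leq_trans (hiter n a); apply: hilb_mono => //.
by rewrite mulnC leq_addr.
Qed.

(** The added [vs] may have other degrees than [ws]. They make the family maximal, which yields the
    conductor [c]; the towers below are built on [ws] alone. *)
Lemma indep_full P (ws : seq R) : prime_ideal P ->
  indep (p ^ 1) P [seq (w, P) | w <- ws] ->
  exists (vs : seq R) c, [/\ indep (p ^ 1) P [seq (w, P) | w <- vs ++ ws], ~ P c
    & forall x, TT (p ^ 1) setT P [seq (w, P) | w <- vs ++ ws] (c ^+ (p ^ 1) * x)].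
Proof.
move=> pP hws; set q := (p ^ 1)%N in hws *; have q0 : (0 < q)%N := pX_gt0 1.
have iP := prime_ideal_ideal pP.
have [us [_ hus]] := Rq_gen q0.
pose C := [seq (u, P) | u <- us].
have [|L1 [LC iL hL]] := @indep_extend k R q q0 P [seq (w, P) | w <- ws] C _ iP hws.
  by move=> _ /mapP[u _ ->].
have eL : [seq (w, P) | w <- [seq f.1 | f <- L1]] = L1.
  rewrite -map_comp -[RHS]map_id; apply/eq_in_map => -[w Q] /LC/mapP[u _ [_ ->]] //.
have /choice[r hr] : forall u, exists r, u \in us ->
    ~ P r /\ TT q setT P (L1 ++ [seq (w, P) | w <- ws]) (r ^+ q * u).
  move=> u; have [uus|] := boolP (u \in us); last by exists 0.
  by have [|r nr h] := hL (u, P); [apply: map_f|exists r].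
exists [seq f.1 | f <- L1], (\prod_(u <- us) r u); rewrite map_cat eL; split=> //.
  by apply: prime_prod => // u /hr[].
move=> x; apply: (hus [set x | TT q setT P (L1 ++ [seq (w, P) | w <- ws])
    ((\prod_(u <- us) r u) ^+ q * x)]).
  have PS : @submodule k R P := ideal_submodule iP.
  have TS : @submodule k R (TT q setT P (L1 ++ [seq (w, P) | w <- ws])).
    apply: (TT_submodule (@expBp 1) q0 (k_perfX 1)) => //.
    by apply/submoduleP.
  apply/submoduleP; split; first by rewrite /= mulr0; apply: submodule0.
  move=> a' x1 x2 h1 h2 /=; rewrite mulrDr -scalerAr; apply: submoduleD => //.
  exact: submoduleZ.
move=> s u uus /=; rewrite mulrCA; apply: (TT_mul (V := setT)) => //.
rewrite (perm_big _ (perm_to_rem uus)) big_cons /= exprMn -mulrA mulrCA.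
by apply: (TT_mul (V := setT)) => //; case: (hr u uus).
Qed.

(* Expanding in the family costs one factor [c], and extracting the p-th root of
   [c ^+ p] leaves the other one, so that the exponent 2 is stable. *)
Lemma indep_descent P B B' (ws : seq R) c : ideal P -> ideal B -> ideal B' ->
  P `<=` B -> B' `<=` addi (ideal_gen [set b ^+ (p ^ 1) | b in B]) P ->
  indep (p ^ 1) P [seq (w, P) | w <- ws] ->
  (forall x, TT (p ^ 1) setT P [seq (w, P) | w <- ws] (c ^+ (p ^ 1) * x)) ->
  indep (p ^ 1) [set x | B' (c ^+ 2 * x)]
    [seq (w, [set x | B (c ^+ 2 * x)]) | w <- ws].
Proof.
move=> iP iB iB' PB hB' hws hc; set q := (p ^ 1)%N in hB' hws hc *.
have q0 : (0 < q)%N := pX_gt0 1.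
have q2 : (2 <= q)%N by rewrite /q expn1 prime_gt1 // p_prime.
apply: (indep_of_coef (@expBp 1) q0) => r hr j js.
set L := [seq (w, P) | w <- ws] in hws hc.
have eL s : qcomb q [seq (w, [set x | B (c ^+ 2 * x)]) | w <- ws] s = qcomb q L s.
  rewrite /qcomb !size_map; apply: eq_bigr => i _; congr (_ * _).
  by rewrite !(nth_map 0).
rewrite eL /= in hr.
have BS := ideal_submodule (k := k) iB; have PS := ideal_submodule (k := k) iP.
have TS : @submodule k R (TT q B P L).
  exact: (TT_submodule (@expBp 1) q0 (k_perfX 1)).
(* Quantifying over multiples makes [X] an ideal; it contains [P] and all b ^ q with b in [B], hence
   [B']. *)
pose X := [set x | forall s, TT q B P L (c ^+ q * (s * x))].
have iX : ideal X.
  apply/idealP; split; first by move=> s; rewrite !mulr0; apply: submodule0.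
  move=> a x y hx hy s.
  have -> : c ^+ q * (s * (a * x + y)) = c ^+ q * (s * a * x) + c ^+ q * (s * y).
    by rewrite !mulrDr !mulrA.
  exact: submoduleD.
have B'X : B' `<=` X.
  move=> x /hB'[y [z [hy Pz ->]]]; apply: (idealD iX); last first.
    move=> s; apply: TT_base => //; first exact: ideal0.
    by do 2 apply: (ideal_mull _ iP).
  apply: (ideal_gen_min iX) hy => _ [b Bb <-] s.
  rewrite [s * _]mulrC mulrCA; apply: (TT_mul (V := setT)) => // t _.
  exact: ideal_mulr.
(* As q >= 2, the relation may be multiplied by c ^ q instead of c ^ 2, which makes the coefficients
   c * r_j; the second c ^ q, paid for the expansion, makes them c ^ 2 * r_j. *)
have : TT q B P L (c ^+ q * qcomb q L (fun j => c * r j)).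
  have /B'X/(_ 1) : B' (qcomb q L (fun j => c * r j)).
    rewrite qcombM; have -> : c ^+ q = c ^+ (q - 2) * c ^+ 2 by rewrite -exprD subnK.
    by rewrite -mulrA; apply: ideal_mull.
  by rewrite mul1r.
move=> /(TT_coef (ideal0 iB))[s Bs].
rewrite -qcombM -(qcombB (@expBp 1)) => hP.
have := indep_coef (@expBp 1) q0 iP _ hws hP (j := j).
rewrite size_map => /(_ _ js) h.
have {}h : P (c * (c * r j) - s j) by apply: h => e /mapP[w _ ->].
rewrite /= expr2 -mulrA -(subrK (s j) (c * (c * r j))).
by apply: idealD => //; apply: PB.
Qed.

(** The products h ^ (p ^ n) * w_1 ^ (p ^ (n - 1)) * ... * w_n over all words of length n in
    [ws]. *)
Fixpoint tower (ws : seq R) (h : R) n : seq R :=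
  if n is n'.+1 then flatten [seq [seq r ^+ (p ^ 1) * w | r <- tower ws h n'] | w <- ws]
  else [:: h].

Lemma size_tower ws h n : size (tower ws h n) = (size ws ^ n)%N.
Proof.
elim: n => [//|n IH] /=; rewrite [RHS]expnS -IH.
move: (tower ws h n) => t {IH}; elim: ws => [//|w ws' IH'] /=.
by rewrite size_cat size_map mulSn IH'.
Qed.

Lemma tower_scale ws h n :
  tower ws h n = [seq h ^+ (p ^ n) * x | x <- tower ws 1 n].
Proof.
elim: n => [|n IH] /=; first by rewrite expr1 mulr1.
rewrite IH map_flatten; congr flatten; rewrite -map_comp; apply: eq_map => w /=.
rewrite -!map_comp; apply: eq_map => x /=.
by rewrite exprMn -exprM -expnD addn1 mulrA.
Qed.

(** The sum of p ^ i * p * (p - 1) * kappa over i < n telescopes. *)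
Lemma tower_homog ws kappa n : (forall w, w \in ws -> Rg (p ^ 1 * (p.-1 * kappa))%N w) ->
  forall x, x \in tower ws 1 n -> Rg ((p ^ n).-1 * (p * kappa))%N x.
Proof.
move=> hws; elim: n => [|n IH] x /=; first by rewrite inE => /eqP ->.
move=> /flattenP[_ /mapP[w wws ->] /mapP[r /IH hr ->]].
have -> : ((p ^ n.+1).-1 * (p * kappa) =
    p ^ 1 * ((p ^ n).-1 * (p * kappa)) + p ^ 1 * (p.-1 * kappa))%N.
  have := pX_gt0 n; have := prime_gt0 p_prime; rewrite expn1 expnS.
  by case: (p ^ n)%N => // a; case: (p) => // b _ _ /=; nia.
by apply: RgM => //; [apply: RgX|apply: hws].
Qed.

Lemma frobenius_powerS I P n : P 0 ->
  addi (frobenius_power (p ^ n.+1) I) P `<=`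
  addi (ideal_gen [set b ^+ (p ^ 1) | b in addi (frobenius_power (p ^ n) I) P]) P.
Proof.
move=> P0 x [y [z [hy Pz ->]]]; exists y, z; split=> //.
apply: ideal_gen_min hy; first exact: ideal_gen_ideal.
move=> _ [b Ib <-]; apply: ideal_gen_sub; exists (b ^+ (p ^ n)).
  by exists (b ^+ (p ^ n)), 0; rewrite addr0; split=> //; apply: ideal_gen_sub; exists b.
by rewrite -exprM -expnD addn1.
Qed.

Lemma tight_growth (K : realType) I P e s z : ideal I -> hideal P ->
  prime_ideal P -> krull_dim K P = e.+1%:R%:E -> Rg s z ->
  (forall c, ~ P c ->
     ~ \forall n \near \oo, addi (frobenius_power (p ^ n) I) P (c * z ^+ (p ^ n))) ->
  exists n1 X, (0 < X)%N /\ forall n, exists l : seq R,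
    [/\ ((p ^ n) ^ e <= size l)%N,
        qfree (addi (frobenius_power (p ^ (n1 + n)) I) P) l
      & forall v, v \in l -> Rg (X * p ^ n)%N v /\
          exists r, v = r * z ^+ (p ^ (n1 + n))].
Proof.
move=> iI hP pP hd sz htc; have iP := prime_ideal_ideal pP.
have [kappa [ws [k0 wsd hws wss]]] := frob_family hP pP hd.
have [vs [c [hvs nPc hc]]] := indep_full pP hws.
have [nR1 _] := hilb_lower hP pP hd.
have [y [y1 nPy]] : exists y, Rg 1%N y /\ ~ P y.
  apply: contrapT => ne; apply: nR1 => y y1; apply: contrapT => nPy.
  by apply: ne; exists y.
pose D := (p * kappa)%N.
(* The hypothesis is applied to the multiplier c ^ 2 * y ^ D; the factor y ^ D is reserved for the
   adjustment of degrees. *)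
have [n1 hn1] : exists n1, ~ addi (frobenius_power (p ^ n1) I) P
    (c ^+ 2 * (y ^+ D * z ^+ (p ^ n1))).
  apply: contrapT => ne; apply: (htc (c ^+ 2 * y ^+ D)).
    by apply: primeM => //; apply: primeX.
  exists 0%N => // n _; apply: contrapT => hn; apply: ne; exists n.
  by rewrite mulrA.
pose J n := addi (frobenius_power (p ^ (n1 + n)) I) P.
have iJ n : ideal (J n) by apply: addi_ideal => //; apply: ideal_gen_ideal.
have JS n : @submodule k R (J n) by apply: ideal_submodule.
have US n : @submodule k R [set x | J n (c ^+ 2 * x)].
  apply/submoduleP; split; first by rewrite /= mulr0; apply: submodule0.
  move=> a' x1 x2 h1 h2 /=; rewrite mulrDr -scalerAr; apply: submoduleD => //.
  exact: submoduleZ.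
pose h := y ^+ D * z ^+ (p ^ n1).
have free n : qfree [set x | J n (c ^+ 2 * x)] (tower ws h n).
  elim: n => [|n IH].
    by split=> //=; rewrite /J addn0.
  pose L := [seq (w, [set x | J n (c ^+ 2 * x)]) | w <- ws].
  have -> : tower ws h n.+1 =
      flatten [seq [seq r ^+ (p ^ 1) * f.1 | r <- tower ws h n] | f <- L].
    by rewrite /= -map_comp.
  apply: (indep_qfree (@expBp 1) (pX_gt0 1) (k_perfX 1) (S := fun=> tower ws h n)) => //.
    by move=> _ /mapP[w _ ->].
  have : indep (p ^ 1) [set x | J n.+1 (c ^+ 2 * x)]
      [seq (w, [set x | J n (c ^+ 2 * x)]) | w <- vs ++ ws].
    apply: (indep_descent iP (iJ n) (iJ n.+1) _ _ hvs hc).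
      by apply: addir; apply: ideal_gen_ideal.
    by rewrite /J addnS; apply: frobenius_powerS; apply: ideal0.
  by rewrite map_cat => /indep_catr.
exists n1, (s * p ^ n1 + D)%N; split=> [|n].
  by rewrite addn_gt0 [(0 < D)%N]muln_gt0 k0 (prime_gt0 p_prime) orbT.
exists [seq y ^+ D * z ^+ (p ^ (n1 + n)) * x | x <- tower ws 1 n]; split.
- rewrite size_map size_tower -expnM mulnC expnM.
  by move: wss; rewrite expn1 => wss; apply: leq_expl.
- have := free n; rewrite tower_scale.
  (* All but y ^ D of the factor y ^ (D * p ^ n) in h ^ (p ^ n) is split off; freeness passes to
     what remains, whose degree is exactly X * p ^ n. *)
  have -> : [seq h ^+ (p ^ n) * x | x <- tower ws 1 n] =
    [seq y ^+ (D * (p ^ n).-1) * x | x <-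
      [seq y ^+ D * z ^+ (p ^ (n1 + n)) * x | x <- tower ws 1 n]].
    rewrite -map_comp; apply: eq_map => x /=.
    by rewrite /h exprMn -!exprM -expnD !mulrA -exprD -mulnSr prednK ?pX_gt0.
  move=> hfree; apply: (@qfree_preimage _ _ _ id
    (fun x => y ^+ (D * (p ^ n).-1) * x) _ _ (J n) _ _ _ hfree) => //.
  + by move=> x1 x2; rewrite mulrBr.
  + by move=> a x; rewrite scalerAr.
  + by move=> x Jx /=; do 2 apply: (ideal_mull _ (iJ n)).
- move=> v /mapP[x xt ->]; split; last by exists (y ^+ D * x); rewrite mulrAC.
  have -> : ((s * p ^ n1 + D) * p ^ n = D * 1 + p ^ (n1 + n) * s + (p ^ n).-1 * D)%N.
    have := pX_gt0 n; rewrite expnD; case: (p ^ n)%N => // a _ /=.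
    by move: (p ^ n1)%N => b; ring.
  apply: RgM => //; first by apply: RgM => //; apply: RgX.
  exact: tower_homog xt.
Qed.

(** * Hilbert functions of Frobenius powers *)

Local Notation frob n I := (frobenius_power (p ^ n) I).

Lemma sp_cap (U V : set R) s x : @submodule k R V -> (forall v, v \in s -> V v) ->
  V x -> sp U s x -> sp (U `&` V) s x.
Proof.
move=> hV; elim: s x => [//|v s IH] x sV Vx /= [a xa]; exists a; apply: IH xa.
  by move=> w ws; apply: sV; rewrite inE ws orbT.
by apply: submoduleB => //; apply: submoduleZ => //; apply: sV; rewrite inE eqxx.
Qed.

Lemma frob_hideal n I : hideal I -> hideal (frob n I).
Proof.
move=> hI; apply: hideal_gen => _ m [x Ix <-].
have [[j ->]|nj] := pselect (exists j, m = (p ^ n * j + 0)%N).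
  rewrite -[x ^+ _]mulr1 (hcompX hG Rg1 (@expBp n) (pX_gt0 n) x Rg1 erefl) mulr1.
  by apply: ideal_gen_sub; exists (hc x j) => //; apply: hI.2.
rewrite -[x ^+ _]mulr1 (hcompX_zero hG Rg1 (@expBp n) (pX_gt0 n) x Rg1).
  exact: (ideal0 (ideal_gen_ideal _)).
by move=> j e; apply: nj; exists j.
Qed.

Lemma frob_ideal n I : ideal (frob n I). Proof. exact: ideal_gen_ideal. Qed.
Hint Resolve frob_ideal : core.

Lemma frobX n n' I r : frob n I r -> frob (n + n') I (r ^+ (p ^ n')).
Proof.
move=> hr.
have hJ : ideal [set r | frob (n + n') I (r ^+ (p ^ n'))].
  apply/idealP; split; first by rewrite /= expr0n gtn_eqF ?pX_gt0 //; exact: ideal0.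
  move=> a x y /= hx hy; rewrite expDp exprMn; apply: (idealD (frob_ideal _ _)) => //.
  exact: (ideal_mull _ (frob_ideal _ _)).
apply: (ideal_gen_min hJ) hr => _ [x Ix <-] /=.
by rewrite -exprM -expnD; apply: ideal_gen_sub; exists x.
Qed.

Lemma exists_hgens I : hideal I -> exists fs : seq (R * nat),
  (forall f, f \in fs -> Rg f.2 f.1 /\ I f.1) /\
  forall J, ideal J -> (forall f, f \in fs -> J f.1) -> I `<=` J.
Proof.
move=> hI; have [s Is] := hN (hideal_ideal hI).
have sI x : x \in s -> I x by move=> xs; rewrite Is; apply: ideal_gen_sub.
have /choice[N hN'] := hcomp_fin hG.
exists (flatten [seq [seq (hc x i, i) | i <- iota 0 (N x)] | x <- s]); split.
  move=> _ /flattenP[_ /mapP[x xs ->] /mapP[i _ ->]] /=; split; first exact: hcompP.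
  by apply: hI.2; apply: sI.
move=> J hJ h; rewrite Is; apply: ideal_gen_min => // x xs.
have [_ ->] := hN' x; apply: ideal_sum => // i _.
apply: (h (hc x i, nat_of_ord i)); apply/flattenP.
exists [seq (hc x i, i) | i <- iota 0 (N x)]; first exact: (map_f (fun x => [seq (hc x i, i) | i <- iota 0 (N x)])).
by apply: (map_f (fun i => (hc x i, i))); rewrite mem_iota ltn_ord.
Qed.

Section Generators.
Variables (I : set R) (fs : seq (R * nat)).
Hypothesis hI : hideal I.
Hypothesis fsI : forall f, f \in fs -> Rg f.2 f.1 /\ I f.1.
Hypothesis fs_gen : forall J, ideal J -> (forall f, f \in fs -> J f.1) -> I `<=` J.

Lemma frob_gen n J : ideal J -> (forall f, f \in fs -> J (f.1 ^+ (p ^ n))) ->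
  frob n I `<=` J.
Proof.
move=> hJ h; apply: ideal_gen_min => // _ [x Ix <-].
apply: (@fs_gen [set x | J (x ^+ (p ^ n))]) Ix => //.
apply/idealP; split; first by rewrite /= expr0n gtn_eqF ?pX_gt0 //; exact: ideal0.
move=> a y z /= hy hz; rewrite expDp exprMn; apply: idealD => //.
exact: ideal_mull.
Qed.

(** An elimination principle in place of explicit coefficients: [S j] is the least subspace
    containing the products of degree [j], and the elements with every component in its [S j] form
    an ideal containing the q-th powers of the generators. *)
Lemma frob_span n m x W : frob n I x -> Rg m x -> @submodule k R W ->
  (forall f r, f \in fs -> (p ^ n * f.2 <= m)%N -> Rg (m - p ^ n * f.2)%N r ->
     W (f.1 ^+ (p ^ n) * r)) -> W x.
Proof.
pose S j := [set y | forall W, @submodule k R W ->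
  (forall f r, f \in fs -> (p ^ n * f.2 <= j)%N -> Rg (j - p ^ n * f.2)%N r ->
     W (f.1 ^+ (p ^ n) * r)) -> W y].
have SS j : @submodule k R (S j).
  apply/submoduleP; split=> [V hV _|a y z hy hz V hV h]; first exact: submodule0.
  apply: submoduleD => //; last exact: hz.
  by apply: submoduleZ => //; apply: hy.
have SM i j a y : Rg i a -> S j y -> S (i + j)%N (a * y).
  move=> ia hy V hV h.
  apply: (hy [set y | V (a * y)]) => [|f r ff fj rj /=].
    apply/submoduleP; split; first by rewrite /= mulr0; apply: submodule0.
    move=> b x1 x2 h1 h2 /=; rewrite mulrDr -scalerAr; apply: submoduleD => //.
    exact: submoduleZ.
  rewrite mulrCA; apply: h => //; first by apply: leq_trans fj _; rewrite leq_addl.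
  by rewrite -addnBA //; apply: RgM.
pose J := [set y | forall j, S j (hc y j)].
have hJ : ideal J.
  apply/idealP; split; first by move=> j; rewrite hcomp0; apply: submodule0.
  move=> a y z hy hz j; rewrite hcompD; apply: (submoduleD (SS j)) => //.
  have [l [_ ->]] := hcomp_fin hG y.
  rewrite mulr_sumr hcomp_sum; apply: (submodule_sum _ (SS j)) => i _.
  rewrite (hcompM hG _ _ (hcompP hG y i)); case: ifP => ij; last exact: submodule0.
  rewrite -{1}(subnK ij); apply: SM; first exact: hcompP.
  exact: hy.
move=> hx xm hW h.
have : J x.
  apply: (frob_gen hJ) hx => f ff j.
  have [fR _] := fsI ff.
  rewrite (hcomp_homog hG _ (RgX hG Rg1 (p ^ n) fR)).
  case: eqP => [->|_]; last exact: submodule0.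
  move=> V hV hV'; rewrite -[_ ^+ _]mulr1; apply: hV' => //.
  by rewrite subnn.
by move=> /(_ m); rewrite (hcomp_id hG xm); apply.
Qed.

(* The dimension of the component of degree m of (I^[p ^ n] + P) / P. *)
Definition Phi P n m : nat := qd P (frob n I `&` Rg m).

Lemma Phi_fin U n m : @submodule k R U -> qfin U (frob n I `&` Rg m).
Proof. by move=> hU; apply: (Rfin_sub (m := m)) => // x []. Qed.

(** Multiplication by a linear form [y] outside [P] gives the growth. Its cokernel is spanned by the
    f ^ q * r, with f among the generators of [I] and r in a basis of R / (P + (y)), whose dimension
    is at most e + 1. *)
Lemma Phi_lipschitz P e : hideal P -> prime_ideal P -> coht_le P e.+2 ->
  ~ (Rg 1%N `<=` P) -> exists C, forall n m,
    (Phi P n m <= Phi P n m.+1)%N /\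
    (Phi P n m.+1 <= Phi P n m + C * m.+2 ^ e)%N.
Proof.
move=> hP pP hcoht nR1; have PS := hideal_submodule hP.
have iP := prime_ideal_ideal pP.
have [y [y1 nPy]] : exists y, Rg 1%N y /\ ~ P y.
  apply: contrapT => ne; apply: nR1 => y y1; apply: contrapT => nPy.
  by apply: ne; exists y.
have hPy := hideal_addi hP (hideal_prin hG y1).
have PyS := hideal_submodule hPy.
have [|C hC] := hilb_bound hPy (e := e).
  apply: (coht_le_step pP _ _ nPy hcoht); first exact/addil/prin_ideal.
  by apply: addir => //; apply: prin_mem.
exists (size fs * C)%N => n m.
have [s bs] := qbasis_exists PS (Phi_fin n m PS); have [sV fS Vs] := bs.
have yS : {morph (fun r => r * y) : x z / x - z} by move=> x z; rewrite mulrBl.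
have yZ (a : k) x : a *: x * y = a *: (x * y) by rewrite scalerAl.
rewrite {1 4}/Phi (qd_basis PS bs); split.
  rewrite -(size_map (fun r => r * y)); apply: qd_ge => //; first exact: Phi_fin.
    move=> v /mapP[r /sV[fr rm] ->]; split; first exact: (ideal_mulr _ (frob_ideal _ _)).
    by rewrite -addn1; apply: RgM.
  apply: (@qfree_image _ _ _ id (fun r => r * y) _ yS yZ P setT) => //.
  - by move=> a; exists a.
  - by apply/submoduleP.
  - by move=> z _ Pzy; apply: contrapT => nPz; exact: (primeM pP nPz nPy).
have /choice[T hT] : forall j, exists t, qbasis (addi P (prin y)) (Rg j) t.
  by move=> j; apply: qbasis_exists => //; apply: Rfin.
pose T' (f : R * nat) := if (p ^ n * f.2 <= m.+1)%N then T (m.+1 - p ^ n * f.2)%N else [::].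
pose l := [seq r * y | r <- s] ++ flatten [seq [seq f.1 ^+ (p ^ n) * r | r <- T' f] | f <- fs].
apply: (@leq_trans (size l)).
  apply: qd_le => // x [fx xm]; apply: (frob_span fx xm); first exact: sp_submodule.
  move=> f r ff fm rR; have [fR If] := fsI ff.
  have [tV _ Tt] := hT (m.+1 - p ^ n * f.2)%N.
  have hr := sp_cap (RgS _) tV rR (Tt r rR).
  have fBl : {morph (fun r => f.1 ^+ (p ^ n) * r) : x z / x - z} by move=> u z; rewrite mulrBr.
  have fZl (a : k) u : f.1 ^+ (p ^ n) * (a *: u) = a *: (f.1 ^+ (p ^ n) * u).
    by rewrite scalerAr.
  have key u : (addi P (prin y) `&` Rg (m.+1 - p ^ n * f.2)%N) u ->
      sp P [seq r * y | r <- s] (f.1 ^+ (p ^ n) * u).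
    move=> [[a [_ [Pa [b ->] uE]]] uR].
    have := hcomp_id hG uR; rewrite uE hcompD (hcompM hG _ _ y1).
    case: ifP => [j1|_ <-]; last first.
      by rewrite addr0; apply: sub_sp; apply: ideal_mull => //; apply: hP.2.
    move=> <-; rewrite mulrDr; apply: submoduleD; first exact: sp_submodule.
      by apply: sub_sp; apply: ideal_mull => //; apply: hP.2.
    rewrite mulrA; apply: (@sp_image _ _ _ id (fun r => r * y) yS yZ P P).
      by move=> z Pz; apply: ideal_mulr.
    apply: Vs; split.
      by apply: (ideal_mulr _ (frob_ideal _ _)); apply: ideal_gen_sub; exists f.1.
    have := RgM hG (RgX hG Rg1 (p ^ n) fR) (hcompP hG b (m.+1 - p ^ n * f.2 - 1)).
    by have -> : (p ^ n * f.2 + (m.+1 - p ^ n * f.2 - 1) = m)%N by lia.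
  have := sp_image fBl fZl key hr.
  apply: sp_min; first exact: sp_submodule.
    exact: sp_catl.
  move=> v vT; apply: mem_sp => //; rewrite mem_cat; apply/orP; right.
  apply/flattenP; exists [seq f.1 ^+ (p ^ n) * r | r <- T' f].
    exact: (map_f (fun f => [seq f.1 ^+ (p ^ n) * r | r <- T' f])).
  by rewrite /T' fm.
rewrite size_cat size_map leq_add2l size_flatten /shape -map_comp sumnE big_map.
apply: (@leq_trans (\sum_(f <- fs) C * m.+2 ^ e)); last first.
  by rewrite big_const_seq count_predT iter_addn_0 mulnC mulnA.
apply: leq_sum => f _; rewrite /= size_map /T'; case: ifP => // fm.
rewrite -(qd_basis PyS (hT _)); apply: leq_trans (hC _) _.
by rewrite leq_mul2l; apply/orP; right; apply: leq_expl; rewrite !ltnS leq_subr.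
Qed.

Lemma Phi_shift P e : hideal P -> prime_ideal P -> coht_le P e.+2 ->
  ~ (Rg 1%N `<=` P) -> exists C, forall n m l,
    (Phi P n m <= Phi P n (m + l))%N /\
    (Phi P n (m + l) <= Phi P n m + l * (C * (m + l).+1 ^ e))%N.
Proof.
move=> hP pP hcoht nR1; have [C hC] := Phi_lipschitz hP pP hcoht nR1.
exists C => n m; elim=> [|l [IH1 IH2]]; first by rewrite addn0 mul0n addn0.
have [h1 h2] := hC n (m + l)%N; rewrite addnS; split; first exact: leq_trans h1.
apply: leq_trans h2 _; rewrite mulSn addnCA addnC leq_add2l.
apply: leq_trans IH2 _; rewrite leq_add2l leq_mul2l; apply/orP; right.
by rewrite leq_mul2l leq_expl ?orbT.
Qed.

(** The maps r -> r ^ p * w send I^[q] into I^[p * q], and over the at least p ^ e members w of the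
    family the images of a free family are jointly free modulo [P]. *)
Lemma Phi_frobenius (K : realType) P e : hideal P -> prime_ideal P ->
  krull_dim K P = e.+1%:R%:E ->
  exists delta, forall n m,
    (p ^ e * Phi P n m <= Phi P n.+1 (p * m + p * delta))%N.
Proof.
move=> hP pP hd; have PS := hideal_submodule hP.
have [kappa [ws [_ wsd hws wss]]] := frob_family hP pP hd.
exists (p.-1 * kappa)%N => n m.
have [s bs] := qbasis_exists PS (Phi_fin n m PS); have [sV fS Vs] := bs.
rewrite {1}/Phi (qd_basis PS bs).
apply: (@leq_trans (size (flatten [seq [seq r ^+ (p ^ 1) * f.1 | r <- s] | f <- [seq (w, P) | w <- ws]]))).
  rewrite (size_flatten_qspan _ _ (fun=> s)) big_const_seq count_predT iter_addn_0.
  by rewrite size_map mulnC leq_mul2l -{1}(expn1 p) wss orbT.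
apply: qd_ge => //; first exact: Phi_fin.
  move=> _ /flattenP[_ /mapP[_ /mapP[w wws ->] ->] /mapP[r /sV[fr rm] ->]] /=.
  split; first by apply: (ideal_mulr _ (frob_ideal _ _)); rewrite -addn1; apply: frobX.
  rewrite -{2 3}(expn1 p); apply: RgM => //; first exact: RgX.
  exact: wsd.
apply: (indep_qfree (@expBp 1) (pX_gt0 1) (k_perfX 1) (S := fun=> s)) => //.
by move=> _ /mapP[w _ ->].
Qed.

End Generators.

(** * Reduction to domains and existence of limits *)

(** Every prime containing [I] strictly contains some [Pm i], which can be put in front of a
    chain. *)
Lemma coht_le_nonminimal t (Pm : 'I_t -> set R) I d :
  (forall P, prime_ideal P -> exists i, Pm i `<=` P) ->
  (forall i, prime_ideal (Pm i)) -> (forall i, ~ (I `<=` Pm i)) ->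
  coht_le [set 0] d.+1 -> coht_le I d.
Proof.
move=> above pPm nI h n c [c1 c2].
have [pc0 Ic0] := c1 0%N (leq0n n); have [i Pc0] := above _ pc0.
suff : (n.+1 <= d.+1)%N by [].
apply: (h n.+1 (fun j => if j is j'.+1 then c j' else Pm i)); split.
  case=> [_|j jn]; first by split=> // _ ->; exact: (ideal0 (prime_ideal_ideal (pPm i))).
  by have [h1 _] := c1 j jn; split=> // _ ->; exact: (ideal0 (prime_ideal_ideal h1)).
case=> [_|j jn]; last exact: c2.
by split=> // h'; apply: (nI i) => x /Ic0/h'.
Qed.

(* Up to terms of lower order, R as a module over its q0-th powers is a direct
   sum of copies of the domains R / P, P a minimal prime, once the q0-th powers
   of the nilpotents vanish. *)
Lemma qspan_decomposition (K : realType) e : krull_dim K [set (0 : R)] = e.+2%:R%:E ->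
  equidimensional K R ->
  exists n0 delta (L : seq (R * set R)) C,
    [/\ forall f, f \in L -> [/\ hideal f.2, minimal_prime f.2,
          Rg (p ^ n0 * delta)%N f.1
          & forall r, f.2 r -> r ^+ (p ^ n0) * f.1 = 0],
        indep (p ^ n0) [set (0 : R)] L
      & forall M, (qd (TT (p ^ n0) setT [set (0%R : R)] L) (Rg (p ^ n0 * M)) <=
          C * M.+1 ^ e)%N].
Proof.
move=> hd heq.
have [t [Pm [N [hPm above incl nilp]]]] := exists_minimal_primes.
have pPm i : prime_ideal (Pm i) by case: (hPm i) => _ [].
(* Since p ^ N >= N, q-th powers kill the nilradical. *)
pose n0 := N; set q := (p ^ n0)%N; have q0 : (0 < q)%N := pX_gt0 n0.
have nilq x : (forall i, Pm i x) -> x ^+ q = 0.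
  move=> /nilp xN; have NQ : (N <= q)%N.
    by apply/ltnW/ltn_expl/prime_gt1/p_prime.
  by rewrite -(subnK NQ) exprD xN mulr0.
have /choice[sep] : forall i, exists ax : nat * R,
    [/\ Rg ax.1 ax.2, ~ Pm i ax.2 & forall j, j != i -> Pm j ax.2].
  move=> i; have [a [x hax]] := @exists_separator _ Pm i (fun i => conj (hPm i).1 (pPm i)) incl.
  by exists (a, x).
pose a i := (sep i).1; pose tau i := (sep i).2 => hsep.
have /choice[y hy] : forall i, exists y, Rg 1%N y /\ ~ Pm i y.
  move=> i; apply: contrapT => ne.
  have hdi : krull_dim K (Pm i) = e.+2%:R%:E by rewrite (heq _ (hPm i).2).
  have [nR1 _] := hilb_lower (hPm i).1 (pPm i) hdi.
  by apply: nR1 => y y1; apply: contrapT => nPy; apply: ne; exists y.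
have [N0 [bas [bR hbas]]] := Rgq_gen q0.
pose delta := (N0 + \sum_(i < t) a i)%N.
have ad m i : (m <= N0)%N -> (m + a i <= delta)%N.
  move=> mN; apply: leq_add => //.
  by rewrite (bigD1 i) //= leq_addr.
(* The separator [tau i] lies in all minimal primes but [Pm i]; for [r] in [Pm i] the product r *
   tau i is therefore nilpotent, and r ^ q kills the candidate. The power of [y i] equalizes
   degrees. *)
pose w i m u := (tau i * y i ^+ (delta - (m + a i))) ^+ q * u.
pose C := flatten [seq flatten [seq [seq (w i m u, Pm i) | u <- bas (q * m)%N]
                  | m <- iota 0 N0.+1] | i <- enum 'I_t].
have CP f : f \in C -> exists i, [/\ f.2 = Pm i, Rg (q * delta)%N f.1
    & forall r, Pm i r -> r ^+ q * f.1 = 0].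
  move=> /flattenP[_ /mapP[i _ ->] /flattenP[_ /mapP[m mN ->] /mapP[u ub ->]]] /=.
  rewrite mem_iota ltnS in mN; exists i; have [ta _ tj] := hsep i; split=> //.
    have -> : (q * delta = q * (a i + (delta - (m + a i)) * 1) + q * m)%N.
      by rewrite -mulnDr muln1; congr (_ * _)%N; have := ad m i mN; lia.
    apply: RgM => //; last exact: bR.
    by apply: RgX => //; apply: RgM => //; apply: RgX => //; case: (hy i).
  move=> r Pr; rewrite /w mulrA -exprMn nilq ?mul0r // => j.
  have iPj := prime_ideal_ideal (pPm j).
  have [->|ji] := eqVneq j i; first exact: (ideal_mulr _ (prime_ideal_ideal (pPm i))).
  by apply: ideal_mull => //; apply: ideal_mulr => //; apply: tj.
have i0 : ideal [set 0 : R] by exact: ideal_set0.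
have [|L [LC iL hL]] := @indep_extend k R q q0 [set 0] [::] C _ i0 I.
  by move=> f /CP[i [-> _ _]].
rewrite cats0 in iL hL.
pose us := flatten [seq bas (q * m)%N | m <- iota 0 N0.+1].
pose c0 := [set c | forall u, u \in us -> TT q setT [set 0] L (c ^+ q * u)].
have hc0 : hideal c0.
  apply: conductor_hideal; first exact: hideal_set0.
    by move=> f /LC/CP[i [_ fd _]]; exists (q * delta)%N.
  by move=> u /flattenP[_ /mapP[m _ ->] /bR]; exists (q * m)%N.
have nc0 i : ~ (c0 `<=` Pm i).
  have /choice[r hr] : forall f, exists r, f \in C ->
      ~ f.2 r /\ TT q setT [set 0] L (r ^+ q * f.1).
    move=> f; have [/hL[r]|] := boolP (f \in C); last by exists 0.
    by exists r.
  (* Only candidates attached to [Pm i] enter: the [r f] chosen for another prime may lie in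
     [Pm i]. *)
  pose Ci := [seq f <- C | f.2 == Pm i].
  pose cc := tau i * y i ^+ delta * \prod_(f <- Ci) r f.
  move=> /(_ cc) h; have : Pm i cc; last first.
    apply: primeM => //; first apply: primeM => //.
    - by case: (hsep i).
    - by apply: primeX => //; case: (hy i).
    - by apply: prime_prod => // f; rewrite mem_filter => /andP[/eqP fP /hr[]]; rewrite fP.
  apply: h => u /flattenP[_ /mapP[m mN ->] ub].
  pose f := (w i m u, Pm i).
  have fC : f \in C.
    apply/flattenP; eexists; first exact: (map_f _ (mem_enum _ i)).
    by apply/flattenP; eexists; [apply: map_f mN|apply: (map_f (fun u => (w i m u, Pm i)))].
  have fCi : f \in Ci by rewrite mem_filter eqxx.
  have [_ hf] := hr f fC.
  have mN' : (m + a i <= delta)%N by apply: ad; rewrite -ltnS; move: mN; rewrite mem_iota.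
  have -> : cc ^+ q * u = (y i ^+ (m + a i) * \prod_(g <- rem f Ci) r g) ^+ q * (r f ^+ q * f.1).
    rewrite /cc (perm_big _ (perm_to_rem fCi)) big_cons /= /w.
    rewrite -{1}(subnK mN') exprD !exprMn.
    by rewrite -!mulrA; ring.
  exact: (TT_mul (V := setT) i0 _ hf).
have [|C1 hC1] := hilb_bound hc0 (e := e).
  apply: (coht_le_nonminimal above pPm nc0); exact: coht_le_krull hd.
have TS : @submodule k R (TT q setT [set 0] L).
  apply: (TT_submodule (@expBp n0) q0 (k_perfX n0)) => //.
  by apply/submoduleP.
have c0S := hideal_submodule hc0.
exists n0, delta, L, (\sum_(m <- iota 0 N0.+1) size (bas (q * m)%N) * C1)%N; split=> //.
  by move=> f /LC/CP[i [-> fd fr]]; split=> //; case: (hPm i).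
move=> M.
have /choice[T hT] : forall j, exists s, qbasis c0 (Rg j) s.
  by move=> j; apply: qbasis_exists => //; apply: Rfin.
(* Modulo [TT], the coefficient [s] of [u] only matters modulo the conductor [c0], whose quotient
   has dimension at most e + 1. *)
pose l := flatten [seq flatten [seq [seq s ^+ q * u | s <-
   if (m <= M)%N then T (M - m)%N else [::]] | u <- bas (q * m)%N] | m <- iota 0 N0.+1].
apply: (@leq_trans (size l)).
  apply: qd_le => //; apply: hbas; first exact: sp_submodule.
  move=> m s u mN mM sR ub.
  have [_ _ Tm] := hT (M - m)%N.
  have mi : m \in iota 0 N0.+1 by rewrite mem_iota ltnS mN.
  have : sp (TT q setT [set 0] L) [seq s ^+ q * u | s <- T (M - m)%N] (s ^+ q * u).
    apply: (@sp_image _ _ _ (fun a => a ^+ q) (fun r => r ^+ q * u) _ _ c0).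
    - by move=> x z; rewrite expBp mulrBl.
    - by move=> b x; rewrite expZ_q scalerAl.
    - by move=> c hc; apply: hc; apply/flattenP; exists (bas (q * m)%N) => //; apply: map_f.
    - exact: Tm.
  apply: sp_min; first exact: sp_submodule.
    exact: sub_sp.
  move=> v vT; apply: mem_sp => //.
  apply/flattenP; eexists; first exact: (map_f _ mi).
  by apply/flattenP; eexists; [apply: map_f ub|rewrite mM].
rewrite size_flatten /shape -map_comp sumnE big_map big_distrl /=.
apply: leq_sum_seq_mem => m _.
rewrite size_flatten /shape -map_comp sumnE big_map /=.
apply: (@leq_trans (\sum_(u <- bas (q * m)%N) C1 * M.+1 ^ e)); last first.
  by rewrite big_const_seq count_predT iter_addn_0 mulnC mulnA.
apply: leq_sum => u _; rewrite size_map; case: ifP => // mM.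
rewrite -(qd_basis c0S (hT _)); apply: leq_trans (hC1 _) _.
by rewrite leq_mul2l leq_expl ?orbT // ltnS leq_subr.
Qed.

Section Limits.
Variables (I : set R) (fs : seq (R * nat)).
Hypothesis hI : hideal I.
Hypothesis fsI : forall f, f \in fs -> Rg f.2 f.1 /\ I f.1.
Hypothesis fs_gen : forall J, ideal J -> (forall f, f \in fs -> J f.1) -> I `<=` J.

(** Below: the products r ^ q0 * w with r in I^[q] are free by independence. Above: in f ^ (q * q0)
    * u with [u] in the span of the family, the coefficients get multiplied by f ^ q and so lie in
    I^[q]; modulo that span, only O(m ^ e) further [u] are needed for each generator f. *)
Lemma Phi_decomposition n0 delta (L : seq (R * set R)) C e :
  (forall f, f \in L -> [/\ hideal f.2, minimal_prime f.2,
     Rg (p ^ n0 * delta)%N f.1 & forall r, f.2 r -> r ^+ (p ^ n0) * f.1 = 0]) ->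
  indep (p ^ n0) [set (0 : R)] L ->
  (forall M, qd (TT (p ^ n0) setT [set (0%R : R)] L) (Rg (p ^ n0 * M)) <= C * M.+1 ^ e)%N ->
  exists C', forall n m, (delta <= m)%N ->
    (\sum_(f <- L) Phi I f.2 n (m - delta) <= Phi I [set (0%R : R)] (n + n0) (p ^ n0 * m))%N /\
    (Phi I [set (0%R : R)] (n + n0) (p ^ n0 * m) <=
       \sum_(f <- L) Phi I f.2 n (m - delta) + C' * m.+1 ^ e)%N.
Proof.
move=> hL iL hT; set q := (p ^ n0)%N in hL iL hT *; have q0 : (0 < q)%N := pX_gt0 n0.
have i0 : ideal [set 0 : R] by exact: ideal_set0.
have TS : @submodule k R (TT q setT [set 0] L).
  apply: (TT_submodule (@expBp n0) q0 (k_perfX n0)) => //.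
  by apply/submoduleP.
exists (size fs * C)%N => n m dm.
have /choice[S hS] : forall P, exists s, hideal P ->
    qbasis P (frob n I `&` Rg (m - delta)%N) s.
  move=> P; have [hP|nP] := pselect (hideal P); last by exists [::].
  have [s hs] := qbasis_exists (hideal_submodule hP)
    (Phi_fin I n (m - delta) (hideal_submodule hP)).
  by exists s.
pose l := flatten [seq [seq r ^+ q * f.1 | r <- S f.2] | f <- L].
have sl : size l = \sum_(f <- L) Phi I f.2 n (m - delta).
  rewrite /l size_flatten_qspan big_seq [RHS]big_seq; apply: eq_bigr => f /hL[hP _ _ _].
  by rewrite -(qd_basis (hideal_submodule hP) (hS _ hP)).
rewrite -sl; split.
  apply: qd_ge => //; first exact: Phi_fin.
    move=> _ /flattenP[_ /mapP[f /hL[hP _ fd _] ->] /mapP[r rS ->]].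
    have [rV _ _] := hS _ hP; have [fr rm] := rV r rS; split.
      by apply: (ideal_mulr _ (frob_ideal _ _)); apply: frobX.
    have -> : (q * m = q * (m - delta) + q * delta)%N by rewrite -mulnDr subnK.
    by apply: RgM => //; apply: RgX.
  apply: (indep_qfree (@expBp n0) q0 (k_perfX n0)) => //.
  by move=> f /hL[hP _ _ _]; have [] := hS _ hP.
have /choice[T hTb] : forall M, exists s, qbasis (TT q setT [set 0] L) (Rg (q * M)%N) s.
  by move=> M; apply: qbasis_exists => //; apply: Rfin.
pose T' (f : R * nat) := if (p ^ n * f.2 <= m)%N then T (m - p ^ n * f.2)%N else [::].
pose l2 := flatten [seq [seq f.1 ^+ (p ^ (n + n0)) * r | r <- T' f] | f <- fs].
apply: (@leq_trans (size (l ++ l2))); last first.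
  rewrite size_cat leq_add2l size_flatten /shape -map_comp sumnE big_map.
  apply: (@leq_trans (\sum_(f <- fs) C * m.+1 ^ e)); last first.
    by rewrite big_const_seq count_predT iter_addn_0 mulnC mulnA.
  apply: leq_sum => f _; rewrite /= size_map /T'; case: ifP => // fm.
  rewrite -(qd_basis TS (hTb _)); apply: leq_trans (hT _) _.
  by rewrite leq_mul2l leq_expl ?orbT // ltnS leq_subr.
apply: qd_le => // x [fx xm]; apply: (frob_span fsI fs_gen fx xm).
  exact: sp_submodule.
move=> f r ff fm rR; have [fR If] := fsI ff.
have eM : (q * m - p ^ (n + n0) * f.2 = q * (m - p ^ n * f.2))%N.
  by rewrite mulnBr mulnA -expnD addnC.
have fm' : (p ^ n * f.2 <= m)%N by move: fm; rewrite expnD mulnAC mulnC leq_pmul2l.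
rewrite eM in rR; set M := (m - p ^ n * f.2)%N in rR eM.
have [tV _ Tt] := hTb M.
have hr := sp_cap (RgS _) tV rR (Tt r rR).
have fBl : {morph (fun r => f.1 ^+ (p ^ (n + n0)) * r) : x z / x - z} by move=> u z; rewrite mulrBr.
have fZl (a : k) u : f.1 ^+ (p ^ (n + n0)) * (a *: u) = a *: (f.1 ^+ (p ^ (n + n0)) * u).
  by rewrite scalerAr.
have key u : (TT q setT [set 0] L `&` Rg (q * M)%N) u ->
    sp [set 0] l (f.1 ^+ (p ^ (n + n0)) * u).
  move=> [Tu uR].
  have hTu : TT q (Rs Rg M delta) [set 0] L u.
    apply: (TT_homog (hideal_set0 hG)) => //.
    by move=> g /hL[_ _ gd _].
  rewrite expnD exprM.
  have : TT q (frob n I `&` Rg (m - delta)%N) [set 0] L ((f.1 ^+ (p ^ n)) ^+ q * u).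
    apply: TT_mul hTu => // s; rewrite /Rs /=; case: ifP => dM; last first.
      by move=> ->; rewrite mulr0; split=> //; apply: (ideal0 (frob_ideal _ _)).
    move=> sM; split.
      by apply: (ideal_mulr _ (frob_ideal _ _)); apply: ideal_gen_sub; exists f.1.
    have := RgM hG (RgX hG Rg1 (p ^ n) fR) sM.
    by have -> : (p ^ n * f.2 + (M - delta) = m - delta)%N by rewrite /M; lia.
  apply: (TT_sp (@expBp n0)) => //.
  - by move=> g /hL[hP _ _ _]; have [] := hS _ hP.
  - by move=> g /hL[_ _ _ h] s /h.
have := sp_image fBl fZl key hr.
apply: sp_min; first exact: sp_submodule.
  exact: sp_catl.
move=> v vT; apply: mem_sp => //; rewrite mem_cat; apply/orP; right.
apply/flattenP; exists [seq f.1 ^+ (p ^ (n + n0)) * r | r <- T' f].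
  exact: (map_f (fun f => [seq f.1 ^+ (p ^ (n + n0)) * r | r <- T' f])).
by rewrite /T' fm'.
Qed.

(** The shifts by [delta] and in [Phi_frobenius] are bounded, so that by [Phi_shift] they change
    [Phi] by O(q ^ e), one order below the normalization. *)
Lemma Phi_cvg (K : realType) P e n1 X delta : hideal P -> prime_ideal P ->
  krull_dim K P = e.+2%:R%:E -> (0 < X)%N ->
  cvg ((fun n => (Phi I P (n1 + n) (X * p ^ n - delta))%:R /
         (p ^ n)%:R ^+ e.+1 : K) @ \oo).
Proof.
move=> hP pP hd X0; have PS := hideal_submodule hP.
have p2 : (1 < p)%N by apply: prime_gt1; apply: p_prime.
have pn n : (0 < p ^ n)%N by apply: pX_gt0.
have [nR1 _] := hilb_lower hP pP hd.
have [C hC] := Phi_shift fsI fs_gen hP pP (coht_le_krull hd) nR1.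
have [d' hd'] := Phi_frobenius I hP pP hd.
have [C1 hC1] := hilb_bound hP (coht_le_krull hd).
pose a n := Phi I P (n1 + n) (X * p ^ n).
have ca : cvg ((fun n => (a n)%:R / (p ^ n)%:R ^+ e.+1 : K) @ \oo).
  apply: (@cvg_superadditive K p p2 e a
    (p * d' * (C * (X * p + p * d').+1 ^ e)) (C1 * X.+1 ^ e.+1)) => n.
    apply: leq_trans (hd' _ _) _; rewrite /a addnS.
    have -> : (p * (X * p ^ n) = X * p ^ n.+1)%N by rewrite expnS mulnCA.
    apply: leq_trans (hC _ _ _).2 _; rewrite leq_add2l -!mulnA !leq_mul2l.
    apply/orP; right; apply/orP; right; apply/orP; right.
    rewrite -expnMn; apply: leq_expl.
    by rewrite expnS; have := pn n; nia.
  apply: (@leq_trans (hilb P (X * p ^ n))).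
    by apply: (qd_mono PS PS _ _ (Rfin _ PS)) => // x [].
  apply: leq_trans (hC1 _) _; rewrite -mulnA leq_mul2l -expnMn; apply/orP; right.
  by apply: leq_expl; have := pn n; nia.
have dX n : (delta <= n)%N -> (delta <= X * p ^ n)%N.
  move=> dn; apply: leq_trans dn _; apply: leq_trans (ltnW (ltn_expl n p2)) _.
  by rewrite leq_pmull.
apply: cvgP; apply: (@cvg_pow_close K p p2 _ _ delta (delta * (C * X.+1 ^ e))%:R _ _ ca) => n dn.
have := hC (n1 + n)%N (X * p ^ n - delta)%N delta; rewrite subnK ?dX // => -[h1 h2].
have pe : 0 < ((p ^ n)%:R : K) ^+ e.+1 by rewrite exprn_gt0 // ltr0n.
rewrite -mulrBl normrM (gtr0_norm (x := _^-1)) ?invr_gt0 // ger0_norm ?subr_ge0 ?ler_nat //.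
rewrite -(natr_pow_split K p2 e n) mulrA ler_wpM2r ?invr_ge0 ?(ltW pe) //.
rewrite lerBlDl -natrM -natrD ler_nat; apply: leq_trans h2 _.
rewrite leq_add2l -!mulnA !leq_mul2l -expnMn.
apply/orP; right; apply/orP; right; apply: leq_expl.
by have := pn n; nia.
Qed.

Lemma sum_cvg (K : realType) (T : eqType) (r : seq T) (u : T -> nat -> K) :
  (forall i, i \in r -> cvg (u i @ \oo)) ->
  cvg ((fun n => \sum_(i <- r) u i n) @ \oo).
Proof.
elim: r => [|i r IH] h.
  have -> : (fun n => \sum_(i <- [::]) u i n) = (fun=> 0).
    by apply/funext => n; rewrite big_nil.
  exact: is_cvg_cst.
have -> : (fun n => \sum_(j <- i :: r) u j n) = u i + (fun n => \sum_(j <- r) u j n).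
  by apply/funext => n; rewrite big_cons.
apply: is_cvgD; first by apply: h; rewrite inE eqxx.
by apply: IH => j jr; apply: h; rewrite inE jr orbT.
Qed.

Lemma Phi0_cvg (K : realType) n0 delta (L : seq (R * set R)) C e n1 X :
  krull_dim K [set (0 : R)] = e.+2%:R%:E -> equidimensional K R ->
  (forall f, f \in L -> [/\ hideal f.2, minimal_prime f.2,
     Rg (p ^ n0 * delta)%N f.1 & forall r, f.2 r -> r ^+ (p ^ n0) * f.1 = 0]) ->
  indep (p ^ n0) [set (0 : R)] L ->
  (forall M, qd (TT (p ^ n0) setT [set (0%R : R)] L) (Rg (p ^ n0 * M)) <= C * M.+1 ^ e)%N ->
  (0 < X)%N ->
  cvg ((fun n => (Phi I [set (0 : R)] (n1 + n + n0) (p ^ n0 * (X * p ^ n)))%:R /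
     (p ^ n)%:R ^+ e.+1 : K) @ \oo).
Proof.
move=> hd heq hL iL hT X0.
have p2 : (1 < p)%N by apply: prime_gt1; apply: p_prime.
have pn n : (0 < p ^ n)%N by apply: pX_gt0.
have [C' hC'] := Phi_decomposition hL iL hT.
have cS : cvg ((fun n => \sum_(f <- L) ((Phi I f.2 (n1 + n) (X * p ^ n - delta))%:R /
         (p ^ n)%:R ^+ e.+1 : K)) @ \oo).
  apply: (sum_cvg (u := fun f n => (Phi I f.2 (n1 + n) (X * p ^ n - delta))%:R /
         (p ^ n)%:R ^+ e.+1 : K)) => f /hL[hP mP _ _].
  by apply: Phi_cvg => //; [case: mP|rewrite (heq _ mP)].
have dX n : (delta <= n)%N -> (delta <= X * p ^ n)%N.
  move=> dn; apply: leq_trans dn _; apply: leq_trans (ltnW (ltn_expl n p2)) _.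
  by rewrite leq_pmull.
apply: cvgP; apply: (@cvg_pow_close K p p2 _ _ delta (C' * X.+1 ^ e)%:R _ _ cS) => n dn.
have [h1 h2] := hC' (n1 + n)%N _ (dX n dn).
have pe : 0 < ((p ^ n)%:R : K) ^+ e.+1 by rewrite exprn_gt0 // ltr0n.
rewrite -mulr_suml -natr_sum -mulrBl normrM distrC.
rewrite (gtr0_norm (x := _^-1)) ?invr_gt0 // ger0_norm ?subr_ge0 ?ler_nat //.
rewrite -(natr_pow_split K p2 e n) mulrA ler_wpM2r ?invr_ge0 ?(ltW pe) //.
rewrite lerBlDl -natrM -natrD ler_nat; apply: leq_trans h2 _.
rewrite leq_add2l -!mulnA !leq_mul2l -expnMn.
apply/orP; right; apply: leq_expl.
by have := pn n; nia.
Qed.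

End Limits.

(** * Tight closure *)

Lemma graded_length_hilb (K : realType) I (m : nat) : ideal I ->
  graded_length K Rg I m%:Z = (hilb I m)%:R%:E.
Proof.
move=> iI; have IS : @submodule k R I := ideal_submodule iI.
have RIS : @submodule k R (Rg m `&` I) by exact: submoduleI.
have RISR : Rg m `&` I `<=` Rg m by move=> x [].
have RISI : Rg m `&` I `<=` I by move=> x [].
rewrite /graded_length /= (qlength_qd K RIS (RgS m) RISR (Rfin m RIS)).
by rewrite (qd_split RIS IS (RgS m) RISI (Rfin m RIS)) (@qd0 _ _ _ (Rg m `&` I)).
Qed.

Lemma hilb_frob_le (I J : set R) n m : I `<=` J ->
  hilb (frob n I) m = (qd (frob n I) (Rg m `&` frob n J) + hilb (frob n J) m)%N.
Proof.
move=> IJ; apply: qd_split => //; try exact: ideal_submodule; last first.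
  exact/Rfin/ideal_submodule.
apply: ideal_gen_min => // _ [x Ix <-]; apply: ideal_gen_sub; exists x => //.
exact: IJ.
Qed.

(** For the unit ideal, I^[q] is R; convergence of the Hilbert functions thus reduces to that of
    [Phi] modulo 0 for two ideals. *)
Lemma hilb_frob_Phi I n m :
  hilb (frob n I) m = (Phi setT [set (0%R : R)] n m - Phi I [set (0%R : R)] n m)%N.
Proof.
have fT : frob n [set: R] = setT.
  apply/seteqP; split=> // x _; rewrite -[x]mulr1.
  by apply: (ideal_mull _ (frob_ideal _ _)); apply: ideal_gen_sub; exists 1; rewrite ?expr1n.
have FS : @submodule k R (frob n I) by exact: ideal_submodule.
rewrite /Phi fT setTI (@qd_split _ _ [set 0] (frob n I) (Rg m)) //.
- by rewrite setIC addKn.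
- by move=> _ ->; apply: submodule0.
- exact: Rfin.
Qed.

Lemma tight_closureD I x y : tight_closure p I x -> tight_closure p I y ->
  tight_closure p I (x + y).
Proof.
move=> [c [hc [N1 _ h1]]] [d [hd [N2 _ h2]]]; exists (c * d); split.
  by move=> P mP; apply: primeM (hc P mP) (hd P mP); case: mP.
exists (maxn N1 N2) => // n /= hn; rewrite expDp mulrDr.
apply: (idealD (frob_ideal _ _)).
  rewrite mulrAC; apply: (ideal_mulr _ (frob_ideal _ _)); apply: h1.
  by apply: leq_trans hn; apply: leq_maxl.
rewrite -mulrA; apply: (ideal_mull _ (frob_ideal _ _)); apply: h2.
by apply: leq_trans hn; apply: leq_maxr.
Qed.

Lemma tight_closure0 I : tight_closure p I 0.
Proof.
exists 1; split; first by move=> P [pP _]; apply: prime_n1.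
exists 0%N => // n _ /=.
by rewrite expr0n gtn_eqF ?pX_gt0 // mulr0; apply: (ideal0 (frob_ideal _ _)).
Qed.

Lemma uniform_bound (T : eqType) (r : seq T) (Q : T -> nat -> Prop) :
  (forall i, i \in r -> exists N, forall n, (N <= n)%N -> Q i n) ->
  exists N, forall i n, i \in r -> (N <= n)%N -> Q i n.
Proof.
elim: r => [|i r IH] h; first by exists 0%N.
have [|N1 h1] := h i; first by rewrite inE eqxx.
have [|N2 h2] := IH; first by move=> j jr; apply: h; rewrite inE jr orbT.
exists (maxn N1 N2) => j n; rewrite inE geq_max => /orP[/eqP ->|jr] /andP[n1 n2].
  exact: h1.
exact: h2.
Qed.

(** The sum C of tau_i * c_i, separators times local multipliers, avoids every minimal prime and
    puts C * w ^ q in I^[q] plus the nilradical. Raising to the power p ^ N removes the nilpotent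
    part. *)
Lemma tight_closure_local I w :
  (forall P, hideal P -> minimal_prime P -> exists2 c, ~ P c &
     \forall n \near \oo, addi (frob n I) P (c * w ^+ (p ^ n))) ->
  tight_closure p I w.
Proof.
move=> hw; have [t [Pm [N [hPm above incl nilp]]]] := exists_minimal_primes.
have pPm i : prime_ideal (Pm i) by case: (hPm i) => _ [].
have iPm i : ideal (Pm i) := prime_ideal_ideal (pPm i).
have p2 : (1 < p)%N by apply: prime_gt1; apply: p_prime.
have /choice[c hc] : forall i, exists c, ~ Pm i c /\
    \forall n \near \oo, addi (frob n I) (Pm i) (c * w ^+ (p ^ n)).
  by move=> i; have [c nc hn] := hw _ (hPm i).1 (hPm i).2; exists c.
have /choice[tau htau] : forall i, exists x, ~ Pm i x /\ forall j, j != i -> Pm j x.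
  move=> i; have [a [x [_ nx hx]]] := @exists_separator _ Pm i (fun i => conj (hPm i).1 (pPm i)) incl.
  by exists x.
have [N' hN'] : exists N', forall i n, i \in enum 'I_t -> (N' <= n)%N ->
    addi (frob n I) (Pm i) (c i * w ^+ (p ^ n)).
  by apply: uniform_bound => i _; have [_ [M _ hM]] := hc i; exists M => n; apply: hM.
pose C := \sum_(i < t) tau i * c i.
have nC j : ~ Pm j C.
  rewrite /C (bigD1 j) //= => h; apply: (primeM (pPm j) (htau j).1 (hc j).1).
  rewrite -(addrK (\sum_(i < t | i != j) tau i * c i) (tau j * c j)).
  apply: idealB => //; apply: ideal_sum => // i ij; apply: ideal_mulr => //.
  by apply: (htau i).2; rewrite eq_sym.
exists (C ^+ (p ^ N)); split.
  move=> P [pP minP]; have [i Pi] := above P pP.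
  by rewrite -(minP _ (pPm i) Pi); apply: primeX.
exists (N' + N)%N => // n /= hn; have hn' : (N' <= n - N)%N by lia.
have nE : (p ^ n = p ^ (n - N) * p ^ N)%N by rewrite -expnD subnK //; lia.
have [u [v [hu hv e]]] : exists u v : R, [/\ frob (n - N) I u, forall j, Pm j v
    & C * w ^+ (p ^ (n - N)) = u + v].
  have /choice[ab hab] : forall i, exists ab : R * R, [/\ frob (n - N) I ab.1,
      Pm i ab.2 & c i * w ^+ (p ^ (n - N)) = ab.1 + ab.2].
    move=> i; have [a [b [ha hb e]]] := hN' i (n - N)%N (mem_enum _ i) hn'.
    by exists (a, b).
  exists (\sum_(i < t) tau i * (ab i).1), (\sum_(i < t) tau i * (ab i).2); split.
  - apply: (ideal_sum _ (frob_ideal _ _)) => i _.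
    by apply: (ideal_mull _ (frob_ideal _ _)); case: (hab i).
  - move=> j; apply: ideal_sum => // i _.
    have [->|ji] := eqVneq j i; first by apply: ideal_mull => //; case: (hab i).
    by apply: ideal_mulr => //; apply: (htau i).2.
  - rewrite /C mulr_suml -big_split; apply: eq_bigr => i _ /=.
    by case: (hab i) => _ _ e; rewrite -mulrA e mulrDr.
have -> : C ^+ (p ^ N) * w ^+ (p ^ n) = u ^+ (p ^ N).
  rewrite nE exprM -exprMn e expDp.
  have vN : v ^+ N = 0 by apply: nilp.
  have NQ : (N <= p ^ N)%N by apply: ltnW; apply: ltn_expl.
  by rewrite -{2}(subnK NQ) exprD vN mulr0 addr0.
have : frob (n - N + N) I (u ^+ (p ^ N)) by apply: frobX.
by rewrite subnK //; lia.
Qed.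

(** J^[q] / I^[q] is generated by the q-th powers of finitely many generators of [J], all killed by
    the ideal [c0] of common multipliers; each contributes at most a shifted Hilbert function of R /
    c0. *)
Lemma tight_closure_hilb (K : realType) I J e : krull_dim K [set (0 : R)] = e.+2%:R%:E ->
  hideal I -> hideal J -> I `<=` J -> J `<=` tight_closure p I ->
  exists C n0, forall n m, (n0 <= n)%N ->
    (hilb (frob n I) m <= hilb (frob n J) m + C * m.+1 ^ e)%N.
Proof.
move=> hd hI hJ IJ Jtc.
have [t [Pm [N [hPm above incl nilp]]]] := exists_minimal_primes.
have pPm i : prime_ideal (Pm i) by case: (hPm i) => _ [].
have [fs [fsJ fs_gen]] := exists_hgens hJ.
have /choice[c hc] : forall f, exists c, f \in fs ->
    (forall P, minimal_prime P -> ~ P c) /\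
    exists N, forall n, (N <= n)%N -> frob n I (c * f.1 ^+ (p ^ n)).
  move=> f; have [/fsJ[_ /Jtc[c [hc1 [M _ hM]]]]|] := boolP (f \in fs); last by exists 0.
  by exists c => _; split=> //; exists M => n; apply: hM.
have [n0 hn0] : exists n0, forall f n, f \in fs -> (n0 <= n)%N ->
    frob n I (c f * f.1 ^+ (p ^ n)).
  by apply: uniform_bound => f /hc[].
pose c0 := [set a | forall f n, f \in fs -> (n0 <= n)%N -> frob n I (a * f.1 ^+ (p ^ n))].
have hc0 : hideal c0.
  split.
    apply/idealP; split=> [f n _ _|a x y hx hy f n ff nn].
      by rewrite mul0r; apply: (ideal0 (frob_ideal _ _)).
    rewrite mulrDl -mulrA; apply: (idealD (frob_ideal _ _)); last exact: hy.
    by apply: (ideal_mull _ (frob_ideal _ _)); apply: hx.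
  move=> x m hx f n ff nn; have [fR _] := fsJ f ff.
  rewrite -(hcompM_r hG x m (RgX hG Rg1 (p ^ n) fR)).
  by apply: (frob_hideal n hI).2; apply: hx.
have nc0 i : ~ (c0 `<=` Pm i).
  move=> /(_ (\prod_(f <- fs) c f)) h.
  have : Pm i (\prod_(f <- fs) c f); last first.
    by apply: prime_prod => // f /hc[hf _]; apply: hf; case: (hPm i).
  apply: h => f n ff nn; rewrite (perm_big _ (perm_to_rem ff)) big_cons mulrAC.
  by apply: (ideal_mulr _ (frob_ideal _ _)); apply: hn0.
have [|C hC] := hilb_bound hc0 (e := e).
  by apply: (coht_le_nonminimal above pPm nc0); apply: coht_le_krull hd.
exists (size fs * C)%N, n0 => n m nn.
rewrite (hilb_frob_le n m IJ) addnC leq_add2l.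
have c0S := hideal_submodule hc0.
have FS : @submodule k R (frob n I) by exact: ideal_submodule.
have /choice[T hT] : forall j, exists s, qbasis c0 (Rg j) s.
  by move=> j; apply: qbasis_exists => //; apply: Rfin.
pose T' (f : R * nat) := if (p ^ n * f.2 <= m)%N then T (m - p ^ n * f.2)%N else [::].
pose l := flatten [seq [seq f.1 ^+ (p ^ n) * r | r <- T' f] | f <- fs].
apply: (@leq_trans (size l)); last first.
  rewrite size_flatten /shape -map_comp sumnE big_map.
  apply: (@leq_trans (\sum_(f <- fs) C * m.+1 ^ e)); last first.
    by rewrite big_const_seq count_predT iter_addn_0 mulnC mulnA.
  apply: leq_sum => f _; rewrite /= size_map /T'; case: ifP => // fm.
  rewrite -(qd_basis c0S (hT _)); apply: leq_trans (hC _) _.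
  by rewrite leq_mul2l leq_expl ?orbT // ltnS leq_subr.
apply: qd_le => // x [xm fx]; apply: (frob_span fsJ fs_gen fx xm).
  exact: sp_submodule.
move=> f r ff fm rR; have [fR Jf] := fsJ f ff.
have [_ _ Tt] := hT (m - p ^ n * f.2)%N.
have fBl : {morph (fun r => f.1 ^+ (p ^ n) * r) : x z / x - z} by move=> u z; rewrite mulrBr.
have fZl (a : k) u : f.1 ^+ (p ^ n) * (a *: u) = a *: (f.1 ^+ (p ^ n) * u).
  by rewrite scalerAr.
have key u : c0 u -> frob n I (f.1 ^+ (p ^ n) * u) by move=> hu; rewrite mulrC; apply: hu.
have := sp_image fBl fZl key (Tt r rR).
apply: sp_min; [exact: sp_submodule|exact: sub_sp|] => v vT.
apply: mem_sp => //; apply/flattenP; exists [seq f.1 ^+ (p ^ n) * r | r <- T' f].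
  exact: (map_f (fun f => [seq f.1 ^+ (p ^ n) * r | r <- T' f])).
by rewrite /T' fm.
Qed.

Lemma HKd_eq_of_tight_closure (K : realType) I J e :
  krull_dim K [set (0 : R)] = e.+2%:R%:E ->
  hideal I -> hideal J -> I `<=` J -> J `<=` tight_closure p I ->
  HKd p e.+2 Rg I = HKd p e.+2 Rg J :> (K -> K).
Proof.
move=> hd hI hJ IJ Jtc; apply/funext => x; rewrite /HKd /=.
have p2 : (1 < p)%N by apply: prime_gt1; apply: p_prime.
have pn n : (0 < p ^ n)%N by apply: pX_gt0.
have [C [n0 hC]] := tight_closure_hilb hd hI hJ IJ Jtc.
(* An integer bound on x, so that the degree floor(x * q) is at most X * q. *)
pose X := Num.bound `|x|.
have xX : x <= X%:R.
  by apply: le_trans (ler_norm x) _; apply/ltW/archi_boundP.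
apply: (@lim_pow_close K p p2 _ _ n0 (C * X.+1 ^ e)%:R) => n nn.
have pe : 0 < ((p ^ n)%:R : K) ^+ e.+1 by rewrite exprn_gt0 // ltr0n.
have := Num.Theory.floor_le (x * (p ^ n)%:R); case: (Num.floor _) => m hm.
  rewrite !graded_length_hilb //=.
  have h1 := hC n m nn.
  have h2 : (hilb (frob n J) m <= hilb (frob n I) m)%N.
    by rewrite (hilb_frob_le n m IJ) leq_addl.
  rewrite -mulrBl normrM (gtr0_norm (x := _^-1)) ?invr_gt0 // ger0_norm ?subr_ge0 ?ler_nat //.
  rewrite -(natr_pow_split K p2 e n) mulrA ler_wpM2r ?invr_ge0 ?(ltW pe) //.
  rewrite lerBlDl -natrM -natrD ler_nat; apply: leq_trans h1 _.
  rewrite leq_add2l -!mulnA !leq_mul2l -expnMn.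
  apply/orP; right; apply: leq_expl.
  have : (m <= X * p ^ n)%N.
    rewrite -(ler_nat K) natrM; apply: le_trans hm _.
    by rewrite ler_wpM2r.
  by have := pn n; nia.
(* In negative degrees both components vanish. *)
have e0 B : ideal B -> [set (0 : R)] `&` B = [set 0].
  by move=> iB; apply/seteqP; split=> [y []//|y ->]; split=> //; apply: ideal0.
rewrite /graded_length /= !e0 // subrr normr0 divr_ge0 //.
Qed.

Lemma hilb_frob_cvg (K : realType) I e n0 delta (L : seq (R * set R)) C n1 X :
  krull_dim K [set (0 : R)] = e.+2%:R%:E -> equidimensional K R -> hideal I ->
  (forall f, f \in L -> [/\ hideal f.2, minimal_prime f.2,
     Rg (p ^ n0 * delta)%N f.1 & forall r, f.2 r -> r ^+ (p ^ n0) * f.1 = 0]) ->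
  indep (p ^ n0) [set (0 : R)] L ->
  (forall M, qd (TT (p ^ n0) setT [set (0%R : R)] L) (Rg (p ^ n0 * M)) <= C * M.+1 ^ e)%N ->
  (0 < X)%N ->
  cvg ((fun n => (hilb (frob (n1 + n) I) (X * p ^ n))%:R /
         (p ^ (n1 + n))%:R ^+ e.+1 : K) @ \oo).
Proof.
move=> hd heq hI hL iL hT X0.
pose u J n : K := (Phi J [set (0 : R)] (n1 + n + n0) (p ^ n0 * (X * p ^ n)))%:R /
  (p ^ n)%:R ^+ e.+1.
have hc J : hideal J -> cvg (u J @ \oo).
  move=> hJ; have [fs [fsJ fs_gen]] := exists_hgens hJ.
  exact: (Phi0_cvg fsJ fs_gen hd heq hL iL hT X0).
have hPhi m n : (Phi I [set (0%R : R)] n m <= Phi setT [set (0%R : R)] n m)%N.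
  apply: qd_mono => //; last exact: Phi_fin.
  move=> y [fy ym]; split=> //; rewrite -[y]mulr1.
  by apply: (ideal_mull _ (frob_ideal _ _)); apply: ideal_gen_sub; exists 1; rewrite ?expr1n.
set v := (fun n => _).
(* The decomposition over q0-th powers concerns exponents n + n0, so that convergence is obtained
   for the shifted sequence. *)
have e1 : [sequence v (n + n0)%N]_n =
    (u setT - u I) \* (fun=> ((p ^ (n1 + n0))%:R ^+ e.+1)^-1).
  apply/funext => n; rewrite /= /v !fctE /u hilb_frob_Phi.
  have -> : (n1 + (n + n0) = n1 + n + n0)%N by lia.
  have -> : (X * p ^ (n + n0) = p ^ n0 * (X * p ^ n))%N by rewrite expnD; lia.
  rewrite natrB // -mulrBl -mulrA.
  congr (_ * _); rewrite -invfM -exprMn -natrM -expnD.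
  by congr ((_ ^+ _)^-1); congr (_ ^ _)%N%:R; lia.
have : cvg ([sequence v (n + n0)%N]_n @ \oo).
  rewrite e1; apply: is_cvgM; last exact: is_cvg_cst.
  by apply: is_cvgB; apply: hc => //; apply: hideal_setT.
by move=> /cvg_ex[l]; rewrite cvg_shiftn => vl; apply/cvg_ex; exists l.
Qed.

(* Along [x = X / p ^ n1] both sequences converge, so that a gap which persists
   in the sequences is a gap between the densities. *)
Lemma tight_closure_of_HKd_eq (K : realType) I J e :
  krull_dim K [set (0 : R)] = e.+2%:R%:E -> equidimensional K R ->
  hideal I -> hideal J -> I `<=` J ->
  HKd p e.+2 Rg I = HKd p e.+2 Rg J :> (K -> K) -> J `<=` tight_closure p I.
Proof.
move=> hd heq hI hJ IJ hIJ z Jz.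
have p2 : (1 < p)%N by apply: prime_gt1; apply: p_prime.
have pn n : (0 < p ^ n)%N by apply: pX_gt0.
have [s [_ zE]] := hcomp_fin hG z; rewrite zE.
(* Tight closure is stable under sums, which reduces the claim to a homogeneous component [w]. *)
elim/big_ind: _ => [|x y|i _]; [exact: tight_closure0|exact: tight_closureD|].
have wJ : J (hc z i) by apply: hJ.2.
move: (hc z i) (hcompP hG z i) wJ => w wi Jw {zE z Jz}.
apply: tight_closure_local => P hP mP; apply: contrapT => nP.
have pP : prime_ideal P by case: mP.
have hdP : krull_dim K P = e.+2%:R%:E by rewrite (heq _ mP).
have [|n1 [X [X0 hX]]] := tight_growth (hideal_ideal hI) hP pP hdP wi.
  by move=> c nc hn; apply: nP; exists c.
have [n0 [delta [L [C [hL iL hT]]]]] := qspan_decomposition hd heq.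
have cvgX B : hideal B -> cvg ((fun n => (hilb (frob (n1 + n) B) (X * p ^ n))%:R /
    (p ^ (n1 + n))%:R ^+ e.+1 : K) @ \oo).
  by move=> hB; apply: (hilb_frob_cvg hd heq hB hL iL hT X0).
(* Here x * p ^ (n1 + n) = X * p ^ n is an integer, so that the floor is exact. *)
pose x : K := X%:R / (p ^ n1)%:R.
have HKdE B : hideal B -> HKd p e.+2 Rg B x =
    lim ((fun n => (hilb (frob (n1 + n) B) (X * p ^ n))%:R /
      (p ^ (n1 + n))%:R ^+ e.+1 : K) @ \oo).
  move=> hB; apply: cvg_lim; first exact: Rhausdorff.
  rewrite -(cvg_shiftn n1); set v := (fun n => _).
  suff -> : v = (fun n => (hilb (frob (n1 + n) B) (X * p ^ n))%:R /
    (p ^ (n1 + n))%:R ^+ e.+1) by exact: cvgX.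
  apply/funext => n; rewrite /v /= [(n1 + n)%N]addnC.
  have -> : x * (p ^ (n + n1))%:R = (X * p ^ n)%:Z%:~R.
    rewrite /x -pmulrn expnD !natrM [(p ^ n)%:R * _]mulrC mulrA divfK //.
    by rewrite pnatr_eq0 -lt0n.
  by rewrite intrKfloor graded_length_hilb.
have := congr1 (fun f => f x) hIJ; rewrite /= !HKdE // => /eqP.
rewrite -subr_eq0 -limB; [|exact: cvgX|exact: cvgX].
apply/negP; rewrite gt_eqF //.
have pe n : 0 < ((p ^ n)%:R : K) ^+ e.+1 by rewrite exprn_gt0 // ltr0n.
(* A gap of (p ^ n) ^ (e + 1) dimensions, divided by (p ^ (n1 + n)) ^ (e + 1), leaves this bound for
   every n. *)
apply: (@lt_le_trans _ _ ((p ^ n1)%:R ^+ e.+1)^-1); first by rewrite invr_gt0.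
apply: limr_ge; first by apply: is_cvgB; apply: cvgX.
apply: nearW => n; rewrite /= !fctE -mulrBl.
have [l [sl fl hl]] := hX n.
have IS : @submodule k R (frob (n1 + n) I) by exact: ideal_submodule.
have IPS : @submodule k R (addi (frob (n1 + n) I) P).
  by apply/ideal_submodule/addi_ideal => //; apply: prime_ideal_ideal.
(* The multiples of w ^ q lie in J^[q], and freeness modulo I^[q] + P implies freeness modulo
   I^[q]. *)
have gap : ((p ^ n) ^ e.+1 <= qd (frob (n1 + n) I) (Rg (X * p ^ n) `&` frob (n1 + n) J))%N.
  apply: leq_trans sl _; apply: qd_ge => //.
  - by apply: qfin_sub (Rfin (X * p ^ n)%N IS) => // y [].
  - move=> v /hl[vm [r vE]]; split=> //; rewrite vE.
    by apply: (ideal_mull _ (frob_ideal _ _)); apply: ideal_gen_sub; exists w.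
  - by apply: qfree_subl fl; apply: addil; apply: prime_ideal_ideal.
rewrite (hilb_frob_le _ _ IJ) natrD addrK.
have -> : (p ^ (n1 + n))%:R = (p ^ n1)%:R * (p ^ n)%:R :> K by rewrite expnD natrM.
rewrite exprMn invfM mulrCA.
rewrite ler_peMr ?invr_ge0 ?(ltW (pe _)) // ler_pdivlMr // mul1r -natrX ler_nat.
exact: gap.
Qed.

End Standard.

Unset Implicit Arguments.

Theorem mainTheorem6 (K : realType) (p d : nat) (k : fieldType)
    (R : comAlgType k) (Rg : nat -> set R) (I J : set R)
    (hk : perfect_char p k)
    (hR : standard_graded Rg)
    (heq : equidimensional K R)
    (hd : (2 <= d)%N)
    (hdim : krull_dim K [set (0 : R)] = d%:R%:E)
    (hI : graded_ideal Rg I) (hJ : graded_ideal Rg J)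
    (hIJ : I `<=` J)
    (hlen : (colength K I < +oo)%E) :
  HKd p d Rg I = HKd p d Rg J :> (K -> K) <-> J `<=` tight_closure p I.
Proof.
have [hN hG hR0 hgen] := hR.
have Rg1 : Rg 0%N 1 by rewrite hR0; exists 1; rewrite ?scale1r.
case: d hd hdim => [//|[//|e]] _ hd.
have [hI' hJ'] := (graded_hideal hG hI, graded_hideal hG hJ).
split.
  exact: (tight_closure_of_HKd_eq hk hN Rg1 hR0 hgen hd heq hI' hJ' hIJ).
exact: (HKd_eq_of_tight_closure hk hN Rg1 hR0 hgen hd hI' hJ' hIJ).
Qed.
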